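(* For every $g\in\mathrm{BMOA}$, the integral operator $V_g$ on $H^2$ is strongly asymptotically Toeplitz, with strong asymptotic symbol $0$. For every $g\in H^\infty$, the integral operator $S_g$ on $H^2$ is strongly asymptotically Toeplitz, with strong asymptotic symbol $g$.
   Context: $\mathbb{D}$ is the open unit disk, $H^2$ is the Hardy space of $\mathbb{D}$, $H^\infty$ is the algebra of bounded holomorphic functions on $\mathbb{D}$. $\mathrm{BMOA}$ is the space of functions in $H^2$ whose boundary values have bounded mean oscillation on the unit circle $\mathbb{T}$. For $g$ holomorphic in $\mathbb{D}$, $V_gf(z)=\int_0^z f(u)g'(u)\,du$ and $S_gf(z)=\int_0^z f'(u)g(u)\,du$. $V_g$ is bounded on $H^2$ iff $g\in\mathrm{BMOA}$; $S_g$ is bounded on $H^2$ iff $g\in H^\infty$. The shift $S$ on $H^2$ is $Sf(z)=zf(z)$ and $S^*f(z)=(f(z)-f(0))/z$ is its adjoint (this $S$ is not to be confused with $S_g$). For $b\in L^\infty(\mathbb{T})$, the Toeplitz operator $T_b$ on $H^2$ is $T_bf=P_+(bf)$, where $P_+$ is the orthogonal projection of $L^2(\mathbb{T})$ onto $H^2$. A bounded operator $T$ on $H^2$ is strongly asymptotically Toeplitz if $\{S^{*n}TS^n\}_n$ converges in the strong operator topology; the limit is then a Toeplitz operator $T_b$ with $b\in L^\infty(\mathbb{T})$, and $b$ is called the (strong) asymptotic symbol of $T$. *)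

(* Defs.v *)
From mathcomp Require Import all_boot all_order all_algebra.
From mathcomp Require Import complex.
From mathcomp Require Import all_classical all_reals all_analysis.

Set Implicit Arguments.
Unset Strict Implicit.
Unset Printing Implicit Defensive.

Import Order.TTheory GRing.Theory Num.Theory.
Import numFieldNormedType.Exports.

Local Open Scope classical_set_scope.
Local Open Scope complex_scope.
Local Open Scope ring_scope.

(* Functions on the disk are total functions on the complex plane of which only
   the values on the disk matter: no notion below looks at the values of
   elements of H^2 elsewhere.  Functions on the unit circle are likewise total
   functions of which only the values at the points [cis t] matter. *)
Definition disk (R : realType) : set R[i] := [set z | `|z| < 1].

(* R[i]^o is R[i] as a normed module over itself, so that directional derivatives
   on it are complex derivatives. *)
Definition holomorphic_disk (R : realType) (f : R[i] -> R[i]) : Prop :=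
  forall z, disk z -> derivable (f : R[i]^o -> R[i]^o) z 1.

Definition cderiv (R : realType) (f : R[i] -> R[i]) (z : R[i]) : R[i] :=
  derive1 (f : R[i]^o -> R[i]^o) z.

Definition cis (R : realType) (t : R) : R[i] := cos t +i* sin t.

Definition cmod (R : realType) (z : R[i]) : R := Normc.normc z.

Definition Cintegral (R : realType) (A : set R) (u : R -> R[i]) : R[i] :=
  (\int[lebesgue_measure]_(t in A) complex.Re (u t)) +i*
  (\int[lebesgue_measure]_(t in A) complex.Im (u t)).

Definition H2norm (R : realType) (f : R[i] -> R[i]) : \bar R :=
  ereal_sup [set sqrte (((2 * pi)^-1)%R%:E *
     \int[lebesgue_measure]_(t in `[0%R, (2 * pi)%R])
        (cmod (f (r%:C%C * cis t)) ^+ 2)%R%:E)%E | r in `[0, 1[ ].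

Definition H2 (R : realType) (f : R[i] -> R[i]) : Prop :=
  holomorphic_disk f /\ (H2norm f < +oo)%E.

Definition Hinfty (R : realType) (f : R[i] -> R[i]) : Prop :=
  holomorphic_disk f /\ exists M : R, forall z, disk z -> cmod (f z) <= M.

(* Radial boundary value; where the radial limit does not exist (a null set of
   the circle if f is in H^2), [lim] returns an irrelevant default value. *)
Definition bval (R : realType) (f : R[i] -> R[i]) (z : R[i]) : R[i] :=
  lim ((f (r%:C * z) : R[i]^o) @[r --> (1 : R)^'-]).

Definition measurableT (R : realType) (u : R[i] -> R[i]) : Prop :=
  measurable_fun [set: R] (fun t : R => complex.Re (u (cis t))) /\
  measurable_fun [set: R] (fun t : R => complex.Im (u (cis t))).

Definition L1T (R : realType) (u : R[i] -> R[i]) : Prop :=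
  measurableT u /\
  (\int[lebesgue_measure]_(t in `[0%R, (2 * pi)%R])
     (cmod (u (cis t)))%:E < +oo)%E.

Definition L2T (R : realType) (u : R[i] -> R[i]) : Prop :=
  measurableT u /\
  (\int[lebesgue_measure]_(t in `[0%R, (2 * pi)%R])
     (cmod (u (cis t)) ^+ 2)%R%:E < +oo)%E.

Definition LinftyT (R : realType) (u : R[i] -> R[i]) : Prop :=
  measurableT u /\
  exists M : R, {ae (@lebesgue_measure R), forall t, cmod (u (cis t)) <= M}.

Definition L2dot (R : realType) (u v : R[i] -> R[i]) : R[i] :=
  ((2 * pi)^-1)%:C *
  Cintegral `[0, 2 * pi] (fun t : R => u (cis t) * (v (cis t))^*).

Definition arc_mean (R : realType) (u : R[i] -> R[i]) (a b : R) : R[i] :=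
  ((b - a)^-1)%:C * Cintegral `[a, b] (fun t : R => u (cis t)).

Definition BMO (R : realType) (u : R[i] -> R[i]) : Prop :=
  L1T u /\
  exists M : R, forall a b : R, a < b -> b <= a + 2 * pi ->
    (((b - a)^-1)%R%:E *
     \int[lebesgue_measure]_(t in `[a, b])
        (cmod (u (cis t) - arc_mean u a b)%R)%:E <= M%:E)%E.

Definition BMOA (R : realType) (g : R[i] -> R[i]) : Prop :=
  H2 g /\ BMO (bval g).

(* Linearity is required on the disk only, i.e. up to equality in H^2; with the
   norm bound, T f on the disk then depends only on f on the disk. *)
Definition bounded_operator (R : realType)
    (T : (R[i] -> R[i]) -> (R[i] -> R[i])) : Prop :=
  [/\ forall f, H2 f -> H2 (T f),
      forall (a : R[i]) f h, H2 f -> H2 h -> forall z, disk z ->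
        T (fun w => a * f w + h w) z = a * T f z + T h z &
      exists M : R, forall f, H2 f -> (H2norm (T f) <= M%:E * H2norm f)%E].

(* The path from 0 to z is t |-> t z, whose derivative is the factor z. *)
Definition segment_integral (R : realType) (F : R[i] -> R[i]) (z : R[i]) :
    R[i] :=
  Cintegral `[0, 1] (fun t : R => F (t%:C * z) * z).

Definition Vop (R : realType) (g f : R[i] -> R[i]) (z : R[i]) : R[i] :=
  segment_integral (fun u => f u * cderiv g u) z.

Definition Sop (R : realType) (g f : R[i] -> R[i]) (z : R[i]) : R[i] :=
  segment_integral (fun u => cderiv f u * g u) z.

Definition shift (R : realType) (f : R[i] -> R[i]) (z : R[i]) : R[i] :=
  z * f z.

(* The quotient (f z - f 0) / z has a removable singularity at 0. *)
Definition backward_shift (R : realType) (f : R[i] -> R[i]) (z : R[i]) :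
    R[i] :=
  if z == 0 then cderiv f 0 else (f z - f 0) / z.

(* h is the orthogonal projection P_+ u of u in L^2 onto H^2, the latter being
   embedded in L^2 by boundary values. *)
Definition is_proj_H2 (R : realType) (u h : R[i] -> R[i]) : Prop :=
  [/\ L2T u, H2 h &
      forall k, H2 k -> L2dot (fun w => u w - bval h w) (bval k) = 0].

(* A is the Toeplitz operator f |-> P_+ (b f). *)
Definition is_Toeplitz (R : realType) (b : R[i] -> R[i])
    (A : (R[i] -> R[i]) -> (R[i] -> R[i])) : Prop :=
  LinftyT b /\ forall f, H2 f -> is_proj_H2 (fun w => b w * bval f w) (A f).

Definition strong_cvg (R : realType)
    (Tn : nat -> (R[i] -> R[i]) -> (R[i] -> R[i]))
    (A : (R[i] -> R[i]) -> (R[i] -> R[i])) : Prop :=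
  forall f, H2 f ->
    H2norm (fun z => Tn n f z - A f z) @[n --> \oo] --> (0 : \bar R)%E.

Definition shift_conj (R : realType)
    (T : (R[i] -> R[i]) -> (R[i] -> R[i])) (n : nat)
    (f : R[i] -> R[i]) : R[i] -> R[i] :=
  iter n (@backward_shift R) (T (iter n (@shift R) f)).

Definition strongly_asymptotically_Toeplitz (R : realType)
    (T : (R[i] -> R[i]) -> (R[i] -> R[i])) : Prop :=
  bounded_operator T /\
  exists A, bounded_operator A /\ strong_cvg (shift_conj T) A.

Definition strong_asymptotic_symbol (R : realType)
    (T : (R[i] -> R[i]) -> (R[i] -> R[i])) (b : R[i] -> R[i]) :
    Prop :=
  exists A,
    [/\ bounded_operator A, strong_cvg (shift_conj T) A & is_Toeplitz b A].

(* Main.v *)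
Require Import Defs.
From mathcomp Require Import all_boot all_order all_algebra.
From mathcomp Require Import complex ring lra.
From mathcomp Require Import all_classical all_reals all_analysis.
From mathcomp Require Import measurable_realfun.

Set Implicit Arguments.
Unset Strict Implicit.
Unset Printing Implicit Defensive.

Import Order.TTheory GRing.Theory Num.Theory.
Import numFieldNormedType.Exports.

Local Open Scope classical_set_scope.
Local Open Scope complex_scope.
Local Open Scope ring_scope.

Local Notation Re := complex.Re.
Local Notation Im := complex.Im.
Local Notation "x ^*" := (conjc x) : ring_scope.

(* Power series computation gives both limits once the operators are bounded: the
   m-th Taylor coefficient of [S*^n V_g S^n f], resp. of [S*^n S_g S^n f - g f], is
   m / (n + m) times the m-th coefficient of [V_g f], resp. of [S_g f - g f], and
   these coefficients are square summable.

   Boundedness comes from comparing [m2 h r] with the integral of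
   [(1 - s) * m2 h' s] (Littlewood-Paley).  For [S_g] this suffices, as |f' g| is at
   most M |f'|.  For [V_g] no Carleson measure is used: by John-Nirenberg (proved
   with a dyadic stopping time) the Poisson integral of |g|^2 exceeds |g|^2 by at
   most a constant K.  Let U be holomorphic with real part that Poisson integral,
   F = exp (- U / 2) f and G_j = g^j F / sqrt (j!).  Then sum_j |G_j|^2 is at most
   |f|^2, whereas sum_j |G_j'|^2 is at least exp (|g|^2) |F g'|^2, hence at least
   exp (- K) |f g'|^2: the function f g' is dominated by derivatives of functions
   whose square means are dominated by those of f.

   Boundary values exist almost everywhere by the Hardy-Littlewood maximal
   inequality; the product rule for radial limits then identifies f |-> g f as the
   Toeplitz operator of symbol [bval g]. *)

(** The weights [1 / j!] come from an identity. Write X = |g|^2. Over all j, the sum of |G_j|^2 is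
    exp (X) |F|^2, and the sum of |G_j'|^2 is exp (X) (|F g'|^2 + |F' + conj(g) g' F|^2). The
    exponent must be controlled from both sides: X <= Re U keeps the G_j small, Re U <= X + const
    keeps their derivatives large. X itself cannot serve as Re U, since it is not harmonic and exp
    (- U / 2) must be holomorphic; the gap between X and its Poisson integral is what bounded mean
    oscillation controls.

    Littlewood-Paley is applied to finitely many functions, so the exponential series is truncated
    at a level depending on the radius; a factor 2 in the constant pays for this. Its weighted
    radial integral is only ever taken of polynomials: Parseval is used for partial sums with
    geometric remainders.

    The hypothesis on g concerns [bval g], a [lim]. It reaches the disk only through almost
    everywhere convergence, L^2 convergence of the dilates and the Poisson formula for boundary
    values. *)

Section cmod_theory.
Context {R : realType}.
Implicit Types (x y : R) (z w : R[i]).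

Lemma ReD z w : Re (z + w) = Re z + Re w. Proof. by case: z w => [??] []. Qed.
Lemma ImD z w : Im (z + w) = Im z + Im w. Proof. by case: z w => [??] []. Qed.
Lemma ReN z : Re (- z) = - Re z. Proof. by case: z. Qed.
Lemma ImN z : Im (- z) = - Im z. Proof. by case: z. Qed.
Lemma ReB z w : Re (z - w) = Re z - Re w. Proof. by rewrite ReD ReN. Qed.
Lemma ImB z w : Im (z - w) = Im z - Im w. Proof. by rewrite ImD ImN. Qed.
Lemma ReM z w : Re (z * w) = Re z * Re w - Im z * Im w.
Proof. by case: z w => [??] []. Qed.
Lemma ImM z w : Im (z * w) = Re z * Im w + Im z * Re w.
Proof. by case: z w => [??] []. Qed.

Lemma complex_ext z w : Re z = Re w -> Im z = Im w -> z = w.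
Proof. by case: z w => [??] [??] /= -> ->. Qed.

Lemma sqr_cmod z : cmod z ^+ 2 = Re z ^+ 2 + Im z ^+ 2.
Proof. by case: z => x y; rewrite /cmod /= sqr_sqrtr ?addr_ge0 ?sqr_ge0. Qed.

Lemma cmod_ge0 z : 0 <= cmod z.
Proof. by case: z => x y; rewrite /cmod /= sqrtr_ge0. Qed.

Lemma cmodR x : cmod x%:C = `|x|.
Proof. by rewrite /cmod /= expr0n addr0 sqrtr_sqr. Qed.

Lemma cmod0 : cmod (0 : R[i]) = 0. Proof. exact: Normc.normc0. Qed.
Lemma cmod1 : cmod (1 : R[i]) = 1. Proof. exact: Normc.normc1. Qed.

Lemma cmod_eq0 z : (cmod z == 0) = (z == 0).
Proof.
by apply/eqP/eqP => [/Normc.eq0_normc|->]; rewrite ?cmod0.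
Qed.

Lemma cmod_gt0 z : (0 < cmod z) = (z != 0).
Proof. by rewrite lt0r cmod_eq0 cmod_ge0 andbT. Qed.

Lemma cmodM z w : cmod (z * w) = cmod z * cmod w. Proof. exact: Normc.normcM. Qed.
Lemma cmodN z : cmod (- z) = cmod z. Proof. exact: normcN. Qed.
Lemma cmodV z : cmod z^-1 = (cmod z)^-1. Proof. exact: Normc.normcV. Qed.
Lemma cmodD z w : cmod (z + w) <= cmod z + cmod w. Proof. exact: le_normcD. Qed.
Lemma cmodX z n : cmod (z ^+ n) = cmod z ^+ n.
Proof. by elim: n => [|n IH]; rewrite ?expr0 ?cmod1 // !exprS cmodM IH. Qed.
Lemma cmodB z w : cmod (z - w) = cmod (w - z).
Proof. by rewrite -cmodN opprB. Qed.
Lemma cmodB_le z w : cmod (z - w) <= cmod z + cmod w.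
Proof. by rewrite -(cmodN w); exact: cmodD. Qed.
Lemma cmodDB z w u : cmod (z - w) <= cmod (z - u) + cmod (u - w).
Proof. by apply: le_trans (cmodD _ _); rewrite addrA subrK. Qed.
Lemma ler_cmodB z w : cmod z - cmod w <= cmod (z - w).
Proof. by rewrite lerBlDr; apply: le_trans (cmodD _ _); rewrite subrK. Qed.

Lemma cmodJ z : cmod z^* = cmod z.
Proof. by case: z => x y; rewrite /cmod /= sqrrN. Qed.

Lemma Re_le_cmod z : `|Re z| <= cmod z.
Proof.
rewrite -(ler_pXn2r (n := 2)) ?nnegrE ?cmod_ge0 // sqr_cmod real_normK ?num_real //.
by rewrite lerDl sqr_ge0.
Qed.

Lemma Im_le_cmod z : `|Im z| <= cmod z.
Proof.
rewrite -(ler_pXn2r (n := 2)) ?nnegrE ?cmod_ge0 // sqr_cmod real_normK ?num_real //.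
by rewrite lerDr sqr_ge0.
Qed.

Lemma cmod_le_ReIm z : cmod z <= `|Re z| + `|Im z|.
Proof.
rewrite {1}[z]complexE; apply: le_trans (cmodD _ _) _.
by rewrite cmodM !cmodR [cmod 'i]/cmod /= expr0n expr1n add0r sqrtr1 mul1r.
Qed.

Lemma cmod_sum I (r : seq I) (P : pred I) (F : I -> R[i]) :
  cmod (\sum_(i <- r | P i) F i) <= \sum_(i <- r | P i) cmod (F i).
Proof.
elim/big_rec2: _ => [|i y1 y2 _ le]; first by rewrite cmod0.
by apply: le_trans (cmodD _ _) _; rewrite lerD2l.
Qed.

Lemma mulcJ z : z * z^* = (cmod z ^+ 2)%:C.
Proof. by rewrite sqr_cmod; apply: complex_ext; case: z => x y /=; ring. Qed.

Lemma conjcM z w : (z * w)^* = z^* * w^*. Proof. exact: rmorphM. Qed.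
Lemma conjcX z n : (z ^+ n)^* = z^* ^+ n. Proof. exact: rmorphXn. Qed.

Lemma diskE z : disk z = (cmod z < 1) :> Prop.
Proof. by rewrite /disk /= -(ltcR (cmod z) 1). Qed.

Lemma cmod_ge_natr n : cmod (n%:R : R[i]) = n%:R.
Proof.
have -> : (n%:R : R[i]) = (n%:R : R)%:C by rewrite rmorph_nat.
by rewrite cmodR ger0_norm.
Qed.

Lemma cmod_cis x : cmod (cis x) = 1.
Proof. by rewrite /cmod /cis /= cos2Dsin2 sqrtr1. Qed.

Lemma cisD x y : cis (x + y) = cis x * cis y.
Proof. by apply: complex_ext; rewrite /cis /= ?cosD ?sinD; ring. Qed.

Lemma cis0 : cis 0 = 1 :> R[i].
Proof. by apply: complex_ext; rewrite /cis /= ?cos0 ?sin0. Qed.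

Lemma cisN x : cis (- x) = (cis x)^*.
Proof. by apply: complex_ext; rewrite /cis /= ?cosN ?sinN. Qed.

Lemma cisX x n : cis x ^+ n = cis (x *+ n).
Proof. by elim: n => [|n IH]; rewrite ?expr0 ?mulr0n ?cis0 // exprS IH mulrS cisD. Qed.

Lemma cis_periodic x : cis (x + 2 * pi) = cis x.
Proof.
rewrite cisD [X in _ * X](_ : _ = 1) ?mulr1 // mulr_natl.
by apply: complex_ext; rewrite /cis /= ?cos2pi ?sin2pi.
Qed.

End cmod_theory.

(** * Complex differentiability *)

Section cdiff.
Context {R : realType}.
Implicit Types (f g : R[i] -> R[i]) (z w d : R[i]).

(** The little-o form of the complex derivative: without a difference quotient the increment 0 needs
    no exclusion, which keeps the product and chain rules free of case distinctions. *)
Definition cdiff f z d := forall e : R, 0 < e -> exists2 r : R, 0 < r &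
  forall h, cmod h < r -> cmod (f (z + h) - f z - d * h) <= e * cmod h.

Lemma posC_real (e : R[i]) : 0 < e -> exists2 x : R, 0 < x & e = x%:C.
Proof. by case: e => x y; rewrite ltcE /= => /andP[/eqP -> x0]; exists x. Qed.

Lemma cvg_cdiff f z d : cdiff f z d <->
  (fun h : R[i]^o => h^-1 *: ((f : R[i]^o -> R[i]^o) (h + z) - f z) : R[i]^o) @ 0^' --> (d : R[i]^o).
Proof.
split=> [fd|fd e e0].
  apply/cvgrPdist_le => e /posC_real[x x0 ->].
  have [r r0 fr] := fd _ x0.
  rewrite /at_right near_withinE; near=> h => h0.
  have hr : cmod h < r.
    rewrite -ltcR.
    have -> : (cmod h)%:C = `|0 - h| by rewrite sub0r normrN.
    by near: h; apply: nbhsx_ballx; rewrite ltcR.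
  rewrite -[`|_|]/((cmod _)%:C) lecR.
  have -> : d - h^-1 *: (f (h + z) - f z) = - (h^-1 * (f (z + h) - f z - d * h)).
    by rewrite /GRing.scale /= [h + z]addrC; field.
  rewrite cmodN cmodM cmodV mulrC ler_pdivrMr ?cmod_gt0 //.
  exact: fr.
have /cvgrPdist_le/(_ e%:C) := fd.
rewrite ltcR => /(_ e0); rewrite near_withinE => /nbhs_ballP[_ /posC_real[r r0 ->]] hr.
exists r => // h hhr; have [->|h0] := eqVneq h 0.
  by rewrite addr0 subrr sub0r mulr0 cmodN cmod0 mulr0.
have := hr h; rewrite /ball /= sub0r normrN -[`|_|]/((cmod h)%:C) ltcR => /(_ hhr h0).
rewrite -[`|_|]/((cmod _)%:C) lecR.
have -> : d - h^-1 *: (f (h + z) - f z) = - (h^-1 * (f (z + h) - f z - d * h)).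
  by rewrite /GRing.scale /= [h + z]addrC; field.
by rewrite cmodN cmodM cmodV mulrC ler_pdivrMr ?cmod_gt0.
Unshelve. all: by end_near. Qed.

Lemma cdiff_cderiv f z d : cdiff f z d ->
  derivable (f : R[i]^o -> R[i]^o) z 1 /\ cderiv f z = d.
Proof.
move=> /cvg_cdiff fd; split; last first.
  exact: (@cvg_lim _ (@norm_hausdorff _ R[i]^o) _ _ _ _ _ fd).
apply/cvg_ex; exists d; apply: cvg_trans fd; apply: near_eq_cvg.
by apply: nearW => h /=; rewrite /GRing.scale /= mulr1.
Qed.

Lemma derivable_cdiff f z : derivable (f : R[i]^o -> R[i]^o) z 1 ->
  cdiff f z (cderiv f z).
Proof.
move=> fz; apply/cvg_cdiff; rewrite /cderiv /derive1.
apply/cvg_ex; move/cvg_ex : fz => [l fl]; exists l.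
apply: cvg_trans fl; apply: near_eq_cvg.
by apply: nearW => h /=; rewrite /GRing.scale /= mulr1.
Qed.

Lemma cdiff_ext f g z d (r : R) : 0 < r ->
  (forall w, cmod (w - z) < r -> f w = g w) -> cdiff f z d -> cdiff g z d.
Proof.
move=> r0 fg fd e e0; have [s s0 fs] := fd _ e0.
exists (Num.min r s) => [|h]; rewrite ?lt_min ?r0 // => /andP[hr hs].
have zh : z + h - z = h by ring.
have zz : z - z = 0 by ring.
rewrite -(fg (z + h)) ?zh // -(fg z) ?zz ?cmod0 //.
exact: fs.
Qed.

Lemma cdiff_cont f z d : cdiff f z d -> forall e : R, 0 < e ->
  exists2 r : R, 0 < r & forall h, cmod h < r -> cmod (f (z + h) - f z) <= e.
Proof.
move=> fd e e0; have [r r0 fr] := fd 1 ltr01.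
have D0 : 0 < 1 + cmod d by rewrite ltr_pwDl // cmod_ge0.
exists (Num.min r (e / (1 + cmod d))) => [|h].
  by rewrite lt_min r0 divr_gt0.
rewrite lt_min => /andP[hr he].
have -> : f (z + h) - f z = (f (z + h) - f z - d * h) + d * h by rewrite subrK.
apply: le_trans (cmodD _ _) _; rewrite cmodM.
apply: le_trans (_ : (1 + cmod d) * cmod h <= _).
  by rewrite mulrDl lerD2r; exact: fr.
by rewrite mulrC -ler_pdivlMr // ltW.
Qed.

Lemma cdiff_cst (c z : R[i]) : cdiff (fun=> c) z 0.
Proof. by move=> e e0; exists 1 => // h _; rewrite subrr mul0r subrr cmod0 mulr_ge0 ?cmod_ge0 // ltW. Qed.

Lemma cdiff_id z : cdiff id z 1.
Proof.
move=> e e0; exists 1 => // h _.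
have -> : id (z + h) - id z - 1 * h = 0 by rewrite /=; ring.
by rewrite cmod0 mulr_ge0 ?cmod_ge0 // ltW.
Qed.

Lemma cdiffD f g z df dg : cdiff f z df -> cdiff g z dg ->
  cdiff (fun w => f w + g w) z (df + dg).
Proof.
move=> fd gd e e0; have e2 : 0 < e / 2 by rewrite divr_gt0.
have [r r0 fr] := fd _ e2; have [s s0 gs] := gd _ e2.
exists (Num.min r s) => [|h]; rewrite ?lt_min ?r0 // => /andP[hr hs].
have -> : f (z + h) + g (z + h) - (f z + g z) - (df + dg) * h =
  (f (z + h) - f z - df * h) + (g (z + h) - g z - dg * h) by ring.
apply: le_trans (cmodD _ _) _.
by rewrite [e]splitr mulrDl lerD ?fr ?gs.
Qed.

Lemma cdiffM f g z df dg : cdiff f z df -> cdiff g z dg ->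
  cdiff (fun w => f w * g w) z (df * g z + f z * dg).
Proof.
move=> fd gd e e0.
(* [K] dominates the bounded factor in each of the three error terms below, so each of them costs at
   most [e / 3 * cmod h]. *)
pose K := 1 + cmod df + cmod (g z) + cmod (f z).
have K0 : 0 < K by rewrite /K -!addrA ltr_pwDl // !addr_ge0 ?cmod_ge0.
have e3 : 0 < e / 3 / K by rewrite !divr_gt0.
have [r r0 fr] := fd _ e3; have [s s0 gs] := gd _ e3.
have m0 : 0 < Num.min 1 (e / 3 / K) by rewrite lt_min e3 ltr01.
have [t t0 gt] := cdiff_cont gd m0.
exists (Num.min t (Num.min r s)) => [|h]; rewrite ?lt_min ?r0 ?s0 ?t0 // => /and3P[ht hr hs].
have -> : f (z + h) * g (z + h) - f z * g z - (df * g z + f z * dg) * h =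
  (f (z + h) - f z - df * h) * g (z + h) + f z * (g (z + h) - g z - dg * h)
  + df * h * (g (z + h) - g z) by ring.
have := gt _ ht; rewrite le_min => /andP[g1 g2].
have gK : cmod (g (z + h)) <= K.
  have -> : g (z + h) = (g (z + h) - g z) + g z by rewrite subrK.
  apply: le_trans (cmodD _ _) _; rewrite /K.
  have := cmod_ge0 df; have := cmod_ge0 (f z); lra.
have fK : cmod (f z) <= K.
  rewrite /K; have := cmod_ge0 df; have := cmod_ge0 (g z); lra.
have dK : cmod df <= K.
  rewrite /K; have := cmod_ge0 (f z); have := cmod_ge0 (g z); lra.
have E3 : e / 3 / K * cmod h * K = e / 3 * cmod h.
  by rewrite -mulrA (mulrC (cmod h)) mulrA divfK // gt_eqF.
have -> : e * cmod h = e / 3 * cmod h + e / 3 * cmod h + e / 3 * cmod h by field.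
apply: le_trans (cmodD _ _) _; apply: lerD.
  apply: le_trans (cmodD _ _) _; rewrite !cmodM; apply: lerD.
    rewrite -E3; apply: ler_pM => //; rewrite ?cmod_ge0 //; exact: fr.
  rewrite -E3 mulrC; apply: ler_pM => //; rewrite ?cmod_ge0 //; exact: gs.
rewrite !cmodM -E3 -mulrA mulrC; apply: ler_pM; rewrite ?mulr_ge0 ?cmod_ge0 //.
by rewrite mulrC ler_wpM2r ?cmod_ge0.
Qed.

Lemma cdiff_comp f g z df dg : cdiff f z df -> cdiff g (f z) dg ->
  cdiff (fun w => g (f w)) z (dg * df).
Proof.
move=> fd gd e e0.
pose K := 1 + cmod df + cmod dg.
have K1 : 1 <= K by rewrite /K; have := cmod_ge0 df; have := cmod_ge0 dg; lra.
have K0 : 0 < K by rewrite (lt_le_trans ltr01).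
have e2 : 0 < e / 2 / K by rewrite !divr_gt0.
have [s s0 gs] := gd _ e2.
have m0 : 0 < Num.min 1 (e / 2 / K) by rewrite lt_min e2 ltr01.
have [r r0 fr] := fd _ m0.
have s2 : 0 < s / 2 by rewrite divr_gt0.
have [t t0 ft] := cdiff_cont fd s2.
exists (Num.min t r) => [|h]; rewrite ?lt_min ?r0 ?t0 // => /andP[ht hr].
set k := f (z + h) - f z.
have fk : f (z + h) = f z + k by rewrite /k; ring.
have fr1 := fr _ hr.
have kK : cmod k <= K * cmod h.
  have -> : k = (k - df * h) + df * h by rewrite subrK.
  apply: le_trans (cmodD _ _) _.
  apply: (@le_trans _ _ (1 * cmod h + cmod df * cmod h)).
    rewrite cmodM lerD2r; apply: le_trans fr1 _.
    by rewrite ler_wpM2r ?cmod_ge0 // ge_min lexx.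
  by rewrite -mulrDl ler_wpM2r ?cmod_ge0 // /K lerDl cmod_ge0.
rewrite fk.
have -> : g (f z + k) - g (f z) - dg * df * h =
   (g (f z + k) - g (f z) - dg * k) + dg * (k - df * h) by ring.
apply: le_trans (cmodD _ _) _.
rewrite [e]splitr mulrDl; apply: lerD.
  apply: le_trans (gs _ _) _.
    by apply: le_lt_trans (ft _ ht) _; rewrite ltr_pdivrMr // mulrDr mulr1 ltrDl.
  apply: le_trans (ler_wpM2l (ltW e2) kK) _.
  by rewrite mulrA divfK // gt_eqF.
rewrite cmodM; apply: (@le_trans _ _ (K * (e / 2 / K * cmod h))).
  apply: ler_pM; rewrite ?cmod_ge0 //.
    by rewrite /K lerDr addr_ge0 ?cmod_ge0.
  apply: le_trans fr1 _.
  by rewrite ler_wpM2r ?cmod_ge0 // ge_min lexx orbT.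
have K00 : K != 0 by rewrite gt_eqF.
by rewrite (_ : K * _ = e / 2 * cmod h) //; field.
Qed.

End cdiff.

(** * Integrals of real functions over compact intervals *)

Section real_interval_integral.
Context {R : realType}.
Implicit Types (a b c x : R) (u v : R -> R).
Notation mu := (@lebesgue_measure R).

Definition intble a b u : Prop := mu.-integrable `[a, b]%classic (EFin \o u).
Definition rint a b u : R := \int[mu]_(t in `[a, b]) u t.

Lemma mitv a b : measurable (`[a, b]%classic : set (measurableTypeR R)).
Proof. exact: measurable_itv. Qed.
Local Hint Resolve mitv : core.

Lemma mu_itv a b : a <= b -> mu `[a, b]%classic = (b - a)%:E.
Proof.
move=> ab; rewrite lebesgue_measure_itv /= lte_fin.
by case: ltgtP ab => // ->; rewrite subrr.
Qed.

Lemma mu_itv_lty a b : (mu `[a, b]%classic < +oo)%E.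
Proof.
rewrite lebesgue_measure_itv /= lte_fin; case: ifPn => // _.
by rewrite -EFinB ltry.
Qed.

Lemma intbleD a b u v : intble a b u -> intble a b v -> intble a b (fun x => u x + v x).
Proof.
move=> iu iv; have /= := integrableD (mitv a b) iu iv.
by apply: eq_integrable => //= x _; rewrite EFinD.
Qed.

Lemma intbleZ a b k u : intble a b u -> intble a b (fun x => k * u x).
Proof.
move=> iu; have := integrableZl (mitv a b) k iu.
by apply: eq_integrable => //= x _; rewrite EFinM.
Qed.

Lemma intbleN a b u : intble a b u -> intble a b (fun x => - u x).
Proof.
move=> /(intbleZ (-1)); congr (intble _ _ _).
by apply/funext => x; rewrite mulN1r.
Qed.

Lemma intbleB a b u v : intble a b u -> intble a b v -> intble a b (fun x => u x - v x).
Proof. by move=> iu /intbleN; exact: intbleD. Qed.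

Lemma intble_cst a b k : intble a b (fun=> k).
Proof.
apply: measurable_bounded_integrable => //; first exact: mu_itv_lty.
exact: bounded_cst.
Qed.

Lemma intble_meas a b u : intble a b u -> measurable_fun `[a, b]%classic u.
Proof. by move=> /integrableP[/measurable_EFinP]. Qed.

Lemma intble_dom a b u v : measurable_fun `[a, b]%classic u -> intble a b v ->
  (forall x, a <= x <= b -> `|u x| <= v x) -> intble a b u.
Proof.
move=> mu_ iv uv; apply: (le_integrable (mitv a b) _ _ iv).
  exact/measurable_EFinP.
move=> x /=; rewrite in_itv /= => xab; rewrite lee_fin.
by apply: le_trans (uv _ xab) _; exact: ler_norm.
Qed.

Lemma intble_norm a b u : intble a b u -> intble a b (fun x => `|u x|).
Proof. exact: integrable_norm. Qed.

Lemma intble_bounded a b u (M : R) : measurable_fun `[a, b]%classic u ->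
  (forall x, a <= x <= b -> `|u x| <= M) -> intble a b u.
Proof. by move=> mu_ uM; apply: intble_dom mu_ (intble_cst a b M) uM. Qed.

Lemma intble_cont a b u : {within `[a, b], continuous u} -> intble a b u.
Proof. by move=> cu; apply: continuous_compact_integrable => //; exact: segment_compact. Qed.

Lemma intble_sub a b c d u : a <= c -> d <= b -> intble a b u -> intble c d u.
Proof.
move=> ac db; apply: integrableS => //= x /=; rewrite !in_itv /= => /andP[cx xd].
by rewrite (le_trans ac) //= (le_trans xd).
Qed.

Lemma eq_intble a b u v : (forall x, a <= x <= b -> u x = v x) -> intble a b u -> intble a b v.
Proof.
by move=> uv; apply: eq_integrable => //= x; rewrite inE /= in_itv /= => /uv ->.
Qed.

Lemma eq_rint a b u v : (forall x, a <= x <= b -> u x = v x) -> rint a b u = rint a b v.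
Proof. by move=> uv; apply: eq_Rintegral => x; rewrite inE /= in_itv /= => /uv. Qed.

Lemma rintD a b u v : intble a b u -> intble a b v ->
  rint a b (fun x => u x + v x) = rint a b u + rint a b v.
Proof. exact: RintegralD. Qed.

Lemma rintB a b u v : intble a b u -> intble a b v ->
  rint a b (fun x => u x - v x) = rint a b u - rint a b v.
Proof. exact: RintegralB. Qed.

Lemma rintZ a b k u : intble a b u -> rint a b (fun x => k * u x) = k * rint a b u.
Proof. exact: RintegralZl. Qed.

Lemma rint_cst a b k : a <= b -> rint a b (fun=> k) = k * (b - a).
Proof. by move=> ab; rewrite /rint Rintegral_cst // [X in fine X](mu_itv ab). Qed.

Lemma rint_ge0 a b u : (forall x, a <= x <= b -> 0 <= u x) -> 0 <= rint a b u.
Proof. by move=> u0; apply: Rintegral_ge0 => x /=; rewrite in_itv /= => /u0. Qed.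

Lemma le_rint a b u v : intble a b u -> intble a b v ->
  (forall x, a <= x <= b -> u x <= v x) -> rint a b u <= rint a b v.
Proof. by move=> iu iv uv; apply: le_Rintegral => // x /=; rewrite in_itv /= => /uv. Qed.

Lemma le_norm_rint a b u : intble a b u -> `|rint a b u| <= rint a b (fun x => `|u x|).
Proof. exact: le_normr_Rintegral. Qed.

Lemma rint_EFin a b u : intble a b u -> (\int[mu]_(x in `[a, b]) (u x)%:E)%E = (rint a b u)%:E.
Proof. by move=> iu; rewrite /rint /Rintegral fineK //; exact: integrable_fin_num. Qed.

Lemma intble_ge0P a b u : measurable_fun `[a, b]%classic u ->
  (forall x, a <= x <= b -> 0 <= u x) ->
  (\int[mu]_(x in `[a, b]) (u x)%:E < +oo)%E -> intble a b u.
Proof.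
move=> mu_ u0 ufin; apply/integrableP; split; first exact/measurable_EFinP.
apply: le_lt_trans ufin; rewrite le_eqVlt; apply/orP; left; apply/eqP.
apply: eq_integral => x; rewrite inE /= in_itv /= => /u0 u0x.
by rewrite ger0_norm.
Qed.

Lemma rint_cat a b c u : a <= c -> c <= b -> intble a b u ->
  rint a b u = rint a c u + rint c b u.
Proof.
move=> ac cb iu.
have E : rint a b u - rint a c u = \int[mu]_(x in `]c, b]) u x.
  by apply: (@Rintegral_itvB R u (BLeft a) (BRight b) c iu); rewrite bnd_simp.
apply/eqP; rewrite addrC -subr_eq; apply/eqP; rewrite E.
rewrite Rintegral_itv_obnd_cbnd //.
apply: integrableS iu => //= x /=; rewrite !in_itv /= => /andP[cx ->].
by rewrite (le_trans ac (ltW cx)).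
Qed.

Lemma itv_cat a b c : a <= c -> c <= b -> `[a, b]%classic = `[a, c]%classic `|` `[c, b]%classic.
Proof.
move=> ac cb; apply/seteqP; split=> x /=; rewrite !in_itv /=.
  by move=> /andP[ax xb]; have [xc|/ltW cx] := leP x c; [left|right]; rewrite ?ax ?xb ?cx.
by case=> /andP[h1 h2]; rewrite ?h1 ?h2 ?(le_trans h2) ?(le_trans ac) //.
Qed.

Lemma intble_cat a b c u : intble a c u -> intble c b u -> intble a b u.
Proof.
have [ac|ca] := leP a c; last first.
  by move=> _; apply: intble_sub => //; exact: ltW.
have [cb|bc] := leP c b; last first.
  by move=> + _; apply: intble_sub => //; exact: ltW.
move=> iac icb; have mub : measurable_fun `[a, b]%classic u.
  rewrite (itv_cat ac cb); apply/measurable_funU => //.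
  by split; exact: intble_meas.
apply/integrableP; split; first exact/measurable_EFinP.
have E : `[a, b]%classic = `[a, c]%classic `|` `]c, b]%classic :> set R.
  apply/seteqP; split=> x /=; rewrite !in_itv /=.
    by move=> /andP[ax xb]; case: (leP x c) => xc; [left|right]; rewrite ?ax ?xb.
  by case=> /andP[h1 h2]; rewrite ?h1 ?h2 ?(le_trans h2) ?(le_trans ac (ltW h1)).
rewrite E ge0_integral_setU //=.
- apply: lte_add_pinfty; first by case/integrableP: iac.
  have /integrableP[_] : mu.-integrable `]c, b]%classic (EFin \o u).
    apply: integrableS icb => //= x /=; rewrite !in_itv /= => /andP[/ltW -> ->] //.
  exact.
- rewrite -E; apply/measurable_EFinP; exact: measurableT_comp.
- apply/disj_setPS => x /=; rewrite !in_itv /= => -[/andP[_ xc] /andP[cx _]].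
  by move: cx; rewrite ltNge xc.
Qed.

Lemma measurable_fun_shift u h : measurable_fun [set: R] u ->
  measurable_fun [set: R] (fun x => u (x + h)).
Proof.
move=> mu_; apply: measurableT_comp => //.
by apply: measurable_funD.
Qed.

(** Lebesgue measure is determined by its values on half-open intervals, and these are preserved by
    translation. *)
Lemma lebesgue_measure_shift h (A : set R) : measurable A ->
  pushforward mu ((fun x => x + h) : _ -> measurableTypeR R) A = mu A.
Proof.
move=> mA; have mh : measurable_fun [set: R] (fun x : R => x + h) by exact: measurable_funD.
apply/esym/lebesgue_measure_unique => //= _ [[a b]] _ <-.
have E : (fun x : R => x + h) @^-1` `]a, b]%classic = `]a - h, b - h]%classic.
  by apply/seteqP; split=> x /=; rewrite !in_itv /= ltrBlDr lerBrDr.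
rewrite /pushforward /= E !lebesgue_measure_itv/= !lte_fin.
by rewrite ltrD2r -!EFinB opprB addrA subrK.
Qed.

Lemma preimage_shift_itv a b h :
  (fun x : R => x + h) @^-1` `[a + h, b + h]%classic = `[a, b]%classic.
Proof. by apply/seteqP; split=> x /=; rewrite !in_itv /= !lerD2r. Qed.

Lemma shift_pushforward h (A : set R) : measurable A ->
  (mu : set (measurableTypeR R) -> _) A = pushforward mu ((fun x => x + h) : _ -> measurableTypeR R) A.
Proof. by move=> mA; rewrite lebesgue_measure_shift. Qed.

Lemma intble_shift a b h u : measurable_fun [set: R] u ->
  intble a b (fun x => u (x + h)) <-> intble (a + h) (b + h) u.
Proof.
have suf a' b' h' u' : measurable_fun [set: R] u' ->
    intble a' b' (fun x => u' (x + h')) -> intble (a' + h') (b' + h') u'.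
  move=> mu' iu'; have mh : measurable_fun [set: R] (fun x : R => x + h') by exact: measurable_funD.
  have /integrableP[m' i'] := @integrable_pushforward _ _ (measurableTypeR R) (measurableTypeR R) R
    (fun x : R => x + h') mh mu `[a' + h', b' + h']%classic (EFin \o u')
    ltac:(exact/measurable_EFinP) ltac:(rewrite preimage_shift_itv; exact: iu') (mitv _ _).
  apply/integrableP; split => //; apply: le_lt_trans i'.
  rewrite le_eqVlt; apply/orP; left; apply/eqP.
  apply: eq_measure_integral => A mA _; exact: shift_pushforward.
move=> mu_; split; first exact: suf.
move=> iu; have := suf (a + h) (b + h) (- h) (fun x => u (x + h)).
rewrite !addrK; apply; first exact: measurable_fun_shift.
apply: eq_intble iu => x _; by rewrite subrK.
Qed.

Lemma rint_shift a b h u : measurable_fun [set: R] u ->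
  intble a b (fun x => u (x + h)) ->
  rint (a + h) (b + h) u = rint a b (fun x => u (x + h)).
Proof.
move=> mu_ iu; have mh : measurable_fun [set: R] (fun x : R => x + h) by exact: measurable_funD.
rewrite /rint /Rintegral; congr fine.
have := @integral_pushforward _ _ (measurableTypeR R) (measurableTypeR R) R
    (fun x : R => x + h) mh mu `[a + h, b + h]%classic (EFin \o u)
    ltac:(exact/measurable_EFinP) ltac:(rewrite preimage_shift_itv; exact: iu) (mitv _ _).
rewrite preimage_shift_itv => <-.
apply: eq_measure_integral => A mA _; exact: shift_pushforward.
Qed.

Lemma intble_periodic u (T : R) : 0 < T -> measurable_fun [set: R] u ->
  (forall x, u (x + T) = u x) -> intble 0 T u -> forall a b, intble a b u.
Proof.
move=> T0 mu_ uT iu a b.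
have uTf : (fun x => u (x + T)) = u by apply/funext.
have shR n : intble 0 (T *+ n) u.
  elim: n => [|n IH]; first by apply: intble_sub iu => //; exact: ltW.
  apply: (intble_cat iu); rewrite mulrS addrC -{1}[T]add0r.
  by apply/intble_shift => //; rewrite uTf.
have shL n : intble (- (T *+ n)) 0 u.
  elim: n => [|n IH]; first by rewrite mulr0n oppr0; exact: (shR 0).
  rewrite -uTf; apply/intble_shift => //; rewrite add0r mulrS opprD addrAC addNr add0r.
  exact: intble_cat IH iu.
(* Finitely many periods on both sides of 0 cover [[a, b]]. *)
have [n an] : exists n, `|a| + `|b| <= T *+ n.
  exists (Num.bound ((`|a| + `|b|) / T)); rewrite -mulr_natl -ler_pdivrMr //.
  by apply: ltW; apply: archi_boundP; rewrite divr_ge0 ?addr_ge0 // ltW.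
apply: intble_sub (intble_cat (shL n) (shR n)).
  rewrite lerNl; apply: le_trans an; apply: le_trans (ler_norm _) _.
  by rewrite normrN lerDl.
by apply: le_trans an; apply: le_trans (ler_norm _) _; rewrite lerDr.
Qed.

(** After adding the integral between 0 and [a] to both sides, only the integrals over two intervals
    that are translates of each other by [T] have to be compared. *)
Lemma rint_periodic u (T : R) : 0 < T -> measurable_fun [set: R] u ->
  (forall x, u (x + T) = u x) -> intble 0 T u -> forall a, rint a (a + T) u = rint 0 T u.
Proof.
move=> T0 mu_ uT iu a.
have uTf : (fun x => u (x + T)) = u by apply/funext.
have ia := intble_periodic T0 mu_ uT iu.
have sh c d : rint (c + T) (d + T) u = rint c d u.
  by rewrite rint_shift ?uTf.
have [a0|/ltW a0] := leP 0 a.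
  apply: (@addrI _ (rint 0 a u)); rewrite -rint_cat ?lerDl ?(ltW T0) //.
  rewrite (@rint_cat 0 (a + T) T) ?(ltW T0) ?lerDr //.
  by rewrite -(sh 0 a) add0r addrC.
apply: (@addIr _ (rint (a + T) T u)); rewrite -rint_cat ?gerDr ?lerDl ?(ltW T0) //.
rewrite (@rint_cat a T 0) ?(ltW T0) //.
by rewrite -(sh a 0) add0r addrC.
Qed.

End real_interval_integral.
#[global] Hint Resolve mitv : core.

(** * Integrals of complex functions over compact intervals *)

Section complex_interval_integral.
Context {R : realType}.
Implicit Types (a b c x : R) (u v : R -> R[i]) (k : R[i]).
Notation mu := (@lebesgue_measure R).

Definition cintble a b u := intble a b (fun t => Re (u t)) /\ intble a b (fun t => Im (u t)).
Definition cint a b u : R[i] := Cintegral `[a, b]%classic u.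
Definition cmeas (D : set R) u :=
  measurable_fun D (fun t => Re (u t)) /\ measurable_fun D (fun t => Im (u t)).

Lemma cintE a b u : cint a b u = rint a b (fun t => Re (u t)) +i* rint a b (fun t => Im (u t)).
Proof. by []. Qed.

Lemma eq_cint a b u v : (forall x, a <= x <= b -> u x = v x) -> cint a b u = cint a b v.
Proof. by move=> uv; rewrite !cintE; congr (_ +i* _); apply: eq_rint => x /uv ->. Qed.

Lemma eq_cintble a b u v : (forall x, a <= x <= b -> u x = v x) -> cintble a b u -> cintble a b v.
Proof. by move=> uv [iu iv]; split; [apply: eq_intble iu|apply: eq_intble iv] => x /uv ->. Qed.

Lemma cintbleD a b u v : cintble a b u -> cintble a b v -> cintble a b (fun t => u t + v t).
Proof.
move=> [ru iu] [rv iv]; split.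
  by apply: eq_intble (intbleD ru rv) => x _; rewrite ReD.
by apply: eq_intble (intbleD iu iv) => x _; rewrite ImD.
Qed.

Lemma cintbleZ a b k u : cintble a b u -> cintble a b (fun t => k * u t).
Proof.
move=> [ru iu]; split.
  by apply: eq_intble (intbleB (intbleZ (Re k) ru) (intbleZ (Im k) iu)) => x _; rewrite ReM.
by apply: eq_intble (intbleD (intbleZ (Re k) iu) (intbleZ (Im k) ru)) => x _; rewrite ImM.
Qed.

Lemma cintbleB a b u v : cintble a b u -> cintble a b v -> cintble a b (fun t => u t - v t).
Proof.
move=> iu /(cintbleZ (-1)) iv; apply: eq_cintble (cintbleD iu iv) => x _.
by rewrite mulN1r.
Qed.

Lemma cintble_cst a b k : cintble a b (fun=> k).
Proof. by split; exact: intble_cst. Qed.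

Lemma cintD a b u v : cintble a b u -> cintble a b v ->
  cint a b (fun t => u t + v t) = cint a b u + cint a b v.
Proof.
move=> [ru iu] [rv iv]; apply: complex_ext; rewrite ?ReD ?ImD !cintE /= -rintD //;
 apply: eq_rint => x _; by rewrite ?ReD ?ImD.
Qed.

Lemma cintZ a b k u : cintble a b u -> cint a b (fun t => k * u t) = k * cint a b u.
Proof.
move=> [ru iu]; apply: complex_ext; rewrite ?ReM ?ImM !cintE /=.
  rewrite -!rintZ // -rintB; [|exact: intbleZ|exact: intbleZ].
  by apply: eq_rint => x _; rewrite ReM.
rewrite -!rintZ // -rintD; [|exact: intbleZ|exact: intbleZ].
by apply: eq_rint => x _; rewrite ImM.
Qed.

Lemma cintB a b u v : cintble a b u -> cintble a b v ->
  cint a b (fun t => u t - v t) = cint a b u - cint a b v.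
Proof.
move=> iu iv; rewrite -[in RHS]mulN1r -cintZ // -cintD //; last exact: cintbleZ.
by apply: eq_cint => x _; rewrite mulN1r.
Qed.

Lemma cint_cst a b k : a <= b -> cint a b (fun=> k) = k * (b - a)%:C.
Proof.
move=> ab; rewrite cintE !rint_cst //.
by apply: complex_ext; rewrite ?ReM ?ImM /= mulr0 ?subr0 ?add0r.
Qed.

Lemma cintble_sum a b n (u : nat -> R -> R[i]) : (forall i, cintble a b (u i)) ->
  cintble a b (fun t => \sum_(i < n) u i t).
Proof.
move=> iu; elim: n => [|n IH].
  by apply: eq_cintble (cintble_cst a b 0) => x _; rewrite big_ord0.
by apply: eq_cintble (cintbleD IH (iu n)) => x _; rewrite big_ord_recr.
Qed.

Lemma cint_sum a b n (u : nat -> R -> R[i]) : a <= b -> (forall i, cintble a b (u i)) ->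
  cint a b (fun t => \sum_(i < n) u i t) = \sum_(i < n) cint a b (u i).
Proof.
move=> ab iu; elim: n => [|n IH].
  rewrite big_ord0 (@eq_cint _ _ _ (fun=> 0)) ?cint_cst ?mul0r // => x _.
  by rewrite big_ord0.
rewrite big_ord_recr /= -IH -cintD //; last exact: cintble_sum.
by apply: eq_cint => x _; rewrite big_ord_recr.
Qed.

Lemma cmodE (z : R[i]) : cmod z = Num.sqrt (Re z ^+ 2 + Im z ^+ 2).
Proof. by rewrite -sqr_cmod sqrtr_sqr ger0_norm // cmod_ge0. Qed.

Lemma cmeas_cmod (D : set R) u : measurable D -> cmeas D u -> measurable_fun D (fun t => cmod (u t)).
Proof.
move=> mD [ru iu].
rewrite (_ : (fun t => _) = Num.sqrt \o (fun t => Re (u t) ^+ 2 + Im (u t) ^+ 2)); last first.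
  by apply/funext => t; rewrite /= cmodE.
apply: measurableT_comp.
  by apply: continuous_measurable_fun; exact: sqrt_continuous.
by apply: measurable_funD; exact: measurable_funX.
Qed.

Lemma cintble_cmeas a b u : cintble a b u -> cmeas `[a, b]%classic u.
Proof. by move=> [ru iu]; split; exact: intble_meas. Qed.

Lemma cintble_cmod a b u : cintble a b u -> intble a b (fun t => cmod (u t)).
Proof.
move=> iu; have [ru iu'] := iu.
apply: (intble_dom _ (intbleD (intble_norm ru) (intble_norm iu'))).
  by apply: cmeas_cmod => //; exact: cintble_cmeas.
by move=> x _; rewrite ger0_norm ?cmod_ge0 ?cmod_le_ReIm.
Qed.

Lemma cintble_dom a b u (v : R -> R) : cmeas `[a, b]%classic u -> intble a b v ->
  (forall x, a <= x <= b -> cmod (u x) <= v x) -> cintble a b u.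
Proof.
move=> [ru iu] iv uv; split; apply: intble_dom iv _ => // x /uv.
  exact: le_trans (Re_le_cmod _).
exact: le_trans (Im_le_cmod _).
Qed.

Lemma cint_le a b u : cintble a b u -> cmod (cint a b u) <= rint a b (fun t => cmod (u t)).
Proof.
move=> iu; have [->|J0] := eqVneq (cint a b u) 0.
  by rewrite cmod0; apply: rint_ge0 => x _; exact: cmod_ge0.
(* The unimodular factor [w] rotates the integral onto the positive axis, where it coincides with
   its real part. *)
pose w := (cint a b u)^* / (cmod (cint a b u))%:C.
have c0 : cmod (cint a b u) != 0 by rewrite cmod_eq0.
have w1 : cmod w = 1.
  by rewrite /w cmodM cmodV cmodJ cmodR ger0_norm ?cmod_ge0 // divff.
have wJ : w * cint a b u = (cmod (cint a b u))%:C.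
  rewrite /w mulrAC [_^* * _]mulrC mulcJ expr2 rmorphM /= mulfK //.
  by rewrite -cmod_eq0 cmodR normr_eq0.
have -> : cmod (cint a b u) = Re (cint a b (fun t => w * u t)).
  by rewrite cintZ // wJ.
rewrite cintE /=; apply: le_rint.
- by have [] := cintbleZ w iu.
- exact: cintble_cmod.
- move=> x _; apply: le_trans (ler_norm _) _; apply: le_trans (Re_le_cmod _) _.
  by rewrite cmodM w1 mul1r.
Qed.

Lemma cint_bound a b u (M : R) : a <= b -> cintble a b u ->
  (forall x, a <= x <= b -> cmod (u x) <= M) -> cmod (cint a b u) <= M * (b - a).
Proof.
move=> ab iu uM; apply: le_trans (cint_le iu) _; rewrite -(rint_cst _ ab).
apply: le_rint uM; [exact: cintble_cmod|exact: intble_cst].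
Qed.

Lemma cint_cat a b c u : a <= c -> c <= b -> cintble a b u ->
  cint a b u = cint a c u + cint c b u.
Proof.
move=> ac cb [ru iu].
by apply: complex_ext; rewrite ?ReD ?ImD !cintE /=; exact: rint_cat.
Qed.

Definition ccont a b u := forall x, a <= x <= b -> forall e : R, 0 < e ->
  exists2 d : R, 0 < d & forall y, a <= y <= b -> `|y - x| < d -> cmod (u y - u x) <= e.

Lemma within_cont_eps a b (f : R -> R) :
  (forall x, a <= x <= b -> forall e : R, 0 < e ->
    exists2 d : R, 0 < d & forall y, a <= y <= b -> `|y - x| < d -> `|f y - f x| <= e) ->
  {within `[a, b], continuous f}.
Proof.
move=> fc; apply/subspace_continuousP => x /=; rewrite in_itv /= => xab.
apply/cvgrPdist_le => e e0; have [d d0 fd] := fc _ xab _ e0.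
rewrite near_withinE; apply/nbhs_ballP; exists d => //= y.
rewrite /ball /= distrC => yd; rewrite in_itv /= => yab; rewrite distrC.
exact: fd.
Qed.

Lemma ccont_cintble a b u : ccont a b u -> cintble a b u.
Proof.
move=> cu; split; apply: intble_cont; apply: within_cont_eps => x xab e e0;
  have [d d0 ud] := cu _ xab _ e0; exists d => // y yab yd;
  apply: le_trans (ud y yab yd).
  by rewrite -ReB; exact: Re_le_cmod.
by rewrite -ImB; exact: Im_le_cmod.
Qed.

End complex_interval_integral.

(** * The complex exponential *)

Section complex_exponential.
Context {R : realType}.
Implicit Types (z w : R[i]) (x y e : R).

Definition cexp z : R[i] := (expR (Re z))%:C * cis (Im z).

Lemma cexpD z w : cexp (z + w) = cexp z * cexp w.
Proof. rewrite /cexp ReD ImD expRD cisD rmorphM /=; ring. Qed.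

Lemma cexp0 : cexp 0 = 1.
Proof. by rewrite /cexp /= expR0 cis0 mulr1. Qed.

Lemma cmod_cexp z : cmod (cexp z) = expR (Re z).
Proof. by rewrite /cexp cmodM cmod_cis mulr1 cmodR ger0_norm // expR_ge0. Qed.

Lemma is_derive_eps (f : R -> R) x d : is_derive x 1 f d -> forall e, 0 < e ->
  exists2 r : R, 0 < r & forall h, `|h| < r -> `|f (x + h) - f x - d * h| <= e * `|h|.
Proof.
move=> fd e e0; have [/cvg_ex[l fl] dl] := fd.
have {dl} ld : l = d.
  by rewrite -dl; apply/esym; exact: (@cvg_lim _ (@norm_hausdorff _ R^o) _ _ _ _ _ fl).
rewrite {l}ld in fl.
have /cvgrPdist_le/(_ e e0) := fl.
rewrite near_withinE => /nbhs_ballP[r /= r0 hr].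
exists r => // h hhr; have [->|h0] := eqVneq h 0.
  by rewrite addr0 subrr sub0r mulr0 normrN normr0 mulr0.
have := hr h; rewrite /ball /= sub0r normrN => /(_ hhr h0).
have -> : d - h^-1 *: (f (h *: (1:R^o) + x) - f x) = - (h^-1 * (f (x + h) - f x - d * h)).
  rewrite /GRing.scale /= mulr1 [h + x]addrC; field; exact: h0.
by rewrite normrN normrM normfV mulrC ler_pdivrMr ?normr_gt0.
Qed.

Lemma cdiff_cexp0 : cdiff cexp 0 1.
Proof.
(* The remainder splits into a real exponential part, a trigonometric part and the product [x * y];
   they cost 1, 4 and 1 times [e1 * cmod h], hence the 6. *)
move=> e e0; pose e1 := Num.min 1 (e / 6).
have e10 : 0 < e1 by rewrite lt_min ltr01 divr_gt0.
have e11 : e1 <= 1 by rewrite ge_min lexx.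
have e16 : e1 * 6 <= e by rewrite -ler_pdivlMr // ge_min lexx orbT.
clearbody e1.
have [r1 r10 h1] := is_derive_eps (is_derive_expR (0 : R)) e10.
have [r2 r20 h2] := is_derive_eps (is_derive_cos (0 : R)) e10.
have [r3 r30 h3] := is_derive_eps (is_derive_sin (0 : R)) e10.
exists (Num.min e1 (Num.min r1 (Num.min r2 r3))) => [|h].
  by rewrite !lt_min e10 r10 r20 r30.
rewrite !lt_min => /and4P[he hr1 hr2 hr3].
have xh := Re_le_cmod h; have yh := Im_le_cmod h.
set x := Re h in xh *; set y := Im h in yh *.
have b1 : `|expR x - 1 - x| <= e1 * `|x|.
  by have := h1 x (le_lt_trans xh hr1); rewrite add0r expR0 mul1r.
have b2 : `|cos y - 1| <= e1 * `|y|.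
  by have := h2 y (le_lt_trans yh hr2); rewrite add0r cos0 sin0 oppr0 mul0r subr0.
have b3 : `|sin y - y| <= e1 * `|y|.
  by have := h3 y (le_lt_trans yh hr3); rewrite add0r sin0 cos0 mul1r subr0.
rewrite add0r cexp0 mul1r.
have -> : cexp h - 1 - h = (expR x - 1 - x)%:C * cis y +
   ((1 + x)%:C * ((cos y - 1) +i* (sin y - y)) + (x * y)%:C * 'i).
  by apply: complex_ext; rewrite /cexp /cis; case: h @x @y {he hr1 hr2 hr3 xh yh b1 b2 b3} => p q /=; ring.
have c0 := cmod_ge0 h; set c := cmod h in xh yh c0 he *.
have x0 := normr_ge0 x; have y0 := normr_ge0 y.
have B1 : cmod ((expR x - 1 - x)%:C * cis y) <= e1 * c.
  rewrite cmodM cmod_cis mulr1 cmodR; apply: le_trans b1 _.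
  by rewrite ler_wpM2l // ltW.
have B2 : cmod ((1 + x)%:C * ((cos y - 1) +i* (sin y - y))) <= 2 * (2 * (e1 * c)).
  rewrite cmodM cmodR; apply: ler_pM; rewrite ?cmod_ge0 ?normr_ge0 //.
    by apply: le_trans (ler_normD _ _) _; rewrite normr1; lra.
  apply: le_trans (cmod_le_ReIm _) _ => /=; have : e1 * `|y| <= e1 * c by rewrite ler_wpM2l // ltW.
  lra.
have B3 : cmod ((x * y)%:C * 'i) <= e1 * c.
  rewrite cmodM cmodR [cmod 'i]/cmod /= expr0n expr1n add0r sqrtr1 mulr1 normrM.
  by apply: ler_pM => //; apply: le_trans xh (ltW he).
apply: le_trans (cmodD _ _) _; apply: le_trans (lerD B1 (cmodD _ _)) _.
apply: (@le_trans _ _ (e1 * 6 * c)); first by lra.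
by rewrite ler_wpM2r.
Qed.

Lemma cdiff_cexp z : cdiff cexp z (cexp z).
Proof.
move=> e e0; have E0 := expR_gt0 (Re z).
have e1 : 0 < e / expR (Re z) by rewrite divr_gt0.
have [r r0 hr] := cdiff_cexp0 e1.
exists r => // h /hr; rewrite add0r cexp0 mul1r => hh.
have -> : cexp (z + h) - cexp z - cexp z * h = cexp z * (cexp h - 1 - h).
  by rewrite cexpD; ring.
rewrite cmodM cmod_cexp mulrC -ler_pdivlMr //; apply: le_trans hh _.
by rewrite mulrAC.
Qed.

End complex_exponential.

(** * Cauchy's theorem *)

Section goursat.
Context {R : realType}.
Implicit Types (a b c d x y e : R).

Lemma nested_itv (a b : nat -> R) : (forall k, a k <= a k.+1) -> (forall k, b k.+1 <= b k) ->
  (forall k, a k <= b k) -> exists x, forall k, a k <= x <= b k.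
Proof.
move=> ai bd ab.
have am m n : (m <= n)%N -> a m <= a n.
  by move=> /subnK <-; elim: (n - m)%N => // k IH; rewrite addSn (le_trans IH).
have bm m n : (m <= n)%N -> b n <= b m.
  by move=> /subnK <-; elim: (n - m)%N => // k IH; rewrite addSn (le_trans (bd _)).
have aub m k : a k <= b m.
  have [mk|/ltnW km] := leqP m k; first exact: le_trans (ab k) (bm _ _ mk).
  exact: le_trans (am _ _ km) (ab m).
have aS : has_sup [set a k | k in setT].
  split; first by exists (a 0%N); exists 0%N.
  by exists (b 0%N) => _ [k _ <-].
exists (sup [set a k | k in setT]) => k; apply/andP; split.
  by apply: sup_upper_bound => //; exists k.
by apply: ge_sup => [|_ [m _ <-]] //; case: aS.
Qed.

Lemma half_pow_lt (L r : R) : 0 < r -> exists k, L / 2 ^+ k < r.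
Proof.
move=> r0; have [k Lk] : exists k : nat, `|L| / r < k%:R.
  by exists (Num.bound (`|L| / r)); apply: archi_boundP; rewrite divr_ge0 // ltW.
exists k; rewrite ltr_pdivrMr ?exprn_gt0 // mulrC -ltr_pdivrMr //.
apply: le_lt_trans (_ : `|L| / r < _).
  by rewrite ler_wpM2r ?invr_ge0 ?(ltW r0) ?ler_norm.
apply: lt_le_trans Lk _.
by rewrite -natrX ler_nat ltnW // ltn_expl.
Qed.

(** If [P] failed, it would fail on one quarter, then on a quarter of that one, and so on; the
    nested rectangles shrink to a point, near which [P] holds. This is the engine of Goursat's
    argument, and it also replaces compactness in the proofs of boundedness and of uniform
    continuity. *)
Lemma quadrisection (P : R -> R -> R -> R -> Prop) (s1 s2 t1 t2 : R) :
  s1 <= s2 -> t1 <= t2 ->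
  (forall a b c d, s1 <= a -> a <= b -> b <= s2 -> t1 <= c -> c <= d -> d <= t2 ->
    let m := (a + b) / 2 in let n := (c + d) / 2 in
    P a m c n -> P m b c n -> P a m n d -> P m b n d -> P a b c d) ->
  (forall x y, s1 <= x <= s2 -> t1 <= y <= t2 -> exists2 r : R, 0 < r &
    forall a b c d, s1 <= a -> b <= s2 -> t1 <= c -> d <= t2 ->
      a <= x <= b -> c <= y <= d -> b - a < r -> d - c < r -> P a b c d) ->
  P s1 s2 t1 t2.
Proof.
move=> s12 t12 bis loc; apply: contrapT => nP.
pose mid (p : R * R) := (p.1 + p.2) / 2.
pose lo (p : R * R) := (p.1, mid p).
pose hi (p : R * R) := (mid p, p.2).
pose PP (q : (R * R) * (R * R)) := P q.1.1 q.1.2 q.2.1 q.2.2.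
(* A quarter on which [P] fails: when the first three tests succeed, [bis] forces the failure of the
   last quarter. *)
pose step (q : (R * R) * (R * R)) :=
  if ~~ `[< PP (lo q.1, lo q.2) >] then (lo q.1, lo q.2) else
  if ~~ `[< PP (hi q.1, lo q.2) >] then (hi q.1, lo q.2) else
  if ~~ `[< PP (lo q.1, hi q.2) >] then (lo q.1, hi q.2) else (hi q.1, hi q.2).
pose inv (q : (R * R) * (R * R)) :=
  [/\ s1 <= q.1.1, q.1.2 <= s2, t1 <= q.2.1 & q.2.2 <= t2] /\
  [/\ q.1.1 <= q.1.2, q.2.1 <= q.2.2 & ~ PP q].
pose le2 (p q : R * R) := [/\ p.1 <= q.1, q.2 <= p.2 & q.2 - q.1 = (p.2 - p.1) / 2].
have loP p : p.1 <= p.2 -> [/\ le2 p (lo p), p.1 <= mid p & mid p <= p.2].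
  by move=> pp; split; [split|..]; rewrite /lo /= /mid; lra.
have hiP p : p.1 <= p.2 -> le2 p (hi p).
  by move=> pp; split; rewrite /hi /= /mid; lra.
have stepP q : inv q -> [/\ inv (step q), le2 q.1 (step q).1 & le2 q.2 (step q).2].
  move=> [[q1 q2 q3 q4] [q12 q34 nq]].
  have [l1 m1 m1'] := loP _ q12; have [l2 m2 m2'] := loP _ q34.
  have h1 := hiP _ q12; have h2 := hiP _ q34.
  have key q' : ~ PP q' -> (q'.1 = lo q.1 \/ q'.1 = hi q.1) -> (q'.2 = lo q.2 \/ q'.2 = hi q.2) ->
      [/\ inv q', le2 q.1 q'.1 & le2 q.2 q'.2].
    move=> nq' e1 e2.
    have L1 : le2 q.1 q'.1 by case: e1 => ->.
    have L2 : le2 q.2 q'.2 by case: e2 => ->.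
    split => //; case: (L1) => a1 a2 a3; case: (L2) => b1 b2 b3; split; split => //.
    - exact: le_trans a1.
    - exact: le_trans a2 _.
    - exact: le_trans b1.
    - exact: le_trans b2 _.
    - by rewrite -subr_ge0 a3 divr_ge0 // subr_ge0.
    - by rewrite -subr_ge0 b3 divr_ge0 // subr_ge0.
  rewrite /step; case: asboolP => [A|A] /=; last by apply: key => //; left.
  case: asboolP => [B|B] /=; last by apply: key => //; [right|left].
  case: asboolP => [C|C] /=; last by apply: key => //; [left|right].
  apply: key => /=; [|by right|by right].
  by move=> D; apply: nq; apply: bis => //.
pose q k := iter k step ((s1, s2), (t1, t2)).
have qi k : inv (q k).
  elim: k => [|k IH]; last by rewrite /q iterS; case: (stepP _ IH).
  by split; split => //=.
have q1 k : le2 (q k).1 (q k.+1).1 by case: (stepP _ (qi k)).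
have q2 k : le2 (q k).2 (q k.+1).2 by case: (stepP _ (qi k)).
have len1 k : (q k).1.2 - (q k).1.1 = (s2 - s1) / 2 ^+ k.
  elim: k => [|k IH]; first by rewrite expr0 divr1.
  by have [_ _ ->] := q1 k; rewrite IH exprSr invfM mulrA.
have len2 k : (q k).2.2 - (q k).2.1 = (t2 - t1) / 2 ^+ k.
  elim: k => [|k IH]; first by rewrite expr0 divr1.
  by have [_ _ ->] := q2 k; rewrite IH exprSr invfM mulrA.
have [x xq] : exists x, forall k, (q k).1.1 <= x <= (q k).1.2.
  by apply: nested_itv => k; [case: (q1 k)|case: (q1 k)|case: (qi k) => _ []].
have [y yq] : exists x, forall k, (q k).2.1 <= x <= (q k).2.2.
  by apply: nested_itv => k; [case: (q2 k)|case: (q2 k)|case: (qi k) => _ []].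
have [r r0 rP] := loc x y (xq 0%N) (yq 0%N).
have [k kr] := half_pow_lt (Num.max (s2 - s1) (t2 - t1)) r0.
have [[w1 w2 w3 w4] [_ _ nPq]] := qi k.
apply: nPq; apply: rP => //.
  rewrite len1; apply: le_lt_trans kr.
  by rewrite ler_pM2r ?invr_gt0 ?exprn_gt0 // le_max lexx.
rewrite len2; apply: le_lt_trans kr.
by rewrite ler_pM2r ?invr_gt0 ?exprn_gt0 // le_max lexx orbT.
Qed.

Lemma cmod_Complex_le x y : cmod (x +i* y) <= `|x| + `|y|.
Proof. exact: cmod_le_ReIm. Qed.

Variable F : R[i] -> R[i].

Lemma ccont_vline s c d : (forall t, c <= t <= d -> exists D, cdiff F (s +i* t) D) ->
  ccont c d (fun t => F (s +i* t)).
Proof.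
move=> FD t tcd e e0; have [D FtD] := FD _ tcd.
have [r r0 hr] := cdiff_cont FtD e0; exists r => // y _ yr.
have -> : s +i* y = (s +i* t) + (0 +i* (y - t)).
  by apply: complex_ext; rewrite /= ?addr0 ?(addrC t) ?subrK.
by apply: hr; apply: le_lt_trans (cmod_Complex_le _ _) _; rewrite normr0 add0r.
Qed.

Lemma ccont_hline t a b : (forall s, a <= s <= b -> exists D, cdiff F (s +i* t) D) ->
  ccont a b (fun s => F (s +i* t)).
Proof.
move=> FD s sab e e0; have [D FtD] := FD _ sab.
have [r r0 hr] := cdiff_cont FtD e0; exists r => // y _ yr.
have -> : y +i* t = (s +i* t) + ((y - s) +i* 0).
  by apply: complex_ext; rewrite /= ?addr0 ?(addrC s) ?subrK.
by apply: hr; apply: le_lt_trans (cmod_Complex_le _ _) _; rewrite normr0 addr0.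
Qed.

(** The counterclockwise integral of [F] along the boundary of the rectangle, with opposite sides
    paired. *)
Definition rect_int a b c d : R[i] :=
  'i * (cint c d (fun t => F (b +i* t)) - cint c d (fun t => F (a +i* t)))
  - (cint a b (fun s => F (s +i* d)) - cint a b (fun s => F (s +i* c))).

Variables s1 s2 t1 t2 : R.
Hypotheses (s12 : s1 <= s2) (t12 : t1 <= t2).
Hypothesis FD : forall s t, s1 <= s <= s2 -> t1 <= t <= t2 -> exists D, cdiff F (s +i* t) D.

Let ivl s c d : s1 <= s <= s2 -> t1 <= c -> d <= t2 -> cintble c d (fun t => F (s +i* t)).
Proof.
move=> hs hc hd; apply: ccont_cintble; apply: ccont_vline => t /andP[ct td].
by apply: FD => //; rewrite (le_trans hc) // (le_trans td).
Qed.

Let ihl t a b : t1 <= t <= t2 -> s1 <= a -> b <= s2 -> cintble a b (fun s => F (s +i* t)).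
Proof.
move=> ht ha hb; apply: ccont_cintble; apply: ccont_hline => s /andP[as_ sb].
by apply: FD => //; rewrite (le_trans ha) // (le_trans sb).
Qed.

(** A bound quadratic in the side lengths is reproduced by quartering: four quarters, each with a
    quarter of the bound. Locally, [F] is affine up to an error [e * L], and two such errors enter
    each pair of opposite sides, whence the factor 2. *)
Lemma rect_int_bound e : 0 < e -> cmod (rect_int s1 s2 t1 t2) <= 2 * e * ((s2 - s1) + (t2 - t1)) ^+ 2.
Proof.
move=> e0.
apply: (quadrisection (P := fun a b c d => cmod (rect_int a b c d) <= 2 * e * ((b - a) + (d - c)) ^+ 2)) => //.
  move=> a b c d sa ab bs tc cd dt m n.
  have [am mb] : a <= m /\ m <= b by rewrite /m; split; lra.
  have [sa2 sb1] : s1 <= a <= s2 /\ s1 <= b <= s2.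
    by rewrite sa bs (le_trans ab bs) (le_trans sa ab).
  have [cn nd] : c <= n /\ n <= d by rewrite /n; split; lra.
  have hv s : s1 <= s <= s2 -> cint c d (fun t => F (s +i* t)) =
      cint c n (fun t => F (s +i* t)) + cint n d (fun t => F (s +i* t)).
    by move=> hs; apply: cint_cat => //; exact: ivl.
  have hh t : t1 <= t <= t2 -> cint a b (fun s => F (s +i* t)) =
      cint a m (fun s => F (s +i* t)) + cint m b (fun s => F (s +i* t)).
    by move=> ht; apply: cint_cat => //; exact: ihl.
  move=> p1 p2 p3 p4.
  have -> : rect_int a b c d = rect_int a m c n + rect_int m b c n + (rect_int a m n d + rect_int m b n d).
    have [k1 k2] : t1 <= c <= t2 /\ t1 <= d <= t2.
      by rewrite tc dt (le_trans cd dt) (le_trans tc cd).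
    have [k3 k4] : s1 <= m <= s2 /\ t1 <= n <= t2.
      by rewrite (le_trans sa am) (le_trans mb bs) (le_trans tc cn) (le_trans nd dt).
    rewrite /rect_int !hv // !hh //; ring.
  apply: le_trans (cmodD _ _) _; apply: le_trans (lerD (cmodD _ _) (cmodD _ _)) _.
  apply: le_trans (lerD (lerD p1 p2) (lerD p3 p4)) _.
  by rewrite le_eqVlt; apply/orP; left; apply/eqP; rewrite /m /n; field.
move=> x y hx hy; have [D FxD] := @FD x y hx hy.
have [r r0 hr] := FxD _ e0; exists (r / 2) => [|a b c d sa bs tc dt /andP[ax xb] /andP[cy yd] bar dcr].
  by rewrite divr_gt0.
have ab : a <= b by exact: le_trans xb.
have cd : c <= d by exact: le_trans yd.
pose p : R[i] := x +i* y.
pose E w := F w - F p - D * (w - p).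
set L := (b - a) + (d - c).
have EL s t : a <= s <= b -> c <= t <= d -> cmod (E (s +i* t)) <= e * L.
  move=> /andP[as_ sb] /andP[ct td].
  have hL : cmod ((s +i* t) - p) <= L.
    apply: le_trans (cmod_le_ReIm _) _; rewrite /p /= /L.
    by apply: lerD; rewrite ler_norml; lra.
  have hpp : p + ((s +i* t) - p) = s +i* t by rewrite addrC subrK.
  apply: (@le_trans _ _ (e * cmod ((s +i* t) - p))); last by rewrite ler_wpM2l // ltW.
  have := hr ((s +i* t) - p); rewrite hpp; apply.
  apply: le_lt_trans hL _; rewrite /L [r]splitr; exact: ltrD.
have FE w w' : F w - F w' = (E w - E w') + D * (w - w') by rewrite /E; ring.
have Hs : cint c d (fun t => F (b +i* t)) - cint c d (fun t => F (a +i* t)) =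
   cint c d (fun t => E (b +i* t) - E (a +i* t)) + D * (b - a)%:C * (d - c)%:C.
  rewrite -cintB; [|by apply: ivl => //; lra|by apply: ivl => //; lra].
  rewrite -(cint_cst _ cd) -cintD; last exact: cintble_cst.
    apply: eq_cint => t _; rewrite FE; congr (_ + _ * _).
    by apply: complex_ext; rewrite /= ?subrr ?subr0.
  apply: eq_cintble (cintbleB (cintbleB (@ivl b c d _ _ _) (@ivl a c d _ _ _)) (cintble_cst c d (D * (b - a)%:C))) => //; try lra.
  move=> t _; rewrite FE.
  have -> : (b +i* t) - (a +i* t) = (b - a)%:C by apply: complex_ext; rewrite /= ?subrr ?subr0.
  by rewrite addrK.
have Vs : cint a b (fun s => F (s +i* d)) - cint a b (fun s => F (s +i* c)) =
   cint a b (fun s => E (s +i* d) - E (s +i* c)) + D * ('i * (d - c)%:C) * (b - a)%:C.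
  have dc s : (s +i* d) - (s +i* c) = 'i * (d - c)%:C.
    by apply: complex_ext; rewrite /= ?subrr ?subr0; ring.
  rewrite -cintB; [|by apply: ihl => //; lra|by apply: ihl => //; lra].
  rewrite -(cint_cst _ ab) -cintD; last exact: cintble_cst.
    by apply: eq_cint => s _; rewrite FE dc.
  apply: eq_cintble (cintbleB (cintbleB (@ihl d a b _ _ _) (@ihl c a b _ _ _)) (cintble_cst a b (D * ('i * (d - c)%:C)))) => //; try lra.
  by move=> s _; rewrite FE dc addrK.
rewrite /rect_int Hs Vs.
set X := cint c d _; set Y := cint a b _.
(* The affine part contributes the same amount to both pairs of sides and cancels. *)
have -> : 'i * (X + D * (b - a)%:C * (d - c)%:C) - (Y + D * ('i * (d - c)%:C) * (b - a)%:C) = 'i * X - Y by ring.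
have X1 : cmod X <= 2 * (e * L) * (d - c).
  apply: cint_bound => //.
    apply: eq_cintble (cintbleB (cintbleB (@ivl b c d _ _ _) (@ivl a c d _ _ _)) (cintble_cst c d (D * (b - a)%:C))) => //; try lra.
    move=> t _; rewrite FE.
    have -> : (b +i* t) - (a +i* t) = (b - a)%:C by apply: complex_ext; rewrite /= ?subrr ?subr0.
    by rewrite addrK.
  move=> t tcd; apply: le_trans (cmodB_le _ _) _.
  have := EL b t; have := EL a t; rewrite !lexx ab tcd => /(_ isT isT) h1 /(_ isT isT) h2; lra.
have Y1 : cmod Y <= 2 * (e * L) * (b - a).
  apply: cint_bound => //.
    apply: eq_cintble (cintbleB (cintbleB (@ihl d a b _ _ _) (@ihl c a b _ _ _)) (cintble_cst a b (D * ('i * (d - c)%:C)))) => //; try lra.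
    move=> s _; rewrite FE.
    have -> : (s +i* d) - (s +i* c) = 'i * (d - c)%:C.
      by apply: complex_ext; rewrite /= ?subrr ?subr0; ring.
    by rewrite addrK.
  move=> s sab; apply: le_trans (cmodB_le _ _) _.
  have := EL s c; have := EL s d; rewrite !lexx cd sab => /(_ isT isT) h1 /(_ isT isT) h2; lra.
apply: le_trans (cmodB_le _ _) _; rewrite cmodM [cmod 'i]/cmod /= expr0n expr1n add0r sqrtr1 mul1r.
apply: le_trans (lerD X1 Y1) _; rewrite le_eqVlt; apply/orP; left; apply/eqP; rewrite /L; ring.
Qed.

Lemma rect_int_eq0 : rect_int s1 s2 t1 t2 = 0.
Proof.
apply/eqP; rewrite -cmod_eq0 eq_le cmod_ge0 andbT.
set M := ((s2 - s1) + (t2 - t1)) ^+ 2; have M0 : 0 <= M by exact: sqr_ge0.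
apply/ler_addgt0Pr => e e0; rewrite add0r.
have e1 : 0 < e / (2 * (1 + M)) by rewrite divr_gt0 // mulr_gt0 // ltr_pwDl.
apply: le_trans (rect_int_bound e1) _; rewrite -/M.
have -> : 2 * (e / (2 * (1 + M))) * M = e * (M / (1 + M)).
  by field; apply/eqP => h; lra.
by rewrite ger_pMr // ler_pdivrMr ?ltr_pwDl // mul1r lerDr.
Qed.

(* The two horizontal sides cancel. *)
Lemma cint_vline_eq : (forall s, s1 <= s <= s2 -> F (s +i* t2) = F (s +i* t1)) ->
  cint t1 t2 (fun t => F (s2 +i* t)) = cint t1 t2 (fun t => F (s1 +i* t)).
Proof.
move=> Fper; have := rect_int_eq0; rewrite /rect_int.
rewrite (eq_cint Fper) subrr subr0 => /eqP; rewrite mulf_eq0 => /orP[/eqP[/eqP]|].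
  by rewrite oner_eq0.
by rewrite subr_eq0 => /eqP.
Qed.

End goursat.

(** * Continuity on the disk and restriction to circles *)

Section disk_continuity.
Context {R : realType}.
Implicit Types (f g : R[i] -> R[i]) (z w : R[i]) (a b r t : R).

Definition cont_disk f := forall z, cmod z < 1 -> forall e : R, 0 < e ->
  exists2 d : R, 0 < d & forall h, cmod h < d -> cmod (f (z + h) - f z) <= e.

Lemma hol_cdiff f z : holomorphic_disk f -> cmod z < 1 -> cdiff f z (cderiv f z).
Proof. by move=> hf z1; apply: derivable_cdiff; apply: hf; rewrite diskE. Qed.

Lemma cdiff_hol f : (forall z, cmod z < 1 -> exists d, cdiff f z d) -> holomorphic_disk f.
Proof. by move=> fd z; rewrite diskE => /fd [d /cdiff_cderiv[]]. Qed.

Lemma hol_cont f : holomorphic_disk f -> cont_disk f.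
Proof. by move=> hf z z1; apply: cdiff_cont; exact: hol_cdiff hf z1. Qed.

Lemma cis_cont (e : R) : 0 < e -> exists2 d : R, 0 < d & forall h : R, `|h| < d -> cmod (cis h - 1) <= e.
Proof.
move=> e0; have [d d0 hd] := cdiff_cont (@cdiff_cexp0 R) e0.
exists d => // h hh; have := hd (0 +i* h); rewrite add0r cexp0.
have -> : cexp (0 +i* h) = cis h by rewrite /cexp /= expR0 mul1r.
by apply; apply: le_lt_trans (cmod_le_ReIm _) _; rewrite normr0 add0r.
Qed.

Lemma ccont_cmeas (u : R -> R[i]) : (forall a b, ccont a b u) -> cmeas [set: R] u.
Proof.
move=> cu; split; apply: continuous_measurable_fun => x; apply/cvgrPdist_le => e e0;
  have [|d d0 ud] := cu (x - 1) (x + 1) x _ e e0; try by lra.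
- apply/nbhs_ballP; exists (Num.min 1 d); first by rewrite /= lt_min ltr01 d0.
  move=> y; rewrite /ball /= lt_min => /andP[h1 h2].
  rewrite distrC -ReB; apply: le_trans (Re_le_cmod _) _; apply: ud.
    by move: h1; rewrite ltr_norml => /andP[h3 h4]; apply/andP; split; lra.
  by rewrite distrC.
- apply/nbhs_ballP; exists (Num.min 1 d); first by rewrite /= lt_min ltr01 d0.
  move=> y; rewrite /ball /= lt_min => /andP[h1 h2].
  rewrite distrC -ImB; apply: le_trans (Im_le_cmod _) _; apply: ud.
    by move: h1; rewrite ltr_norml => /andP[h3 h4]; apply/andP; split; lra.
  by rewrite distrC.
Qed.

Lemma circle_lt1 r t : 0 <= r -> r < 1 -> cmod (r%:C * cis t) < 1.
Proof. by move=> r0 r1; rewrite cmodM cmod_cis mulr1 cmodR ger0_norm. Qed.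

Lemma cmod_circle r t : 0 <= r -> cmod (r%:C * cis t) = r.
Proof. by move=> r0; rewrite cmodM cmod_cis mulr1 cmodR ger0_norm. Qed.

Lemma ccont_circle f r : cont_disk f -> 0 <= r -> r < 1 ->
  forall a b, ccont a b (fun t => f (r%:C * cis t)).
Proof.
move=> cf r0 r1 a b x _ e e0.
have [d d0 hd] := cf _ (circle_lt1 x r0 r1) e e0.
have [s s0 hs] := cis_cont (divr_gt0 d0 (ltr0Sn _ 1)).
exists s => // y _ ys.
have -> : r%:C * cis y = r%:C * cis x + r%:C * (cis y - cis x) by ring.
apply: hd; rewrite cmodM cmodR ger0_norm //.
have -> : cis y - cis x = cis x * (cis (y - x) - 1) by rewrite mulrBr mulr1 -cisD; congr (cis _ - _); ring.
rewrite cmodM cmod_cis mul1r; apply: le_lt_trans (_ : 1 * (d / 2) < d); last by lra.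
by apply: ler_pM; rewrite ?cmod_ge0 ?hs ?(ltW r1).
Qed.

Lemma cintble_circle f r a b : cont_disk f -> 0 <= r -> r < 1 ->
  cintble a b (fun t => f (r%:C * cis t)).
Proof. by move=> cf r0 r1; apply: ccont_cintble; exact: ccont_circle. Qed.

Lemma cmeas_circle f r : cont_disk f -> 0 <= r -> r < 1 ->
  cmeas [set: R] (fun t => f (r%:C * cis t)).
Proof. by move=> cf r0 r1; apply: ccont_cmeas => a b; exact: ccont_circle. Qed.

Lemma ccont_cis (k : R) a b : ccont a b (fun t => cis (k * t)).
Proof.
move=> x _ e e0; have [s s0 hs] := cis_cont e0.
have K0 : 0 < 1 + `|k| by rewrite ltr_pwDl.
exists (s / (1 + `|k|)); first by rewrite divr_gt0.
move=> y _ ys.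
have -> : cis (k * y) - cis (k * x) = cis (k * x) * (cis (k * (y - x)) - 1).
  by rewrite mulrBr mulr1 -cisD; congr (cis _ - _); ring.
rewrite cmodM cmod_cis mul1r; apply: hs; rewrite normrM.
apply: le_lt_trans (_ : (1 + `|k|) * `|y - x| < _).
  by rewrite ler_wpM2r // lerDr.
by rewrite mulrC -ltr_pdivlMr.
Qed.

Lemma cmeas_cis (k : R) : cmeas [set: R] (fun t => cis (k * t)).
Proof. by apply: ccont_cmeas => a b; exact: ccont_cis. Qed.

Lemma cmeasD (D : set R) (u v : R -> R[i]) : cmeas D u -> cmeas D v ->
  cmeas D (fun t => u t + v t).
Proof.
move=> [ru iu] [rv iv]; split.
  rewrite (_ : (fun t => _) = (fun t => Re (u t) + Re (v t))); first exact: measurable_funD.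
  by apply/funext => t; rewrite ReD.
rewrite (_ : (fun t => _) = (fun t => Im (u t) + Im (v t))); first exact: measurable_funD.
by apply/funext => t; rewrite ImD.
Qed.

Lemma cmeasM (D : set R) (u v : R -> R[i]) : cmeas D u -> cmeas D v ->
  cmeas D (fun t => u t * v t).
Proof.
move=> [ru iu] [rv iv]; split.
  rewrite (_ : (fun t => _) = (fun t => Re (u t) * Re (v t) - Im (u t) * Im (v t))).
    by apply: measurable_funB; exact: measurable_funM.
  by apply/funext => t; rewrite ReM.
rewrite (_ : (fun t => _) = (fun t => Re (u t) * Im (v t) + Im (u t) * Re (v t))).
  by apply: measurable_funD; exact: measurable_funM.
by apply/funext => t; rewrite ImM.
Qed.

Lemma cmeas_cst (D : set R) (k : R[i]) : cmeas D (fun=> k).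
Proof. by split; exact: measurable_cst. Qed.

Lemma cmeasJ (D : set R) (u : R -> R[i]) : cmeas D u -> cmeas D (fun t => (u t)^*).
Proof.
move=> [ru iu]; split.
  by rewrite (_ : (fun t => _) = (fun t => Re (u t))) //; apply/funext => t; case: (u t).
rewrite (_ : (fun t => _) = (fun t => - Im (u t))); first exact: measurable_funN.
by apply/funext => t; case: (u t).
Qed.

Lemma cmeasR (D : set R) (u : R -> R) : measurable_fun D u -> cmeas D (fun t => (u t)%:C).
Proof. by move=> mu; split => //=; exact: measurable_cst. Qed.

Lemma cmeasS (D E : set R) (u : R -> R[i]) : measurable D -> E `<=` D -> cmeas D u -> cmeas E u.
Proof. by move=> mD ED [h1 h2]; split; exact: measurable_funS ED _. Qed.

Lemma cintbleM_bounded a b (u v : R -> R[i]) (M : R) : cmeas `[a, b]%classic u -> cintble a b v ->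
  (forall x, a <= x <= b -> cmod (u x) <= M) -> cintble a b (fun t => u t * v t).
Proof.
move=> mu_ iv uM; apply: (cintble_dom (v := fun t => M * cmod (v t))).
- by apply: cmeasM => //; exact: cintble_cmeas.
- by apply: intbleZ; exact: cintble_cmod.
- by move=> x xab; rewrite cmodM ler_wpM2r ?cmod_ge0 ?uM.
Qed.

(** Bounds on four quarters combine into a bound on their union, and continuity gives a bound near
    each point of the disk, so [quadrisection] applies to the square around it. *)
Lemma cont_disk_bounded f r : cont_disk f -> r < 1 ->
  exists2 B : R, 0 <= B & forall z, cmod z <= r -> cmod (f z) <= B.
Proof.
move=> cf r1.
suff [B hB] : exists B : R, forall x y, -1 <= x <= 1 -> -1 <= y <= 1 -> cmod (x +i* y) <= r ->
    cmod (f (x +i* y)) <= B.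
  exists (Num.max 0 B) => [|[x y] zr]; first by rewrite le_max lexx.
  have x1 := le_trans (Re_le_cmod (x +i* y)) (le_trans zr (ltW r1)).
  have y1 := le_trans (Im_le_cmod (x +i* y)) (le_trans zr (ltW r1)).
  by rewrite le_max hB ?orbT // -ler_norml.
apply: (quadrisection (P := fun a b c d => exists B : R, forall x y, a <= x <= b -> c <= y <= d ->
  cmod (x +i* y) <= r -> cmod (f (x +i* y)) <= B) (s1 := -1) (s2 := 1) (t1 := -1) (t2 := 1)).
- lra.
- lra.
- move=> a b c d _ _ _ _ _ _ m n [B1 h1] [B2 h2] [B3 h3] [B4 h4].
  exists (Num.max (Num.max B1 B2) (Num.max B3 B4)) => x y /andP[ax xb] /andP[cy yd] zr.
  rewrite !le_max; case: (leP x m) => xm; case: (leP y n) => yn.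
  + by rewrite h1 ?ax ?cy ?xm ?yn.
  + by rewrite h3 ?ax ?(ltW yn) ?xm ?yd ?orbT.
  + by rewrite h2 ?xb ?cy ?(ltW xm) ?yn ?orbT.
  + by rewrite h4 ?xb ?yd ?(ltW xm) ?(ltW yn) ?orbT.
- move=> x y _ _; have hd x' y' a b c d (s : R) : a <= x <= b -> c <= y <= d ->
      a <= x' <= b -> c <= y' <= d -> b - a < s / 2 -> d - c < s / 2 ->
      cmod ((x' +i* y') - (x +i* y)) < s.
    move=> /andP[ax xb] /andP[cy yd] /andP[ax' xb'] /andP[cy' yd'] h1 h2.
    apply: le_lt_trans (cmod_le_ReIm _) _ => /=; rewrite [s]splitr.
    by apply: ltrD; rewrite ltr_norml; apply/andP; split; lra.
  have [z1|z1] := ltP (cmod (x +i* y)) 1.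
    have [s s0 hs] := cf _ z1 1 ltr01.
    exists (s / 2) => [|a b c d _ _ _ _ ax cy h1 h2]; first by rewrite divr_gt0.
    exists (1 + cmod (f (x +i* y))) => x' y' ax' cy' _.
    have := hs _ (hd _ _ _ _ _ _ _ ax cy ax' cy' h1 h2).
    rewrite (addrC (x +i* y)) subrK => h.
    have -> : f (x' +i* y') = (f (x' +i* y') - f (x +i* y)) + f (x +i* y) by rewrite subrK.
    by apply: le_trans (cmodD _ _) _; rewrite lerD2r.
  (* Near a point of modulus at least 1 the claim is vacuous: rectangles this small miss the disk of
     radius [r]. *)
  exists ((1 - r) / 2) => [|a b c d _ _ _ _ ax cy h1 h2]; first by rewrite divr_gt0 // subr_gt0.
  exists 0 => x' y' ax' cy' zr; exfalso.
  have := hd _ _ _ _ _ _ _ ax cy ax' cy' h1 h2.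
  have := ler_cmodB (x +i* y) (x' +i* y'); rewrite cmodB; lra.
Qed.

End disk_continuity.

(** * Fourier coefficients on circles *)

Section fourier_coefficients.
Context {R : realType}.
Implicit Types (f g : R[i] -> R[i]) (z w : R[i]) (a b r t : R).

(** Neither normalised nor conjugated: the Taylor coefficients of [f] sit at the frequencies
    [k <= 0]. *)
Definition fcoef f r (k : R) : R[i] := cint 0 (2 * pi) (fun t => f (r%:C * cis t) * cis (k * t)).

Lemma twopi_gt0 : 0 < 2 * pi :> R.
Proof. by rewrite mulr_gt0 // pi_gt0. Qed.

Lemma cis_2pin n : cis ((n%:R : R) * (2 * pi)) = 1.
Proof.
rewrite mulr_natl -cisX (_ : cis (2 * pi) = 1) ?expr1n //.
by rewrite -[2 * pi]add0r cis_periodic cis0.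
Qed.

(** In the logarithmic coordinate, circles become vertical segments of height [2 * pi]. The function
    [f (cexp w) * cexp (k w)] takes equal values at their two ends, so Cauchy's theorem on a
    rectangle compares two radii. *)
Lemma fcoef_log f (k s1 s2 : R) : holomorphic_disk f -> cis (k * (2 * pi)) = 1 ->
  s1 <= s2 -> s2 < 0 ->
  (expR (k * s2))%:C * fcoef f (expR s2) k = (expR (k * s1))%:C * fcoef f (expR s1) k.
Proof.
move=> hf k1 s12 s20.
pose F w := f (cexp w) * cexp (k%:C * w).
have FE s t : F (s +i* t) = (expR (k * s))%:C * (f ((expR s)%:C * cis t) * cis (k * t)).
  rewrite /F /cexp /= !mul0r subr0 addr0; ring.
have FD s t : s1 <= s <= s2 -> 0 <= t <= 2 * pi -> exists D, cdiff F (s +i* t) D.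
  move=> /andP[_ ss] _; have c1 : cmod (cexp (s +i* t)) < 1.
    by rewrite cmod_cexp /= expR_lt1 (le_lt_trans ss).
  eexists; apply: cdiffM.
    apply: (cdiff_comp (f := cexp) (g := f)); first exact: cdiff_cexp.
    exact: hol_cdiff hf c1.
  apply: (cdiff_comp (f := fun w => k%:C * w) (g := cexp)); last exact: cdiff_cexp.
  by apply: cdiffM; [exact: cdiff_cst|exact: cdiff_id].
have Fper s : s1 <= s <= s2 -> F (s +i* (2 * pi)) = F (s +i* 0).
  move=> _; rewrite !FE mulr0 k1 cis0; congr (_ * (f (_ * _) * _)).
  by rewrite -[2 * pi]add0r cis_periodic cis0.
have cF s : s < 0 -> cintble 0 (2 * pi) (fun t => f ((expR s)%:C * cis t) * cis (k * t)).
  move=> s0; have es : expR s < 1 by rewrite expR_lt1.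
  have [B B0 hB] := cont_disk_bounded (hol_cont hf) es.
  apply: (cintbleM_bounded (M := B)).
  - apply: (cmeasS measurableT) => //; apply: cmeas_circle; rewrite ?expR_ge0 //.
    exact: hol_cont.
  - by apply: ccont_cintble; exact: ccont_cis.
  - by move=> x _; apply: hB; rewrite cmod_circle ?expR_ge0.
have := cint_vline_eq s12 (ltW twopi_gt0) FD Fper.
rewrite (@eq_cint _ _ _ _ _ (fun t _ => FE s2 t)) cintZ; last exact: cF.
rewrite (@eq_cint _ _ _ _ _ (fun t _ => FE s1 t)) cintZ //.
by apply: cF; exact: le_lt_trans s20.
Qed.

End fourier_coefficients.

Section fourier_coefficients_hol.
Context {R : realType}.
Implicit Types (f g : R[i] -> R[i]) (z w : R[i]) (a b r t : R).

Lemma cintble_fcoef f r (k : R) : cont_disk f -> 0 <= r -> r < 1 ->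
  cintble 0 (2 * pi) (fun t => f (r%:C * cis t) * cis (k * t)).
Proof.
move=> cf r0 r1; have [B B0 hB] := cont_disk_bounded cf r1.
apply: (cintbleM_bounded (M := B)).
- by apply: (cmeasS measurableT) => //; exact: cmeas_circle.
- by apply: ccont_cintble; exact: ccont_cis.
- by move=> x _; apply: hB; rewrite cmod_circle.
Qed.

Lemma fcoef_bound f r (k B : R) : cont_disk f -> 0 <= r -> r < 1 ->
  (forall z, cmod z <= r -> cmod (f z) <= B) -> cmod (fcoef f r k) <= B * (2 * pi).
Proof.
move=> cf r0 r1 hB; rewrite -[X in _ * X]subr0; apply: cint_bound.
- exact: ltW twopi_gt0.
- exact: cintble_fcoef.
- by move=> x _; rewrite cmodM cmod_cis mulr1 hB // cmod_circle.
Qed.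

Lemma expR_lnX (n : nat) r : 0 < r -> expR (n%:R * ln r) = r ^+ n.
Proof. by move=> r0; rewrite expRM_natl lnK. Qed.

Lemma expR_lnVX (n : nat) r : 0 < r -> expR (- n%:R * ln r) = (r ^+ n)^-1.
Proof. by move=> r0; rewrite mulNr expRN expR_lnX. Qed.

(** [r ^+ n] times the coefficient is independent of the radius, while the coefficient stays bounded
    as the radius tends to 0. *)
Lemma fcoef_pos0 f r (n : nat) : holomorphic_disk f -> 0 < r -> r < 1 -> (0 < n)%N ->
  fcoef f r n%:R = 0.
Proof.
move=> hf r0 r1 n0; have cf := hol_cont hf.
have [B B0 hB] := cont_disk_bounded cf r1.
have key s : 0 < s -> s <= r -> r ^+ n * cmod (fcoef f r n%:R) <= s * (B * (2 * pi)).
  move=> s0 sr.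
  have s1 : s < 1 by exact: le_lt_trans r1.
  have l1 : ln s <= ln r by rewrite ler_ln ?posrE.
  have l2 : ln r < 0 by rewrite ln_lt0 // r0.
  have es : expR (ln s) = s by rewrite lnK ?posrE.
  have er : expR (ln r) = r by rewrite lnK ?posrE.
  have := fcoef_log hf (cis_2pin n) l1 l2.
  rewrite (expR_lnX n s0) (expR_lnX n r0) es er => /(congr1 (@cmod R)).
  rewrite !cmodM !cmodR !ger0_norm ?exprn_ge0 ?(ltW r0) ?(ltW s0) // => ->.
  apply: ler_pM; rewrite ?exprn_ge0 ?cmod_ge0 ?(ltW s0) //.
    by rewrite -[X in _ <= X]expr1; apply: ler_wiXn2l; rewrite ?(ltW s0) ?(ltW s1).
  apply: fcoef_bound => //; rewrite ?(ltW s0) // => z zs.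
  by apply: hB; exact: le_trans sr.
apply/eqP; rewrite -cmod_eq0 eq_le cmod_ge0 andbT leNgt; apply/negP => c0.
have X0 : 0 < r ^+ n * cmod (fcoef f r n%:R) by rewrite mulr_gt0 // exprn_gt0.
set X := r ^+ n * _ in key X0; pose D := 1 + B * (2 * pi).
have D0 : 0 < D by rewrite /D ltr_pwDl // mulr_ge0 // ltW // twopi_gt0.
have m0 : 0 < Num.min r (X / D) by rewrite lt_min r0 divr_gt0.
have := key (Num.min r (X / D)) m0 _; rewrite ge_min lexx => /(_ isT).
apply/negP; rewrite -ltNge.
apply: (@lt_le_trans _ _ (Num.min r (X / D) * D)).
  by rewrite ltr_pM2l // /D ltrDr.
by rewrite -ler_pdivlMr // ge_min lexx orbT.
Qed.

(** The Taylor coefficient, read off the circle of radius 1/2; by [fcoef_neg] every other radius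
    gives the same number. *)
Definition tcoef f (n : nat) : R[i] := fcoef f 2^-1 (- n%:R) * (2 ^+ n / (2 * pi))%:C.

Lemma conj1 : (1 : R[i])^* = 1.
Proof. by apply: complex_ext; rewrite /= ?oppr0. Qed.

Lemma conj0 : (0 : R[i])^* = 0.
Proof. by apply: complex_ext; rewrite /= ?oppr0. Qed.

Lemma cis_N2pin n : cis (- (n%:R : R) * (2 * pi)) = 1.
Proof. by rewrite mulNr cisN cis_2pin conj1. Qed.

Lemma fcoef_neg f r n : holomorphic_disk f -> 0 < r -> r < 1 ->
  fcoef f r (- n%:R) = (2 * pi * r ^+ n)%:C * tcoef f n.
Proof.
move=> hf r0 r1.
have H1 : (0 : R) < 2^-1 by rewrite invr_gt0.
have H2 : (2^-1 : R) < 1 by rewrite invf_lt1 // ltr1n.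
have key (s1 s2 : R) : 0 < s1 -> s1 <= s2 -> s2 < 1 ->
    ((s2 ^+ n)^-1)%:C * fcoef f s2 (- n%:R) = ((s1 ^+ n)^-1)%:C * fcoef f s1 (- n%:R).
  move=> h1 h2 h3; have h4 := lt_le_trans h1 h2.
  have l1 : ln s1 <= ln s2 by rewrite ler_ln ?posrE.
  have l2 : ln s2 < 0 by rewrite ln_lt0 // h4.
  have e1 : expR (ln s1) = s1 by rewrite lnK ?posrE.
  have e2 : expR (ln s2) = s2 by rewrite lnK ?posrE.
  have := fcoef_log hf (cis_N2pin n) l1 l2.
  by rewrite (expR_lnVX n h1) (expR_lnVX n h4) e1 e2.
have E : ((r ^+ n)^-1)%:C * fcoef f r (- n%:R) = ((2^-1 ^+ n)^-1)%:C * fcoef f 2^-1 (- n%:R).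
  by have [h|/ltW h] := leP r 2^-1; [apply/esym|]; exact: key.
have rn : r ^+ n != 0 by rewrite expf_neq0 // gt_eqF.
have p0 : 2 * pi != 0 :> R by rewrite gt_eqF // twopi_gt0.
have -> : fcoef f r (- n%:R) = (r ^+ n)%:C * (((r ^+ n)^-1)%:C * fcoef f r (- n%:R)).
  by rewrite mulrA -rmorphM /= divff // mul1r.
rewrite E /tcoef -exprVn invrK.
have -> : (2 * pi * r ^+ n)%:C * (fcoef f 2^-1 (- n%:R) * (2 ^+ n / (2 * pi))%:C)
  = ((2 * pi * r ^+ n) * (2 ^+ n / (2 * pi)))%:C * fcoef f 2^-1 (- n%:R).
  by rewrite [in RHS]rmorphM /=; ring.
rewrite mulrA -rmorphM /=; congr (_%:C * _).
by move: (2 * pi) p0 => p p0; field.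
Qed.

End fourier_coefficients_hol.

(** * The Poisson kernel *)

Section poisson_kernel.
Context {R : realType}.
Implicit Types (f g : R[i] -> R[i]) (z w : R[i]) (a b r t : R) (v : R -> R[i]).
Local Notation T := (2 * pi : R).

Definition fc v (k : R) : R[i] := cint 0 T (fun t => v t * cis (k * t)).

Lemma cintble_fc v k : cintble 0 T v -> cintble 0 T (fun t => v t * cis (k * t)).
Proof.
move=> iv; have := cintbleM_bounded (M := 1) (cmeasS measurableT _ (cmeas_cis k)) iv.
move=> /(_ (@subsetT _ _)) h; apply: eq_cintble (h _); first by move=> x _; rewrite mulrC.
by move=> x _; rewrite cmod_cis.
Qed.

Lemma cintJ a b v : cintble a b v -> cint a b (fun t => (v t)^*) = (cint a b v)^*.
Proof.
move=> [rv iv]; rewrite !cintE; apply: complex_ext => /=.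
  by apply: eq_rint => x _; case: (v x).
rewrite -mulN1r -rintZ //; apply: eq_rint => x _; by rewrite mulN1r; case: (v x).
Qed.

Lemma cintbleJ a b v : cintble a b v -> cintble a b (fun t => (v t)^*).
Proof.
move=> [rv iv]; split; first by apply: eq_intble rv => x _; case: (v x).
by apply: eq_intble (intbleN iv) => x _; case: (v x).
Qed.

Lemma fc_conj v k : cintble 0 T v -> fc (fun t => (v t)^*) k = (fc v (- k))^*.
Proof.
move=> iv; rewrite /fc -cintJ; last exact: cintble_fc.
by apply: eq_cint => t _; rewrite conjcM mulNr cisN conjcK.
Qed.

Lemma fc_one_pos (n : nat) : (0 < n)%N -> fc (fun=> 1) n%:R = 0.
Proof.
move=> n0; have h1 : holomorphic_disk (fun=> 1 : R[i]).
  by apply: cdiff_hol => z _; exists 0; exact: cdiff_cst.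
have r0 : (0 : R) < 2^-1 by rewrite invr_gt0.
have r1 : (2^-1 : R) < 1 by rewrite invf_lt1 // ltr1n.
exact: (fcoef_pos0 h1 r0 r1 n0).
Qed.

Lemma fc_one_neg (n : nat) : (0 < n)%N -> fc (fun=> 1) (- n%:R) = 0.
Proof.
move=> n0; rewrite -[- n%:R]opprK -[LHS]conjcK -fc_conj; last exact: cintble_cst.
by rewrite opprK conj1 fc_one_pos // conj0.
Qed.

Lemma fc_one0 : fc (fun=> 1) 0 = T%:C.
Proof.
rewrite /fc (@eq_cint _ _ _ _ (fun=> 1)); last by move=> x _; rewrite mul0r cis0 mulr1.
by rewrite cint_cst ?subr0 ?mul1r // ltW // twopi_gt0.
Qed.

(** The Herglotz kernel [(cis t + z) / (cis t - z)], divided through by [cis t]. Its real part is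
    the Poisson kernel, here with total mass [2 * pi]. *)
Definition herglotz z t : R[i] := (1 + z * cis (- t)) / (1 - z * cis (- t)).
Definition poisson z t : R := Re (herglotz z t).

Lemma herglotz_den z t : 1 - cmod z <= cmod (1 - z * cis (- t)).
Proof. by apply: le_trans (ler_cmodB _ _); rewrite cmod1 cmodM cmod_cis mulr1. Qed.

Lemma herglotz_den0 z t : cmod z < 1 -> 1 - z * cis (- t) != 0.
Proof.
by move=> z1; rewrite -cmod_gt0 (lt_le_trans _ (herglotz_den z t)) // subr_gt0.
Qed.

Lemma herglotz_expand z t N : cmod z < 1 ->
  herglotz z t = 1 + 2%:R * (\sum_(k < N) z ^+ k.+1 * cis (- k.+1%:R * t))
    + 2%:R * (z * cis (- t)) ^+ N.+1 / (1 - z * cis (- t)).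
Proof.
move=> z1; have D0 := herglotz_den0 t z1.
have E k : z ^+ k.+1 * cis (- k.+1%:R * t) = (z * cis (- t)) ^+ k.+1.
  by rewrite exprMn cisX; congr (_ * cis _); rewrite mulNr mulr_natl mulNrn.
under eq_bigr do rewrite E.
rewrite /herglotz; set w := z * cis (- t) in D0 *.
elim: N => [|N IH]; first by rewrite big_ord0; field.
rewrite big_ord_recr /= IH [w ^+ N.+2]exprS; field.
exact: D0.
Qed.

Lemma herglotz_le z t : cmod z < 1 -> cmod (herglotz z t) <= 2 / (1 - cmod z).
Proof.
move=> z1; have D := herglotz_den z t; have z0 : 0 < 1 - cmod z by rewrite subr_gt0.
rewrite /herglotz cmodM cmodV; apply: ler_pM; rewrite ?cmod_ge0 ?invr_ge0 ?cmod_ge0 //.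
  apply: le_trans (cmodD _ _) _; rewrite cmod1 cmodM cmod_cis mulr1; lra.
by rewrite lef_pV2 ?posrE // (lt_le_trans z0).
Qed.

Lemma ccont_herglotz z a b : cmod z < 1 -> ccont a b (herglotz z).
Proof.
move=> z1 x xab e e0; have z0 : 0 < 1 - cmod z by rewrite subr_gt0.
have [|d d0 hd] := @ccont_cis R (-1) a b x xab (e * (1 - cmod z) ^+ 2 / 2).
  by rewrite divr_gt0 // mulr_gt0 // exprn_gt0.
exists d => // y yab yd; have := hd y yab yd; rewrite !mulN1r => h.
have Dx := herglotz_den0 x z1; have Dy := herglotz_den0 y z1.
have -> : herglotz z y - herglotz z x =
   2%:R * z * (cis (- y) - cis (- x)) / ((1 - z * cis (- y)) * (1 - z * cis (- x))).
  by rewrite /herglotz; field; rewrite Dx Dy.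
rewrite !cmodM cmodV cmodM cmod_ge_natr ler_pdivrMr; last by rewrite mulr_gt0 // cmod_gt0.
apply: (@le_trans _ _ (e * (1 - cmod z) ^+ 2)).
  have := cmod_ge0 (cis (- y) - cis (- x)); move: h; set c := cmod (_ - _) => h c0.
  apply: (@le_trans _ _ (2 * 1 * c)); last by rewrite mulr1 mulrC -ler_pdivlMr.
  by rewrite ler_wpM2r // ler_wpM2l // ltW.
rewrite ler_wpM2l ?(ltW e0) // expr2; apply: ler_pM; rewrite ?(ltW z0) //; exact: herglotz_den.
Qed.

Lemma cmeas_herglotz z : cmod z < 1 -> cmeas [set: R] (herglotz z).
Proof. by move=> z1; apply: ccont_cmeas => a b; exact: ccont_herglotz. Qed.

Lemma cintble_herglotz z a b v : cmod z < 1 -> cintble a b v ->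
  cintble a b (fun t => herglotz z t * v t).
Proof.
move=> z1 iv; apply: (cintbleM_bounded (M := 2 / (1 - cmod z))) => //.
  by apply: (cmeasS measurableT) => //; exact: cmeas_herglotz.
by move=> x _; exact: herglotz_le.
Qed.

(** The finite geometric expansion of the kernel is exact, so integrating it term by term leaves
    only its remainder, and no infinite sum has to be exchanged with the integral. *)
Lemma herglotz_series v z N : cintble 0 T v -> cmod z < 1 ->
  cmod (cint 0 T (fun t => herglotz z t * v t)
        - (fc v 0 + 2%:R * \sum_(k < N) z ^+ k.+1 * fc v (- k.+1%:R)))
  <= 2 * cmod z ^+ N.+1 / (1 - cmod z) * rint 0 T (fun t => cmod (v t)).
Proof.
move=> iv z1; have z0 : 0 < 1 - cmod z by rewrite subr_gt0.
have T0 : 0 <= T by exact: ltW twopi_gt0.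
have i1 k : cintble 0 T (fun t => z ^+ k.+1 * (v t * cis (- k.+1%:R * t))).
  by apply: cintbleZ; exact: cintble_fc.
have iS : cintble 0 T (fun t => \sum_(k < N) z ^+ k.+1 * (v t * cis (- k.+1%:R * t))).
  exact: (cintble_sum N i1).
have S : fc v 0 + 2%:R * \sum_(k < N) z ^+ k.+1 * fc v (- k.+1%:R) =
  cint 0 T (fun t => v t * cis (0 * t) + 2%:R * (\sum_(k < N) z ^+ k.+1 * (v t * cis (- k.+1%:R * t)))).
  rewrite cintD; [|exact: cintble_fc|exact: cintbleZ].
  rewrite cintZ // (cint_sum N T0 i1); congr (_ + _ * _).
  by apply: eq_bigr => k _; rewrite cintZ //; exact: cintble_fc.
rewrite S -cintB; [|exact: cintble_herglotz|by apply: cintbleD; [exact: cintble_fc|exact: cintbleZ]].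
apply: le_trans (cint_le _) _.
  by apply: cintbleB; [exact: cintble_herglotz|by apply: cintbleD; [exact: cintble_fc|exact: cintbleZ]].
rewrite -rintZ; last exact: cintble_cmod.
apply: le_rint.
- apply: cintble_cmod; apply: cintbleB; [exact: cintble_herglotz|].
  by apply: cintbleD; [exact: cintble_fc|exact: cintbleZ].
- by apply: intbleZ; exact: cintble_cmod.
move=> t _; rewrite (herglotz_expand t N z1) mul0r cis0 mulr1.
have -> : \sum_(k < N) z ^+ k.+1 * (v t * cis (- k.+1%:R * t)) =
    v t * \sum_(k < N) z ^+ k.+1 * cis (- k.+1%:R * t).
  by rewrite mulr_sumr; apply: eq_bigr => k _; ring.
set S1 := \sum_(k < N) _; set X := 2%:R * _ ^+ _ / _.
have -> : (1 + 2%:R * S1 + X) * v t - (v t + 2%:R * (v t * S1)) = X * v t by ring.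
rewrite cmodM ler_wpM2r ?cmod_ge0 // /X !cmodM cmodX !cmodM cmod_cis mulr1 cmodV cmod_ge_natr.
rewrite ler_wpM2l ?mulr_ge0 ?exprn_ge0 ?cmod_ge0 // lef_pV2 ?posrE //; first exact: herglotz_den.
by rewrite cmod_gt0 herglotz_den0.
Qed.

Lemma poisson_series v z N : cintble 0 T v -> cmod z < 1 ->
  cmod (cint 0 T (fun t => (poisson z t)%:C * v t)
        - (fc v 0 + \sum_(k < N) z ^+ k.+1 * fc v (- k.+1%:R)
                  + \sum_(k < N) z^* ^+ k.+1 * fc v k.+1%:R))
  <= 2 * cmod z ^+ N.+1 / (1 - cmod z) * rint 0 T (fun t => cmod (v t)).
Proof.
move=> iv z1; have ivJ := cintbleJ iv.
have h1 := herglotz_series N iv z1; have h2 := herglotz_series N ivJ z1.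
(* The Poisson kernel is half the sum of the Herglotz kernel and its conjugate. In the second
   integral the conjugation is moved onto [v], which reflects the frequencies. *)
have E : cint 0 T (fun t => (poisson z t)%:C * v t) =
   2^-1 * (cint 0 T (fun t => herglotz z t * v t) +
    (cint 0 T (fun t => herglotz z t * (v t)^*))^*).
  rewrite -cintJ; last exact: cintble_herglotz.
  rewrite -cintD; [|exact: cintble_herglotz|by apply: cintbleJ; exact: cintble_herglotz].
  rewrite -cintZ; last first.
    by apply: cintbleD; [exact: cintble_herglotz|by apply: cintbleJ; exact: cintble_herglotz].
  apply: eq_cint => t _; rewrite conjcM conjcK /poisson.
  have -> : (Re (herglotz z t))%:C = 2^-1 * (herglotz z t + (herglotz z t)^*).
    by rewrite ReJ_add mulrC.
  by ring.
rewrite E; set A := cint _ _ _ in h1 *; set B := cint _ _ _ in h2 *.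
set S := \sum_(k < N) _ in h1 *; set S' := \sum_(k < N) _ in h2 *.
set S2 := \sum_(k < N) _.
have S2E : S2 = S'^*.
  rewrite /S2 /S' rmorph_sum; apply: eq_bigr => k _.
  by rewrite [RHS]conjcM conjcX fc_conj // opprK conjcK.
have f0 : fc (fun t => (v t)^*) 0 = (fc v 0)^* by rewrite fc_conj // oppr0.
have -> : 2^-1 * (A + B^*) - (fc v 0 + S + S2) =
   2^-1 * ((A - (fc v 0 + 2%:R * S)) + (B - (fc (fun t => (v t)^*) 0 + 2%:R * S'))^*).
  have J2 (x y u : R[i]) : (x - (y + 2%:R * u))^* = x^* - (y^* + 2%:R * u^*).
    by rewrite !(rmorphB, rmorphD) /= conjcM conjc_nat.
  by rewrite J2 S2E f0 conjcK; field.
rewrite cmodM cmodV cmod_ge_natr ler_pdivrMl //.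
apply: le_trans (cmodD _ _) _; rewrite cmodJ.
have E2 : rint 0 T (fun t => cmod (v t)^*) = rint 0 T (fun t => cmod (v t)).
  by apply: eq_rint => t _; rewrite cmodJ.
rewrite E2 in h2; apply: le_trans (lerD h1 h2) _.
by rewrite le_eqVlt; apply/orP; left; apply/eqP; ring.
Qed.

Lemma poissonE z t : cmod z < 1 -> poisson z t = (1 - cmod z ^+ 2) / cmod (cis t - z) ^+ 2.
Proof.
move=> z1; rewrite /poisson /herglotz.
have -> : cmod (cis t - z) = cmod (1 - z * cis (- t)).
  have -> : 1 - z * cis (- t) = (cis t - z) * cis (- t) by rewrite mulrBl -cisD subrr cis0.
  by rewrite cmodM cmod_cis mulr1.
have -> : cmod z = cmod (z * cis (- t)) by rewrite cmodM cmod_cis mulr1.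
have := herglotz_den0 t z1; set w := z * cis (- t) => D0.
have c0 : cmod (1 - w) ^+ 2 != 0 by rewrite expf_neq0 // cmod_eq0.
have -> : (1 + w) / (1 - w) = (1 + w) * (1 - w)^* * ((cmod (1 - w) ^+ 2)^-1)%:C.
  apply: (mulIf D0); rewrite divfK //.
  have -> : (1 + w) * (1 - w)^* * ((cmod (1 - w) ^+ 2)^-1)%:C * (1 - w) =
     (1 + w) * (((1 - w) * (1 - w)^*) * ((cmod (1 - w) ^+ 2)^-1)%:C) by ring.
  by rewrite mulcJ -rmorphM /= divff // mulr1.
rewrite ReM /= mulr0 subr0; congr (_ / _).
by rewrite sqr_cmod; case: w {D0 c0} => x y /=; ring.
Qed.

Lemma poisson_ge0 z t : cmod z < 1 -> 0 <= poisson z t.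
Proof.
move=> z1; rewrite poissonE // divr_ge0 ?sqr_ge0 // subr_ge0.
by rewrite expr_le1 ?cmod_ge0 // ltW.
Qed.

Lemma poisson_le z t : cmod z < 1 -> poisson z t <= 2 / (1 - cmod z).
Proof.
move=> z1; apply: le_trans (herglotz_le t z1); apply: le_trans (ler_norm _) _.
exact: Re_le_cmod.
Qed.

Lemma measurable_poisson z : cmod z < 1 -> measurable_fun [set: R] (poisson z).
Proof. by move=> z1; case: (cmeas_herglotz z1). Qed.

Lemma cintble_poisson z a b v : cmod z < 1 -> cintble a b v ->
  cintble a b (fun t => (poisson z t)%:C * v t).
Proof.
move=> z1 iv; apply: (cintbleM_bounded (M := 2 / (1 - cmod z))) => //.
  by apply: (cmeasS measurableT) => //; apply: cmeasR; exact: measurable_poisson.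
by move=> x _; rewrite cmodR ger0_norm ?poisson_ge0 // poisson_le.
Qed.

Lemma intble_poissonM z a b (u : R -> R) : cmod z < 1 -> intble a b u ->
  intble a b (fun t => poisson z t * u t).
Proof.
move=> z1 iu; apply: (intble_dom (v := fun t => 2 / (1 - cmod z) * `|u t|)).
- apply: measurable_funM; last exact: intble_meas.
  by apply: measurable_funTS; exact: measurable_poisson.
- by apply: intbleZ; exact: intble_norm.
- move=> x _; rewrite normrM ler_wpM2r // ger0_norm ?poisson_ge0 //.
  exact: poisson_le.
Qed.

Lemma intble_poisson z a b : cmod z < 1 -> intble a b (poisson z).
Proof.
move=> z1; apply: eq_intble (intble_poissonM z1 (intble_cst a b 1)) => x _.
by rewrite mulr1.
Qed.

Lemma small_pow (q C e : R) : 0 <= q -> q < 1 -> 0 < e -> exists N, forall n, (N <= n)%N -> C * q ^+ n <= e.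
Proof.
move=> q0 q1 e0.
have : (fun n => C * q ^+ n) @ \oo --> C * 0.
  by apply: cvgMr; apply: cvg_expr; rewrite ger0_norm.
rewrite mulr0 => /cvgrPdist_le/(_ e e0) [N _ hN]; exists N => n Nn.
have := hN n Nn; rewrite sub0r normrN; exact: le_trans (ler_norm _).
Qed.

(** All Fourier coefficients of the constant 1 except the zeroth vanish, so [poisson_series] reduces
    to its geometric remainder. *)
Lemma poisson_one z : cmod z < 1 -> rint 0 T (poisson z) = T.
Proof.
move=> z1; have T0 := @twopi_gt0 R; have z0 : 0 < 1 - cmod z by rewrite subr_gt0.
have key N : cmod (cint 0 T (fun t => (poisson z t)%:C * 1) - T%:C) <=
    (2 / (1 - cmod z) * rint 0 T (fun=> cmod (1 : R[i]))) * cmod z ^+ N.+1.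
  have := poisson_series N (cintble_cst 0 T 1) z1.
  rewrite fc_one0 !big1 ?addr0 => [h|k _|k _]; rewrite ?fc_one_neg ?fc_one_pos ?mulr0 //.
  by apply: le_trans h _; rewrite le_eqVlt; apply/orP; left; apply/eqP; ring.
have : cint 0 T (fun t => (poisson z t)%:C * 1) - T%:C = 0.
  apply/eqP; rewrite -cmod_eq0 eq_le cmod_ge0 andbT.
  apply/ler_addgt0Pr => e e0; rewrite add0r.
  have [N hN] := small_pow (2 / (1 - cmod z) * rint 0 T (fun=> cmod (1 : R[i]))) (cmod_ge0 z) z1 e0.
  by apply: le_trans (key N) (hN _ _).
move=> /eqP; rewrite subr_eq0 => /eqP/(congr1 (@complex.Re R)); rewrite cintE /= => E; rewrite -[RHS]E.
by apply: eq_rint => t _; rewrite ?mulr1 ?mulr0 ?subr0.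
Qed.

End poisson_kernel.

(** * Power series *)

Section power_series.
Context {R : realType}.
Implicit Types (f g : R[i] -> R[i]) (z w : R[i]) (r q B e : R) (a b : nat -> R[i]).

Definition psum a N z : R[i] := \sum_(i < N) a i * z ^+ i.

(* The geometric rate on every smaller disk makes all later interchanges of
   limits explicit estimates. *)
Definition psr a f := forall r, 0 <= r < 1 -> exists B q, [/\ 0 <= B, 0 <= q < 1,
  forall n, cmod (a n) * r ^+ n <= B * q ^+ n &
  forall z N, cmod z <= r -> cmod (f z - psum a N z) <= B * q ^+ N].

Lemma psumS a N z : psum a N.+1 z = psum a N z + a N * z ^+ N.
Proof. by rewrite /psum big_ord_recr. Qed.

(** The difference [q ^+ N - q ^+ M] makes the induction on [M] exact; with consecutive indices it
    also yields the nested intervals of [psum_lim]. *)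
Lemma psum_tail a r B q z N M : 0 <= r -> 0 <= B -> 0 <= q < 1 ->
  (forall n, cmod (a n) * r ^+ n <= B * q ^+ n) -> cmod z <= r -> (N <= M)%N ->
  cmod (psum a M z - psum a N z) <= B / (1 - q) * (q ^+ N - q ^+ M).
Proof.
move=> r0 B0 /andP[q0 q1] ha zr /subnK <-; elim: (M - N)%N => [|k IH].
  by rewrite !subrr cmod0 mulr0.
rewrite addSn psumS.
have -> : psum a (k + N) z + a (k + N)%N * z ^+ (k + N) - psum a N z =
  (psum a (k + N) z - psum a N z) + a (k + N)%N * z ^+ (k + N) by ring.
apply: le_trans (cmodD _ _) _.
have h : cmod (a (k + N)%N * z ^+ (k + N)) <= B * q ^+ (k + N).
  rewrite cmodM cmodX; apply: le_trans (ha _).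
  by rewrite ler_wpM2l ?cmod_ge0 // lerXn2r ?nnegrE ?cmod_ge0.
apply: le_trans (lerD IH h) _; rewrite le_eqVlt; apply/orP; left; apply/eqP.
rewrite exprS; move: (q ^+ (k + N)) (q ^+ N) => X Y; field.
by rewrite subr_eq0 eq_sym lt_eqF.
Qed.

Lemma psum_tail_le a r B q z N M : 0 <= r -> 0 <= B -> 0 <= q < 1 ->
  (forall n, cmod (a n) * r ^+ n <= B * q ^+ n) -> cmod z <= r -> (N <= M)%N ->
  cmod (psum a M z - psum a N z) <= B / (1 - q) * q ^+ N.
Proof.
move=> r0 B0 q01 ha zr NM; apply: le_trans (psum_tail r0 B0 q01 ha zr NM) _.
case/andP: q01 => q0 q1; rewrite ler_wpM2l ?divr_ge0 ?subr_ge0 ?(ltW q1) //.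
by rewrite lerBlDr lerDl exprn_ge0.
Qed.

Lemma le_lim_pow (x y C q : R) : 0 <= q < 1 -> (forall N, x <= y + C * q ^+ N) -> x <= y.
Proof.
move=> /andP[q0 q1] h; apply/ler_addgt0Pr => e e0.
have [N hN] := small_pow C q0 q1 e0.
by apply: le_trans (h N) _; rewrite lerD2l hN.
Qed.

Lemma le_lim (x y : R) : (forall e, 0 < e -> x <= y + e) -> x <= y.
Proof. by move=> h; apply/ler_addgt0Pr. Qed.

Lemma psum_lim a r B q z : 0 <= r -> 0 <= B -> 0 <= q < 1 ->
  (forall n, cmod (a n) * r ^+ n <= B * q ^+ n) -> cmod z <= r ->
  exists l, forall N, cmod (l - psum a N z) <= 2 * (B / (1 - q)) * q ^+ N.
Proof.
move=> r0 B0 q01 ha zr; have /andP[q0 q1] := q01.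
have C0 : 0 <= B / (1 - q) by rewrite divr_ge0 // subr_ge0 ltW.
have st N : cmod (psum a N.+1 z - psum a N z) <= B / (1 - q) * q ^+ N - B / (1 - q) * q ^+ N.+1.
  by rewrite -mulrBr; exact: (psum_tail r0 B0 q01 ha zr (leqnSn N)).
(* Each coordinate of the limit is caught in nested intervals of radius [B / (1 - q) * q ^+ N];
   adding the two coordinates gives the factor 2 of the statement. *)
have nest (p : R[i] -> R) : (forall u v, `|p u - p v| <= cmod (u - v)) ->
    exists x, forall N, `|x - p (psum a N z)| <= B / (1 - q) * q ^+ N.
  move=> hp; have [x hx] : exists x, forall N,
      p (psum a N z) - B / (1 - q) * q ^+ N <= x <= p (psum a N z) + B / (1 - q) * q ^+ N.
    apply: nested_itv => N.
    - by have := le_trans (hp _ _) (st N); rewrite ler_norml => /andP[]; lra.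
    - by have := le_trans (hp _ _) (st N); rewrite ler_norml => /andP[]; lra.
    - by rewrite lerBlDr -addrA lerDl addr_ge0 // mulr_ge0 // exprn_ge0.
  exists x => N; have /andP[h1 h2] := hx N; rewrite ler_norml; apply/andP; split; lra.
have [x hx] := nest (@complex.Re R) (fun u v => ltac:(rewrite -ReB; exact: Re_le_cmod)).
have [y hy] := nest (@complex.Im R) (fun u v => ltac:(rewrite -ImB; exact: Im_le_cmod)).
exists (x +i* y) => N; apply: le_trans (cmod_le_ReIm _) _; rewrite ReB ImB /=.
have := hx N; have := hy N; lra.
Qed.

Lemma cdisk_eq0 (x y : R[i]) : (forall e, 0 < e -> cmod (x - y) <= e) -> x = y.
Proof.
move=> h; apply/eqP; rewrite -subr_eq0 -cmod_eq0 eq_le cmod_ge0 andbT.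
by apply: le_lim => e e0; rewrite add0r h.
Qed.

Lemma psr_ext a f g : (forall z, cmod z < 1 -> f z = g z) -> psr a f -> psr a g.
Proof.
move=> fg fa r r01; have [B [q [B0 q01 h1 h2]]] := fa r r01.
exists B, q; split => // z N zr; rewrite -fg ?h2 //.
by apply: le_lt_trans zr _; case/andP: r01.
Qed.

Lemma tcoef_bound f r B n : holomorphic_disk f -> 0 < r -> r < 1 ->
  (forall z, cmod z <= r -> cmod (f z) <= B) -> cmod (tcoef f n) * r ^+ n <= B.
Proof.
move=> hf r0 r1 hB; have := fcoef_bound (- n%:R) (hol_cont hf) (ltW r0) r1 hB.
rewrite fcoef_neg // cmodM cmodR ger0_norm; last first.
  by rewrite mulr_ge0 ?exprn_ge0 ?(ltW twopi_gt0) // ltW.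
rewrite -mulrA mulrC ler_pM2r ?twopi_gt0 //.
by rewrite mulrC.
Qed.

(* The Poisson means of f_s, s = |w|/rho, at rho w/|w| are the Taylor sum of f
   at w by orthogonality, and they tend to f w as rho tends to 1. *)
Lemma hol_psum_cvg f w e : holomorphic_disk f -> cmod w < 1 -> 0 < e ->
  exists N0, forall N, (N0 <= N)%N -> cmod (f w - psum (tcoef f) N w) <= e.
Proof.
move=> hf w1 e0; have cf := hol_cont hf; set r := cmod w in w1 *.
have T0 := @twopi_gt0 R.
have e2 : 0 < e / 3 by rewrite divr_gt0.
have [eta eta0 heta] := cf w w1 _ e2.
have heta' z : cmod (z - w) < eta -> cmod (f z - f w) <= e / 3.
  by move=> h; have := heta _ h; rewrite (addrC w) subrK.
(* The point [rho w / |w|] makes no sense at the origin; there the mean over a single small circle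
   is enough. *)
have [r0|r0] := eqVneq r 0.
  have w0 : w = 0 by apply/eqP; rewrite -cmod_eq0; apply/eqP.
  exists 1%N => N N1.
  have -> : psum (tcoef f) N w = tcoef f 0%N.
    rewrite /psum w0; case: N N1 => // N _; rewrite big_ord_recl expr0 mulr1 big1 ?addr0 // => i _.
    by rewrite expr0n mulr0.
  pose s := Num.min (eta / 2) 2^-1.
  have s0 : 0 < s by rewrite lt_min divr_gt0 // invr_gt0 ltr0n.
  have s1 : s < 1 by rewrite gt_min (invf_lt1) ?ltr1n ?orbT.
  have se : s < eta by rewrite gt_min; apply/orP; left; lra.
  have := fcoef_neg 0 hf s0 s1; rewrite expr0 mulr1 => E.
  have T0' : (2 * pi : R) != 0 by rewrite gt_eqF.
  have : cmod (fcoef f s (- 0%:R) - f w * (2 * pi)%:C) <= e / 3 * (2 * pi).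
    rewrite -[X in f w * X](_ : (2 * pi - 0)%:C = _) ?subr0 // -[X in X%:C]subr0.
    rewrite -(cint_cst (f w) (ltW T0)) -cintB; [|exact: cintble_fcoef (ltW s0) s1|exact: cintble_cst].
    rewrite -[X in _ <= _ * X]subr0; apply: cint_bound; first exact: ltW.
      by apply: cintbleB; [exact: cintble_fcoef (ltW s0) s1|exact: cintble_cst].
    move=> t _; rewrite oppr0 mul0r cis0 mulr1; apply: heta'.
    by rewrite w0 subr0 cmod_circle ?(ltW s0).
  rewrite E mulrC -mulrBl cmodM cmodR (gtr0_norm T0) ler_pM2r // cmodB => h.
  by apply: le_trans h _; lra.
have r0' : 0 < r by rewrite lt_neqAle eq_sym r0 cmod_ge0.
pose r1 := (1 + r) / 2.
have r11 : r1 < 1 by rewrite /r1; lra.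
have [B B0 hB] := cont_disk_bounded cf r11.
(* The first bound keeps [r / rho] below [r1], where [B] bounds [f]. The second is for the arc where
   [cis t] stays at distance [eta] from [z]: there the kernel is at most [2 * d / eta ^+ 2] and
   values of [f] differ by at most [2 * B]. *)
pose d := Num.min ((1 - r) / (1 + r)) (e / 3 * eta ^+ 2 / (4 * (B + 1))).
have B1 : 0 < 4 * (B + 1) by rewrite mulr_gt0 // ltr_wpDl.
have r1p : 0 < 1 + r by rewrite addr_gt0.
have d0 : 0 < d.
  rewrite lt_min; apply/andP; split; first by rewrite divr_gt0 // subr_gt0.
  by rewrite divr_gt0 // mulr_gt0 // exprn_gt0.
have d1 : d * (1 + r) <= 1 - r by rewrite -ler_pdivlMr // ge_min lexx.
have d2 : d * (4 * (B + 1)) <= e / 3 * eta ^+ 2.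
  by rewrite -ler_pdivlMr // ge_min lexx orbT.
clearbody d.
pose rho := 1 - d.
have dr : r * d >= 0 by rewrite mulr_ge0 // ltW.
have rho1 : rho < 1 by rewrite /rho; lra.
have rrho : r < rho by rewrite /rho; nra.
have rho0 : 0 < rho by exact: lt_trans rrho.
pose s := r / rho.
have s0 : 0 < s by rewrite divr_gt0.
have sr1 : s <= r1 by rewrite /s ler_pdivrMr // /r1 /rho; nra.
have s1 : s < 1 by exact: le_lt_trans r11.
pose z := (rho / r)%:C * w.
have zrho : cmod z = rho by rewrite /z cmodM cmodR ger0_norm ?divr_ge0 ?(ltW rho0) ?(ltW r0') // divfK.
have z1 : cmod z < 1 by rewrite zrho.
have szw : s%:C * z = w.
  rewrite /z mulrA -rmorphM /= (_ : s * (rho / r) = 1) ?mul1r //.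
  by rewrite /s; field; rewrite r0 gt_eqF.
clearbody z s.
pose v t := f (s%:C * cis t).
have iv : cintble 0 (2 * pi) v by apply: cintble_circle => //; exact: ltW.
have vB t : cmod (v t) <= B by apply: hB; rewrite cmod_circle // ltW.
have fwB : cmod (f w) <= B by apply: hB; rewrite -/r /r1; lra.
pose X := cint 0 (2 * pi) (fun t => (poisson z t)%:C * v t).
have hX1 : cmod (X - f w * (2 * pi)%:C) <= 2 * (e / 3) * (2 * pi).
  have -> : f w * (2 * pi)%:C = cint 0 (2 * pi) (fun t => (poisson z t)%:C * f w).
    rewrite -[in LHS](poisson_one z1).
    have -> : (rint 0 (2 * pi) (poisson z))%:C = cint 0 (2 * pi) (fun t => (poisson z t)%:C * 1).
      apply: complex_ext; rewrite cintE /=; first by apply: eq_rint => t _; rewrite ?mulr1 ?mulr0 ?subr0.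
      rewrite -[LHS](_ : rint 0 (2 * pi) (fun=> 0) = 0); last by rewrite rint_cst ?mul0r // ltW.
      by apply: eq_rint => t _; rewrite ?mulr0 ?mul0r ?addr0.
    rewrite -cintZ; last by apply: cintble_poisson => //; exact: cintble_cst.
    by apply: eq_cint => t _; rewrite mulr1 mulrC.
  rewrite -cintB; [|exact: cintble_poisson|by apply: cintble_poisson => //; exact: cintble_cst].
  have iD : cintble 0 (2 * pi) (fun t => (poisson z t)%:C * v t - (poisson z t)%:C * f w).
    by apply: cintbleB; [exact: cintble_poisson|apply: cintble_poisson => //; exact: cintble_cst].
  apply: le_trans (cint_le iD) _.
  have iP : intble 0 (2 * pi) (fun t => e / 3 * poisson z t + e / 3).
    by apply: intbleD; [apply: intbleZ; exact: intble_poisson|exact: intble_cst].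
  have -> : 2 * (e / 3) * (2 * pi) = rint 0 (2 * pi) (fun t => e / 3 * poisson z t + e / 3).
    rewrite rintD; [|by apply: intbleZ; exact: intble_poisson|exact: intble_cst].
    by rewrite rintZ ?poisson_one ?rint_cst ?(ltW T0) //; [ring|exact: intble_poisson].
  apply: le_rint => //; first exact: cintble_cmod.
  move=> t _; rewrite -mulrBr cmodM cmodR ger0_norm ?poisson_ge0 //.
  have P0 := poisson_ge0 t z1.
  have [h|h] := ltP (cmod (s%:C * cis t - w)) eta.
    rewrite mulrC; apply: le_trans (_ : e / 3 * poisson z t <= _).
      by rewrite ler_wpM2r // heta'.
    by rewrite lerDl ltW.
  have h1 : eta <= cmod (cis t - z).
    apply: le_trans h _; rewrite -[in X in X <= _]szw -mulrBr cmodM cmodR gtr0_norm //.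
    by rewrite ler_piMl ?cmod_ge0 // ltW.
  apply: le_trans (_ : e / 3 <= _); last by rewrite lerDr mulr_ge0 // ltW.
  have h2 : poisson z t <= 2 * d / eta ^+ 2.
    rewrite poissonE // zrho; apply: ler_pM.
    - by rewrite subr_ge0 expr_le1 // ltW.
    - by rewrite invr_ge0 sqr_ge0.
    - by rewrite /rho expr2; have := sqr_ge0 d; rewrite expr2; lra.
    - rewrite lef_pV2 ?posrE ?exprn_gt0 //; last exact: lt_le_trans h1.
      by rewrite lerXn2r ?nnegrE ?cmod_ge0 // ltW.
  have h3 : cmod (v t - f w) <= 2 * B by apply: le_trans (cmodB_le _ _) _; have := vB t; lra.
  apply: le_trans (ler_pM P0 (cmod_ge0 _) h2 h3) _.
  rewrite mulrAC ler_pdivrMr ?exprn_gt0 //; apply: le_trans d2.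
  have := mulr_ge0 (ltW d0) B0; lra.
have [N0 hN0] : exists N0, forall n, (N0 <= n)%N -> (2 / (1 - rho) * B) * rho ^+ n <= e / 3.
  by apply: small_pow => //; exact: ltW.
exists N0.+1 => -[//|N]; rewrite ltnS => N0N.
have hX2 : cmod (X - psum (tcoef f) N.+1 w * (2 * pi)%:C) <= e / 3 * (2 * pi).
  have := poisson_series N iv z1; rewrite -/X zrho.
  have -> : fc v 0 + \sum_(k < N) z ^+ k.+1 * fc v (- k.+1%:R) + \sum_(k < N) z^* ^+ k.+1 * fc v k.+1%:R
      = psum (tcoef f) N.+1 w * (2 * pi)%:C.
    rewrite [X in _ + X]big1 ?addr0 => [|k _]; last first.
      have /= := @fcoef_pos0 R f s k.+1 hf s0 s1 isT; rewrite /fcoef -/(v _) => h.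
      by rewrite /fc [X in _ * X]h mulr0.
    have E n : fc v (- n%:R) = (2 * pi * s ^+ n)%:C * tcoef f n by exact: fcoef_neg.
    rewrite /psum big_ord_recl mulrDl; congr (_ + _).
      by have := E 0%N; rewrite oppr0 => ->; rewrite !expr0 !mulr1 mulrC.
    rewrite mulr_suml; apply: eq_bigr => k _; rewrite E -[in RHS]szw exprMn !rmorphM rmorphXn /=.
    by rewrite /bump /= add1n; ring.
  move=> h; apply: le_trans h _.
  have hr : rint 0 (2 * pi) (fun t => cmod (v t)) <= B * (2 * pi).
    rewrite -[X in _ <= B * X]subr0 -rint_cst ?(ltW T0) //; apply: le_rint => //.
      exact: cintble_cmod.
    exact: intble_cst.
  have := hN0 N.+1 (leqW N0N); set Y := rho ^+ N.+1 => hY.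
  have c0 : 0 <= 2 * Y / (1 - rho) by rewrite divr_ge0 ?mulr_ge0 ?exprn_ge0 ?(ltW rho0) // subr_ge0 ltW.
  apply: le_trans (ler_wpM2l c0 hr) _; rewrite [X in X <= _]mulrA ler_pM2r //.
  apply: le_trans hY; rewrite le_eqVlt; apply/orP; left; apply/eqP; ring.
rewrite -(ler_pM2r T0).
have -> : cmod (f w - psum (tcoef f) N.+1 w) * (2 * pi) =
  cmod (f w * (2 * pi)%:C - psum (tcoef f) N.+1 w * (2 * pi)%:C).
  by rewrite -mulrBl cmodM cmodR gtr0_norm.
apply: le_trans (cmodDB _ _ X) _; rewrite cmodB.
apply: le_trans (lerD hX1 hX2) _.
by rewrite le_eqVlt; apply/orP; left; apply/eqP; field.
Qed.

(** Cauchy's estimate on the larger radius [r' = (1 + r) / 2] provides the ratio [q = r / r'];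
    pointwise convergence then identifies the limit of the partial sums with [f]. *)
Theorem hol_psr f : holomorphic_disk f -> psr (tcoef f) f.
Proof.
move=> hf r /andP[r0 r1]; pose r' := (1 + r) / 2.
have r'1 : r' < 1 by rewrite /r'; lra.
have r'0 : 0 < r' by rewrite /r'; lra.
have [B B0 hB] := cont_disk_bounded (hol_cont hf) r'1.
pose q := r / r'.
have q0 : 0 <= q by rewrite divr_ge0 // ltW.
have q1 : q < 1 by rewrite /q ltr_pdivrMr // mul1r /r'; lra.
have ha n : cmod (tcoef f n) * r ^+ n <= B * q ^+ n.
  have hb := tcoef_bound n hf r'0 r'1 hB.
  rewrite /q exprMn exprVn mulrCA [X in X <= _]mulrC ler_wpM2l ?exprn_ge0 //.
  by rewrite ler_pdivlMr ?exprn_gt0.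
have q01 : 0 <= q < 1 by rewrite q0.
have C0 : 0 <= B / (1 - q) by rewrite divr_ge0 // subr_ge0 ltW.
exists (B + B / (1 - q)), q; split => //; first exact: addr_ge0.
  by move=> n; apply: le_trans (ha n) _; rewrite ler_wpM2r ?exprn_ge0 // lerDl.
move=> z N zr; apply: le_trans (_ : B / (1 - q) * q ^+ N <= _); last first.
  by rewrite ler_wpM2r ?exprn_ge0 // lerDr.
apply: le_lim => e e0; have [N0 hN0] := hol_psum_cvg hf (le_lt_trans zr r1) e0.
apply: le_trans (cmodDB _ _ (psum (tcoef f) (maxn N N0) z)) _; rewrite addrC.
by apply: lerD; [apply: (psum_tail_le r0 B0 q01 ha zr); exact: leq_maxl|apply: hN0; exact: leq_maxr].
Qed.

End power_series.

(** * Differentiation of power series *)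

Section power_series_calculus.
Context {R : realType}.
Implicit Types (f g : R[i] -> R[i]) (z w : R[i]) (r q B e : R) (a b : nat -> R[i]).

(** The power [(q + d) ^+ n.+1] contains the binomial term [n.+1%:R * q ^+ n * d], and lowering its
    exponent to [n] only enlarges it as [q + d <= 1]. So the linear factors produced by
    differentiation cost a slightly larger ratio. *)
Lemma linear_geom_le q : 0 <= q < 1 -> exists C q', [/\ 0 <= C, 0 <= q' < 1 &
  forall n : nat, n.+1%:R * q ^+ n <= C * q' ^+ n].
Proof.
move=> /andP[q0 q1]; pose d := (1 - q) / 2.
have d0 : 0 < d by rewrite divr_gt0 // subr_gt0.
exists d^-1, (q + d); split; rewrite ?invr_ge0 ?(ltW d0) //.
  by rewrite addr_ge0 ?(ltW d0) //= /d; lra.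
move=> n; rewrite [X in X <= _]mulrC ler_pdivlMl //.
have dq : q + d <= 1 by rewrite /d; lra.
elim: n => [|n IH]; first by rewrite !expr0 !mulr1; lra.
rewrite [q ^+ _]exprS [(q + d) ^+ _]exprS -[n.+2]addn1 natrD mulrDr mulr1 mulrDr.
have h1 : d * (q * q ^+ n * n.+1%:R) <= q * (q + d) ^+ n.
  rewrite [X in X <= _](_ : _ = q * (d * (q ^+ n * n.+1%:R))); last by ring.
  by rewrite ler_wpM2l.
have h2 : d * (q * q ^+ n) <= d * (q + d) ^+ n.
  rewrite ler_wpM2l ?(ltW d0) // -exprS.
  apply: le_trans (_ : q ^+ n <= _).
    by rewrite exprS ler_piMl ?exprn_ge0 // ltW.
  by rewrite lerXn2r ?nnegrE ?addr_ge0 ?(ltW d0) // lerDl ltW.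
by rewrite [X in _ <= X]mulrDl; exact: lerD.
Qed.

Definition dcoef a n : R[i] := n.+1%:R * a n.+1.

Lemma dcoef_bound a r B q : 0 < r -> (forall n, cmod (a n) * r ^+ n <= B * q ^+ n) ->
  forall n, cmod (dcoef a n) * r ^+ n <= (B * q / r) * (n.+1%:R * q ^+ n).
Proof.
move=> r0 ha n; rewrite /dcoef cmodM cmod_ge_natr.
have := ha n.+1; rewrite !exprS => h.
rewrite [X in _ <= X](_ : _ = n.+1%:R * (B * (q * q ^+ n) / r)); last by ring.
rewrite -mulrA ler_wpM2l // ler_pdivlMr //; apply: le_trans h.
by rewrite le_eqVlt; apply/orP; left; apply/eqP; ring.
Qed.

(** The second order remainder should carry [r ^+ (n - 2)]; the factor [r ^+ 2] on the left avoids
    the truncated subtraction and lets the induction start at 0. *)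
Lemma monomial_taylor z h r n : 0 < r -> cmod z <= r -> cmod (z + h) <= r ->
  r ^+ 2 * cmod ((z + h) ^+ n - z ^+ n - h * (n%:R * z ^+ n.-1)) <= cmod h ^+ 2 * (n%:R ^+ 2 * r ^+ n).
Proof.
move=> r0 zr zhr; elim: n => [|n IH].
  by rewrite !expr0 mul0r mulr0 subrr subr0 cmod0 expr0n mul0r !mulr0.
have -> : (z + h) ^+ n.+1 - z ^+ n.+1 - h * (n.+1%:R * z ^+ n.+1.-1) =
  (z + h) * ((z + h) ^+ n - z ^+ n - h * (n%:R * z ^+ n.-1)) + n%:R * h ^+ 2 * z ^+ n.-1.
  by case: n {IH} => [|n] /=; rewrite ?expr0 ?expr1 ?exprS -?[n.+2]addn1 ?natrD; ring.
apply: le_trans (ler_wpM2l (sqr_ge0 r) (cmodD _ _)) _.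
rewrite !cmodM !cmodX cmod_ge_natr mulrDr.
set X := cmod (_ - _ - _) in IH *.
have X0 : 0 <= X by exact: cmod_ge0.
have h1 : r ^+ 2 * (cmod (z + h) * X) <= r * (cmod h ^+ 2 * (n%:R ^+ 2 * r ^+ n)).
  rewrite [X in X <= _]mulrCA.
  exact: (ler_pM (cmod_ge0 _) (mulr_ge0 (sqr_ge0 r) X0) zhr IH).
have h2 : r ^+ 2 * (n%:R * cmod h ^+ 2 * cmod z ^+ n.-1) <= n%:R * cmod h ^+ 2 * r ^+ n.+1.
  case: n {IH h1 X X0} => [|n]; first by rewrite !mul0r mulr0.
  rewrite (_ : r ^+ n.+2 = r ^+ 2 * r ^+ n); last by rewrite -exprD add2n.
  rewrite -[n.+1.-1]/n mulrCA; apply: ler_wpM2l; first by rewrite mulr_ge0 ?sqr_ge0.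
  apply: ler_wpM2l; first exact: sqr_ge0.
  by rewrite lerXn2r ?nnegrE ?cmod_ge0 // ltW.
apply: le_trans (lerD h1 h2) _.
have -> : cmod h ^+ 2 * (n.+1%:R ^+ 2 * r ^+ n.+1) = r * (cmod h ^+ 2 * (n%:R ^+ 2 * r ^+ n))
   + n%:R * cmod h ^+ 2 * r ^+ n.+1 + (n%:R + 1) * (cmod h ^+ 2 * r ^+ n.+1).
  by rewrite (_ : n.+1%:R = n%:R + 1 :> R) ?exprS; [ring|rewrite -natr1].
by rewrite lerDl; apply: mulr_ge0; rewrite ?addr_ge0 // mulr_ge0 ?sqr_ge0 // exprn_ge0 // ltW.
Qed.

Lemma sum_geom_le q N : 0 <= q < 1 -> \sum_(i < N) q ^+ i <= (1 - q)^-1.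
Proof.
move=> /andP[q0 q1]; have d0 : 0 < 1 - q by rewrite subr_gt0.
rewrite -[X in _ <= X]mul1r ler_pdivlMr //.
have -> : (\sum_(i < N) q ^+ i) * (1 - q) = 1 - q ^+ N.
  elim: N => [|N IH]; first by rewrite big_ord0 mul0r expr0 subrr.
  by rewrite big_ord_recr /= mulrDl IH exprS; ring.
by rewrite gerBl exprn_ge0.
Qed.

Lemma psr_dcoef_lim a f : psr a f -> forall r, 0 <= r < 1 -> exists B q, [/\ 0 <= B, 0 <= q < 1,
  forall n, cmod (dcoef a n) * r ^+ n <= B * q ^+ n &
  forall z, cmod z <= r -> exists l, forall N, cmod (l - psum (dcoef a) N z) <= B * q ^+ N].
Proof.
move=> fa r /andP[r0 r1]; pose r' := (1 + r) / 2.
have r'01 : 0 <= r' < 1 by apply/andP; split; rewrite /r'; lra.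
have r'0 : 0 < r' by rewrite /r'; lra.
have rr' : r <= r' by rewrite /r'; lra.
have [B [q [B0 q01 h1 _]]] := fa r' r'01; have /andP[q0 q1] := q01.
have [C [q' [C0 q'01 hC]]] := linear_geom_le q01; have /andP[q'0 q'1] := q'01.
pose D := B * q / r' * C.
have D0 : 0 <= D by rewrite !mulr_ge0 // invr_ge0 ltW.
have hD n : cmod (dcoef a n) * r ^+ n <= D * q' ^+ n.
  apply: le_trans (_ : cmod (dcoef a n) * r' ^+ n <= _).
    by rewrite ler_wpM2l ?cmod_ge0 // lerXn2r ?nnegrE // ltW.
  apply: le_trans (dcoef_bound r'0 h1 n) _; rewrite /D -[X in _ <= X]mulrA.
  by apply: ler_wpM2l => //; rewrite !mulr_ge0 ?invr_ge0 ?(ltW r'0).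
exists (D + 2 * (D / (1 - q'))), q'; split => //.
- by rewrite addr_ge0 // mulr_ge0 // divr_ge0 // subr_ge0 ltW.
- move=> n; apply: le_trans (hD n) _; rewrite ler_wpM2r ?exprn_ge0 // lerDl.
  by rewrite mulr_ge0 // divr_ge0 // subr_ge0 ltW.
- move=> z zr; have [l hl] := psum_lim r0 D0 q'01 hD zr; exists l => N.
  by apply: le_trans (hl N) _; rewrite ler_wpM2r ?exprn_ge0 // lerDr.
Qed.

Lemma psr_cdiff a f z l B q : psr a f -> cmod z < 1 -> 0 <= q < 1 ->
  (forall N, cmod (l - psum (dcoef a) N z) <= B * q ^+ N) -> cdiff f z l.
Proof.
move=> fa z1 q01 hl e e0; pose r := (1 + cmod z) / 2.
have z0 := cmod_ge0 z.
have r0 : 0 < r by rewrite /r; lra.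
have r01 : 0 <= r < 1 by apply/andP; split; rewrite /r; lra.
have [B1 [q1 [B10 q101 h1 h2]]] := fa r r01.
have [C [q2 [C0 q201 hC]]] := linear_geom_le q101.
have [C' [q3 [C'0 q301 hC']]] := linear_geom_le q201.
(* [K] bounds the second order sums below; the two factors [i] are absorbed one after the other, by
   the passages from [q1] to [q2] and from [q2] to [q3]. *)
pose K := B1 * (C * C') / (1 - q3).
have K0 : 0 <= K by rewrite /K !mulr_ge0 // invr_ge0 subr_ge0; case/andP: q301 => _ /ltW.
have hK N : \sum_(i < N) (i%:R ^+ 2 * (cmod (a i) * r ^+ i)) <= K.
  apply: le_trans (_ : \sum_(i < N) (B1 * (C * C')) * q3 ^+ i <= _).
    apply: ler_sum => i _; have hi : (0:R) <= i%:R by [].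
    have hn : (i%:R : R) <= i.+1%:R by rewrite ler_nat.
    apply: le_trans (ler_wpM2l (sqr_ge0 _) (h1 i)) _.
    rewrite [X in X <= _](_ : _ = B1 * (i%:R * (i%:R * q1 ^+ i))); last by ring.
    rewrite -mulrA ler_wpM2l //.
    have q1i : 0 <= q1 ^+ i by rewrite exprn_ge0; case/andP: q101.
    have q2i : 0 <= q2 ^+ i by rewrite exprn_ge0; case/andP: q201.
    have E1 : i%:R * q1 ^+ i <= C * q2 ^+ i by apply: le_trans (hC i); rewrite ler_wpM2r.
    have E2 : i%:R * q2 ^+ i <= C' * q3 ^+ i by apply: le_trans (hC' i); rewrite ler_wpM2r.
    apply: le_trans (ler_wpM2l hi E1) _; rewrite mulrCA -mulrA ler_wpM2l //.
  rewrite -mulr_sumr ler_wpM2l ?mulr_ge0 //; exact: sum_geom_le.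
pose d := Num.min ((1 - cmod z) / 2) (e * r ^+ 2 / (K + 1)).
have K1 : 0 < K + 1 by rewrite ltr_wpDl.
have d0 : 0 < d.
  rewrite lt_min; apply/andP; split; first by rewrite divr_gt0 // subr_gt0.
  by rewrite divr_gt0 // mulr_gt0 // exprn_gt0.
exists d => // h; rewrite lt_min => /andP[hd1 hd2].
have zr : cmod z <= r by rewrite /r; lra.
have zhr : cmod (z + h) <= r by apply: le_trans (cmodD _ _) _; rewrite /r; lra.
have h0 := cmod_ge0 h.
have step N : cmod (psum a N.+1 (z + h) - psum a N.+1 z - psum (dcoef a) N z * h) <= cmod h ^+ 2 / r ^+ 2 * K.
  have -> : psum a N.+1 (z + h) - psum a N.+1 z - psum (dcoef a) N z * h =
     \sum_(i < N.+1) a i * ((z + h) ^+ i - z ^+ i - h * (i%:R * z ^+ i.-1)).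
    rewrite (_ : psum (dcoef a) N z * h = \sum_(i < N.+1) a i * (h * (i%:R * z ^+ i.-1))).
      by rewrite /psum -!sumrB; apply: eq_bigr => i _; ring.
    rewrite big_ord_recl mul0r !mulr0 add0r /psum mulr_suml; apply: eq_bigr => i _.
    by rewrite lift0 /dcoef /=; ring.
  apply: le_trans (cmod_sum _ _ _) _.
  apply: le_trans (_ : \sum_(i < N.+1) cmod h ^+ 2 / r ^+ 2 * (i%:R ^+ 2 * (cmod (a i) * r ^+ i)) <= _).
    apply: ler_sum => i _; rewrite cmodM.
    have := monomial_taylor i r0 zr zhr => hm.
    rewrite [X in _ <= X](_ : _ = cmod (a i) * ((cmod h ^+ 2 * (i%:R ^+ 2 * r ^+ i)) / r ^+ 2)); last by ring.
    by rewrite ler_wpM2l ?cmod_ge0 // ler_pdivlMr ?exprn_gt0 // mulrC.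
  rewrite -mulr_sumr ler_wpM2l ?divr_ge0 ?sqr_ge0 //.
have main : cmod (f (z + h) - f z - l * h) <= cmod h ^+ 2 / r ^+ 2 * K.
  pose Q := Num.max q q1.
  have Q01 : 0 <= Q < 1.
    by case/andP: q01 => a1 a2; case/andP: q101 => b1 b2; rewrite le_max a1 gt_max a2 b2.
  have qQ N : q ^+ N <= Q ^+ N by apply: lerXn2r; rewrite ?nnegrE ?le_max ?lexx //; case/andP: q01 => ->.
  have q1Q N : q1 ^+ N.+1 <= Q ^+ N.
    apply: le_trans (_ : Q ^+ N.+1 <= _).
      by apply: lerXn2r; rewrite ?nnegrE ?le_max ?lexx ?orbT //; case/andP: q101 => -> //; rewrite orbT.
    by rewrite exprS; case/andP: Q01 => Q0 Q1; rewrite ler_piMl ?exprn_ge0 // ltW.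
  apply: (@le_lim_pow _ _ _ (2 * B1 + `|B| * cmod h) _ Q01) => N.
  have -> : f (z + h) - f z - l * h = (psum a N.+1 (z + h) - psum a N.+1 z - psum (dcoef a) N z * h)
     + ((f (z + h) - psum a N.+1 (z + h)) - (f z - psum a N.+1 z) - (l - psum (dcoef a) N z) * h) by ring.
  apply: le_trans (cmodD _ _) _; apply: lerD; first exact: step.
  apply: le_trans (cmodB_le _ _) _; rewrite [X in _ <= X]mulrDl; apply: lerD.
    apply: le_trans (cmodB_le _ _) _.
    have b1 := h2 _ N.+1 zhr; have b2 := h2 _ N.+1 zr.
    have b3 : B1 * q1 ^+ N.+1 <= B1 * Q ^+ N by rewrite ler_wpM2l.
    by rewrite mulrAC; lra.
  rewrite cmodM mulrAC ler_wpM2r //; apply: le_trans (hl N) _.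
  apply: le_trans (_ : `|B| * q ^+ N <= _); last by rewrite ler_wpM2l.
  by rewrite ler_wpM2r ?ler_norm // exprn_ge0; case/andP: q01.
have hh : cmod h * (K + 1) <= e * r ^+ 2 by rewrite -ler_pdivlMr // ltW.
apply: le_trans main _.
have -> : cmod h ^+ 2 / r ^+ 2 * K = cmod h * (cmod h * K / r ^+ 2) by ring.
rewrite [e * _]mulrC ler_wpM2l // ler_pdivrMr ?exprn_gt0 //; apply: le_trans hh.
by rewrite ler_wpM2l // lerDl.
Qed.

Lemma psr_hol a f : psr a f -> holomorphic_disk f.
Proof.
move=> fa; apply: cdiff_hol => z z1.
have z01 : 0 <= cmod z < 1 by rewrite cmod_ge0.
have [B [q [_ q01 _ /(_ z (lexx _)) [l hl]]]] := psr_dcoef_lim fa z01.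
by exists l; exact: psr_cdiff fa z1 q01 hl.
Qed.

Lemma psr_deriv a f : psr a f -> psr (dcoef a) (cderiv f).
Proof.
move=> fa r r01; have [B [q [B0 q01 h1 h2]]] := psr_dcoef_lim fa r01.
exists B, q; split => // z N zr; have [l hl] := h2 z zr.
have z1 : cmod z < 1 by apply: le_lt_trans zr _; case/andP: r01.
by have /cdiff_cderiv[_ ->] := psr_cdiff fa z1 q01 hl.
Qed.

Lemma hol_deriv f : holomorphic_disk f -> holomorphic_disk (cderiv f).
Proof. by move=> /hol_psr/psr_deriv/psr_hol. Qed.

End power_series_calculus.

(** * Parseval and Littlewood-Paley *)

Section parseval.
Context {R : realType}.
Implicit Types (f g : R[i] -> R[i]) (z w : R[i]) (r q B e : R) (a b : nat -> R[i]).
Local Notation T := (2 * pi : R).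

(** Real-valued, because a function continuous on the disk is bounded on each smaller circle; the
    supremum over [r] of its square root is [H2norm f]. *)
Definition m2 f r : R := T^-1 * rint 0 T (fun t => cmod (f (r%:C * cis t)) ^+ 2).

Lemma eq_cmeas (D : set R) (u v : R -> R[i]) : u =1 v -> cmeas D u -> cmeas D v.
Proof. by move=> /funext ->. Qed.

Lemma T_ge0 : 0 <= T. Proof. exact: ltW twopi_gt0. Qed.
Lemma T_neq0 : T != 0. Proof. by rewrite gt_eqF // twopi_gt0. Qed.

Lemma intble_sqcmod (a b : R) (u : R -> R[i]) (M : R) : cmeas `[a, b]%classic u ->
  (forall x, a <= x <= b -> cmod (u x) <= M) -> intble a b (fun t => cmod (u t) ^+ 2).
Proof.
move=> mu_ uM; apply: (intble_bounded (M := M ^+ 2)).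
  by apply: measurable_funX; exact: cmeas_cmod.
move=> x xab; rewrite ger0_norm ?sqr_ge0 // lerXn2r ?nnegrE ?cmod_ge0 ?uM //.
exact: le_trans (cmod_ge0 _) (uM _ xab).
Qed.

Lemma intble_circle2 f r (a b : R) : cont_disk f -> 0 <= r -> r < 1 ->
  intble a b (fun t => cmod (f (r%:C * cis t)) ^+ 2).
Proof.
move=> cf r0 r1; have [B B0 hB] := cont_disk_bounded cf r1.
apply: (intble_sqcmod (M := B)); last by move=> x _; rewrite hB // cmod_circle.
by apply: (cmeasS measurableT) => //; exact: cmeas_circle.
Qed.

Lemma m2_ge0 f r : 0 <= m2 f r.
Proof.
by rewrite mulr_ge0 ?invr_ge0 ?T_ge0 //; apply: rint_ge0 => x _; exact: sqr_ge0.
Qed.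

Lemma cint_cis_neg n : (0 < n)%N -> cint 0 T (fun t => cis (- n%:R * t)) = 0.
Proof.
move=> n0; rewrite -(fc_one_neg n0); apply: eq_cint => t _; by rewrite mul1r.
Qed.

Lemma cont_psum a N : cont_disk (psum a N).
Proof.
move=> z _; suff [d zd] : exists d, cdiff (psum a N) z d by exact: cdiff_cont zd.
elim: N => [|N [d IH]].
  exists 0; apply: (cdiff_ext ltr01 _ (cdiff_cst 0 z)) => w _.
  by rewrite /psum big_ord0.
have [d' hd'] : exists d, cdiff (fun w => w ^+ N) z d.
  elim: N {d IH} => [|N [d IH]]; first by exists 0; exact: cdiff_cst.
  eexists; apply: (cdiff_ext ltr01 _ (cdiffM (cdiff_id z) IH)) => w _.
  by rewrite exprS.
eexists; apply: (cdiff_ext ltr01 _ (cdiffD IH (cdiffM (cdiff_cst (a N) z) hd'))) => w _.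
by rewrite psumS.
Qed.

Lemma sqr_cmodD z w : cmod (z + w) ^+ 2 = cmod z ^+ 2 + 2 * Re (z * w^*) + cmod w ^+ 2.
Proof. by rewrite !sqr_cmod; case: z w => [x y] [u v] /=; ring. Qed.

(** Adding the monomial of degree [N] creates a cross term with nonzero frequencies only, which
    integrates to 0. *)
Lemma parseval_psum a N r : 0 <= r < 1 ->
  m2 (psum a N) r = \sum_(n < N) cmod (a n) ^+ 2 * (r ^+ n) ^+ 2.
Proof.
move=> /andP[r0 r1]; elim: N => [|N IH].
  rewrite big_ord0 /m2 (@eq_rint _ _ _ _ (fun=> 0)); first by rewrite rint_cst ?T_ge0 // mul0r mulr0.
  by move=> x _; rewrite /psum big_ord0 cmod0 expr0n.
rewrite big_ord_recr /= -IH /m2.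
have i1 := intble_circle2 0 T (cont_psum a N) r0 r1.
pose w t : R[i] := a N * (r%:C * cis t) ^+ N.
have w2 t : cmod (w t) ^+ 2 = cmod (a N) ^+ 2 * (r ^+ N) ^+ 2.
  by rewrite /w cmodM cmodX cmod_circle // exprMn.
have ip i : cintble 0 T (fun t => (r%:C * cis t) ^+ i * (w t)^*).
  have cw : cmeas `[0, T]%classic (fun t : R => cis t).
    apply: (cmeasS measurableT) => //.
    by apply: eq_cmeas (cmeas_cis 1) => t; rewrite mul1r.
  have cX n : cmeas `[0, T]%classic (fun t : R => (r%:C * cis t) ^+ n).
    elim: n => [|n IHn]; first exact: cmeas_cst.
    apply: eq_cmeas (cmeasM (cmeasM (cmeas_cst `[0, T]%classic r%:C) cw) IHn) => t.
    by rewrite exprS.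
  apply: (cintble_dom (v := fun=> r ^+ i * (cmod (a N) * r ^+ N))).
  - apply: cmeasM => //; apply: cmeasJ; apply: cmeasM => //; exact: cmeas_cst.
  - exact: intble_cst.
  - by move=> x _; rewrite cmodM cmodJ !(cmodM (a N)) !cmodX cmod_circle.
have ortho i : (i < N)%N -> cint 0 T (fun t => (r%:C * cis t) ^+ i * (w t)^*) = 0.
  move=> iN; rewrite (@eq_cint _ _ _ _ (fun t => (r ^+ (i + N))%:C * (a N)^* * cis (- (N - i)%:R * t))).
    rewrite cintZ ?cint_cis_neg ?mulr0 ?subn_gt0 //.
    by apply: ccont_cintble; exact: ccont_cis.
  move=> t _; rewrite /w conjcM conjcX conjcM conjc_real -cisN !exprMn !cisX.
  have -> : cis (- (N - i)%:R * t) = cis (t *+ i) * cis (- t *+ N).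
    rewrite -cisD; congr cis; rewrite natrB ?(ltnW iN) // -mulr_natl -[- t *+ N]mulr_natl; ring.
  by rewrite rmorphXn /= exprD; ring.
have iS : cintble 0 T (fun t => psum a N (r%:C * cis t) * (w t)^*).
  have := cintble_sum N (fun i => cintbleZ (a i) (ip i)).
  apply: eq_cintble => t _; rewrite /psum mulr_suml; apply: eq_bigr => i _; by rewrite mulrA.
have S0 : cint 0 T (fun t => psum a N (r%:C * cis t) * (w t)^*) = 0.
  rewrite (@eq_cint _ _ _ _ (fun t => \sum_(i < N) a i * ((r%:C * cis t) ^+ i * (w t)^*))).
    rewrite (cint_sum N T_ge0 (fun i => cintbleZ (a i) (ip i))) big1 // => i _.
    by rewrite cintZ // ortho // mulr0.
  by move=> t _; rewrite /psum mulr_suml; apply: eq_bigr => i _; rewrite mulrA.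
have [iR _] := iS; have := congr1 (@complex.Re R) S0; rewrite cintE /= => S1.
have -> : rint 0 T (fun t => cmod (psum a N.+1 (r%:C * cis t)) ^+ 2) =
  rint 0 T (fun t => cmod (psum a N (r%:C * cis t)) ^+ 2 + 2 * Re (psum a N (r%:C * cis t) * (w t)^*)
      + cmod (a N) ^+ 2 * (r ^+ N) ^+ 2).
  by apply: eq_rint => t _; rewrite psumS sqr_cmodD w2.
rewrite rintD; [|by apply: intbleD => //; exact: intbleZ|exact: intble_cst].
rewrite rintD //; last exact: intbleZ.
rewrite (rintZ 2 iR) S1 mulr0 addr0 rint_cst ?T_ge0 // subr0 mulrDr; congr (_ + _).
by rewrite mulrCA mulVf ?T_neq0 // mulr1.
Qed.

(** On the circle, [f] and its partial sum are bounded and differ by a geometric error, hence so do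
    their squared moduli; [parseval_psum] evaluates the mean for the partial sum. *)
Lemma parseval a f r : psr a f -> 0 <= r < 1 -> exists C q, [/\ 0 <= C, 0 <= q < 1 &
  forall N, `|m2 f r - \sum_(n < N) cmod (a n) ^+ 2 * (r ^+ n) ^+ 2| <= C * q ^+ N].
Proof.
move=> fa r01; have /andP[r0 r1] := r01; have cf := hol_cont (psr_hol fa).
have [B [q [B0 q01 h1 h2]]] := fa r r01; have /andP[q0 q1] := q01.
have [D D0 hD] := cont_disk_bounded cf r1.
exists (B * (2 * D + B)), q; split => //.
  by rewrite mulr_ge0 // addr_ge0 // mulr_ge0.
move=> N; rewrite -parseval_psum // /m2 -mulrBr -rintB; last 2 first.
  exact: intble_circle2.
  exact: intble_circle2 (cont_psum _ _) _ _.
rewrite normrM ger0_norm ?invr_ge0 ?T_ge0 // mulrC ler_pdivrMr ?twopi_gt0 //.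
have iD : intble 0 T (fun t => cmod (f (r%:C * cis t)) ^+ 2 - cmod (psum a N (r%:C * cis t)) ^+ 2).
  by apply: intbleB; [exact: intble_circle2|exact: intble_circle2 (cont_psum _ _) _ _].
apply: le_trans (le_norm_rint iD) _.
apply: (@le_trans _ _ (rint 0 T (fun=> B * (2 * D + B) * q ^+ N))); last first.
  by rewrite rint_cst ?T_ge0 // subr0.
apply: le_rint.
- exact: intble_norm.
- exact: intble_cst.
move=> t _; set z := r%:C * cis t.
have zr : cmod z <= r by rewrite cmod_circle.
have e1 := h2 z N zr; have e2 := hD z zr.
have qN : q ^+ N <= 1 by rewrite exprn_ile1 // ltW.
have BqN : B * q ^+ N <= B by rewrite ler_piMr.
have e3 : cmod (psum a N z) <= D + B.
  have := ler_cmodB (psum a N z) (f z); rewrite cmodB; lra.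
have e4 : `|cmod (f z) - cmod (psum a N z)| <= B * q ^+ N.
  have := ler_cmodB (psum a N z) (f z); rewrite cmodB => k1.
  have := ler_cmodB (f z) (psum a N z) => k2.
  rewrite ler_norml; apply/andP; split; lra.
have -> : cmod (f z) ^+ 2 - cmod (psum a N z) ^+ 2 =
  (cmod (f z) - cmod (psum a N z)) * (cmod (f z) + cmod (psum a N z)) by ring.
rewrite normrM mulrAC; apply: ler_pM => //.
rewrite ger0_norm ?addr_ge0 ?cmod_ge0 //; lra.
Qed.

Lemma parseval_le a f r N : psr a f -> 0 <= r < 1 ->
  \sum_(n < N) cmod (a n) ^+ 2 * (r ^+ n) ^+ 2 <= m2 f r.
Proof.
move=> fa r01; have [C [q [C0 q01 h]]] := parseval fa r01; have /andP[q0 q1] := q01.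
apply: le_lim => e e0; have [M hM] := small_pow C q0 q1 e0.
have := hM (N + M)%N (leq_addl _ _); have := h (N + M)%N; rewrite ler_norml => /andP[h1 _] h2.
have : \sum_(n < N) cmod (a n) ^+ 2 * (r ^+ n) ^+ 2 <= \sum_(n < N + M) cmod (a n) ^+ 2 * (r ^+ n) ^+ 2.
  by rewrite big_split_ord /= lerDl; apply: sumr_ge0 => i _; rewrite mulr_ge0 ?sqr_ge0.
lra.
Qed.

Lemma parseval_ge a f r K : psr a f -> 0 <= r < 1 ->
  (forall N, \sum_(n < N) cmod (a n) ^+ 2 * (r ^+ n) ^+ 2 <= K) -> m2 f r <= K.
Proof.
move=> fa r01 hK; have [C [q [C0 q01 h]]] := parseval fa r01.
apply: (@le_lim_pow _ _ _ C q q01) => N; have := h N; rewrite ler_norml => /andP[_ h1].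
rewrite lerBlDr in h1; apply: le_trans h1 _; rewrite [X in X <= _]addrC lerD2r; exact: hK.
Qed.

Lemma parseval_small a f r e : psr a f -> 0 <= r < 1 -> 0 < e -> exists N0, forall N, (N0 <= N)%N ->
  m2 f r - \sum_(n < N) cmod (a n) ^+ 2 * (r ^+ n) ^+ 2 <= e.
Proof.
move=> fa r01 e0; have [C [q [C0 /andP[q0 q1] h]]] := parseval fa r01.
have [M hM] := small_pow C q0 q1 e0; exists M => N MN.
by apply: le_trans (ler_norm _) _; apply: le_trans (h N) _; exact: hM.
Qed.

(** By Parseval both sides are tails of nonnegative terms that increase with the radius. Hence a
    truncation level chosen at the outer radius serves for all smaller radii. *)
Lemma m2_mono_tail a f s r N : psr a f -> 0 <= s -> s <= r -> r < 1 ->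
  m2 f s - \sum_(n < N) cmod (a n) ^+ 2 * (s ^+ n) ^+ 2 <=
  m2 f r - \sum_(n < N) cmod (a n) ^+ 2 * (r ^+ n) ^+ 2.
Proof.
move=> fa s0 sr r1; have r0 := le_trans s0 sr.
rewrite lerBlDr; apply: (parseval_ge fa); first by rewrite s0 (le_lt_trans sr).
move=> M; set Sr := \sum_(n < N) _ * (r ^+ n) ^+ 2; set Ss := \sum_(n < N) _.
have r01 : 0 <= r < 1 by rewrite r0.
have := parseval_le (N + M) fa r01; rewrite big_split_ord /= -/Sr.
set Tr := \sum_(n < M) _ => h.
apply: (@le_trans _ _ (\sum_(n < N + M) cmod (a n) ^+ 2 * (s ^+ n) ^+ 2)).
  by rewrite addnC big_split_ord /= lerDl; apply: sumr_ge0 => i _; rewrite mulr_ge0 ?sqr_ge0.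
rewrite big_split_ord /= -/Ss; set Ts := \sum_(n < M) _.
have : Ts <= Tr.
  apply: ler_sum => i _; rewrite ler_wpM2l ?sqr_ge0 // lerXn2r ?nnegrE ?exprn_ge0 //.
  by rewrite lerXn2r ?nnegrE.
lra.
Qed.

End parseval.

(** * Primitives and radial weights *)

Section antiderivative.
Context {R : realType}.
Implicit Types (f g : R[i] -> R[i]) (z w : R[i]) (r q B e : R) (a d : nat -> R[i]).

Lemma rintX01 k : intble 0 1 (fun t : R => t ^+ k) /\ rint 0 1 (fun t : R => t ^+ k) = k.+1%:R^-1.
Proof.
have cX n : continuous (fun t : R => t ^+ n) by exact: exprn_continuous.
have iX : intble 0 1 (fun t : R => t ^+ k).
  by apply: intble_cont; apply: continuous_subspaceT; exact: cX.
split=> //; pose F (t : R) : R := k.+1%:R^-1 * t ^+ k.+1.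
have dF x : is_derive x (1 : R) F (x ^+ k).
  have hX : is_derive x (1 : R) (fun t : R => t ^+ k.+1) (k.+1%:R *: x ^+ k *: 1).
    by apply: DeriveDef; [exact: exprn_derivable|rewrite exp_derive].
  have := @is_deriveZ _ _ _ _ (k.+1%:R^-1 : R) _ _ _ hX.
  by rewrite /GRing.scale /= mulr1 mulKf.
have cF : continuous F.
  by move=> x; apply: differentiable_continuous; apply/derivable1_diffP; case: (dF x).
have dFo : derivable_oo_LRcontinuous F 0 1.
  split=> [x _||]; first by case: (dF x).
    by apply: cvg_at_right_filter; exact: cF.
  by apply: cvg_at_left_filter; exact: cF.
have := @continuous_FTC2 R (fun t => t ^+ k) F 0 1 ltr01 (continuous_subspaceT (cX k)) dFo.
rewrite /rint /Rintegral => ->.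
  by rewrite /= /F expr1n mulr1 expr0n mulr0 subr0.
by move=> x _; rewrite derive1E; case: (dF x).
Qed.

Lemma cintX01 k : cintble 0 1 (fun t : R => (t%:C) ^+ k : R[i]) /\
  cint 0 1 (fun t : R => (t%:C) ^+ k : R[i]) = (k.+1%:R^-1 : R)%:C.
Proof.
have [iX rX] := rintX01 k.
have E t : (t%:C : R[i]) ^+ k = (t ^+ k)%:C by rewrite rmorphXn.
split.
  by split; [apply: eq_intble iX|apply: eq_intble (intble_cst 0 1 0)] => x _; rewrite E.
rewrite cintE; apply: complex_ext => /=.
  by rewrite -rX; apply: eq_rint => x _; rewrite E.
rewrite -[RHS](_ : rint 0 1 (fun=> 0) = 0); last by rewrite rint_cst ?mul0r.
by apply: eq_rint => x _; rewrite E.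
Qed.

Definition acoef d n : R[i] := if n is k.+1 then d k * (k.+1%:R^-1 : R)%:C else 0.

Lemma ccont_ray f z : cont_disk f -> cmod z < 1 -> ccont 0 1 (fun t => f (t%:C * z)).
Proof.
move=> cf z1 x /andP[x0 x1] e e0.
have xz : cmod (x%:C * z) < 1.
  by rewrite cmodM cmodR ger0_norm //; apply: le_lt_trans z1; rewrite ler_piMl ?cmod_ge0.
have [s s0 hs] := cf _ xz e e0; exists s => // y _ ys.
have -> : y%:C * z = x%:C * z + (y - x)%:C * z by rewrite rmorphB /=; ring.
apply: hs; rewrite cmodM cmodR; apply: le_lt_trans ys; rewrite ler_piMr //.
exact: ltW.
Qed.

Lemma psr_segment_integral d f : psr d f -> psr (acoef d) (segment_integral f).
Proof.
move=> fd r r01; have [B [q [B0 q01 h1 h2]]] := fd r r01.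
have /andP[q0 q1] := q01; have /andP[r0 r1] := r01.
(* A ratio of at least 1/2 pays for the index shift of integration: [q ^+ N <= 2 * Q ^+ N.+1], even
   when [q] is 0. *)
pose Q := Num.max q 2^-1.
have qQ : q <= Q by rewrite le_max lexx.
have Qh : 2^-1 <= Q by rewrite le_max lexx orbT.
have Q0 : 0 <= Q by exact: le_trans qQ.
have Q1 : Q < 1 by rewrite gt_max q1 invf_lt1 // ltr1n.
have BQ N : B * q ^+ N <= 2 * B * Q ^+ N.+1.
  have h3 : q ^+ N <= Q ^+ N by rewrite lerXn2r ?nnegrE.
  have h4 : Q ^+ N <= 2 * Q ^+ N.+1.
    rewrite exprS mulrA ler_peMl ?exprn_ge0 //; lra.
  rewrite mulrAC [2 * _ * B]mulrC; apply: ler_wpM2l => //; exact: le_trans h4.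
exists (2 * B), Q; split; rewrite ?mulr_ge0 ?Q0 //.
  case=> [|n]; first by rewrite /acoef cmod0 mul0r expr0 mulr1 mulr_ge0.
  rewrite /acoef cmodM cmodR ger0_norm ?invr_ge0 //.
  apply: le_trans (BQ n); apply: le_trans (h1 n).
  have i0 : (0 : R) <= n.+1%:R^-1 by rewrite invr_ge0.
  have i1 : n.+1%:R^-1 <= 1 :> R by rewrite invf_le1 ?ler1n ?ltr0n.
  have ir := mulr_ile1 i0 r0 i1 (ltW r1).
  rewrite exprS; have -> : cmod (d n) * n.+1%:R^-1 * (r * r ^+ n) =
    (n.+1%:R^-1 * r) * (cmod (d n) * r ^+ n) by ring.
  by rewrite ler_piMl // mulr_ge0 ?cmod_ge0 ?exprn_ge0.
move=> z N zr; have cf := hol_cont (psr_hol fd).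
have z1 : cmod z < 1 by exact: le_lt_trans r1.
have seg M : cmod (segment_integral f z - psum (acoef d) M.+1 z) <= B * q ^+ M.
  have iray := ccont_cintble (ccont_ray cf z1).
  have ifz : cintble 0 1 (fun t => f (t%:C * z) * z).
    by apply: eq_cintble (cintbleZ z iray) => t _; rewrite mulrC.
  have iX k := (cintX01 k).1.
  have iterm k : cintble 0 1 (fun t => d k * z ^+ k.+1 * (t%:C) ^+ k) by apply: cintbleZ.
  have -> : psum (acoef d) M.+1 z = cint 0 1 (fun t => \sum_(k < M) d k * z ^+ k.+1 * (t%:C) ^+ k).
    rewrite (cint_sum M ler01 iterm) /psum big_ord_recl mul0r add0r; apply: eq_bigr => k _.
    by rewrite cintZ // (cintX01 k).2 lift0 /=; ring.
  rewrite -cintB //; last exact: (cintble_sum M iterm).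
  rewrite -[X in _ <= X]mulr1 -[X in _ * X]subr0; apply: cint_bound => //.
    by apply: cintbleB => //; exact: (cintble_sum M iterm).
  move=> t /andP[t0 t1].
  have -> : \sum_(k < M) d k * z ^+ k.+1 * t%:C ^+ k = psum d M (t%:C * z) * z.
    by rewrite /psum mulr_suml; apply: eq_bigr => k _; rewrite exprMn exprS; ring.
  rewrite -mulrBl cmodM; apply: (@le_trans _ _ (cmod (f (t%:C * z) - psum d M (t%:C * z)))).
    by rewrite ler_piMr ?cmod_ge0 // ltW.
  apply: h2; rewrite cmodM cmodR ger0_norm //; apply: le_trans zr.
  by rewrite ler_piMl ?cmod_ge0.
case: N => [|N]; last exact: le_trans (seg N) (BQ N).
have := seg 0%N; rewrite /psum big_ord_recl !big_ord0 mul0r addr0 subr0 !expr0 !mulr1 => h.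
by apply: le_trans h _; rewrite ler_peMl // ler1n.
Qed.

(** Restricting the weighted integral to polynomials in the radius avoids any question about how
    [m2] depends on it; Parseval reduces everything to this case. *)
Lemma rint_weight_poly N (x : nat -> R) :
  intble 0 1 (fun s => (1 - s) * \sum_(i < N) x i * (s ^+ i) ^+ 2) /\
  rint 0 1 (fun s => (1 - s) * \sum_(i < N) x i * (s ^+ i) ^+ 2) =
    \sum_(i < N) x i * ((i.*2.+1%:R)^-1 - (i.*2.+2%:R)^-1).
Proof.
elim: N => [|N [IH1 IH2]].
  rewrite big_ord0; split; first by apply: eq_intble (intble_cst 0 1 0) => s _; rewrite big_ord0 mulr0.
  rewrite -[RHS](_ : rint 0 1 (fun=> 0) = 0); last by rewrite rint_cst ?mul0r.
  by apply: eq_rint => s _; rewrite big_ord0 mulr0.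
have E s : (1 - s) * (\sum_(i < N.+1) x i * (s ^+ i) ^+ 2) =
   (1 - s) * (\sum_(i < N) x i * (s ^+ i) ^+ 2) + x N * (s ^+ N.*2 - s ^+ N.*2.+1).
  by rewrite big_ord_recr /= -exprM muln2 [s ^+ N.*2.+1]exprS; ring.
have iN : intble 0 1 (fun s : R => x N * (s ^+ N.*2 - s ^+ N.*2.+1)).
  by apply: intbleZ; apply: intbleB; apply: (rintX01 _).1.
split; first by apply: eq_intble (intbleD IH1 iN) => s _; rewrite E.
rewrite (eq_rint (fun s _ => E s)) rintD // IH2 big_ord_recr /=; congr (_ + _).
rewrite rintZ ?rintB; [|exact: (rintX01 _).1|exact: (rintX01 _).1|by apply: intbleB; apply: (rintX01 _).1].
by rewrite !(rintX01 _).2.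
Qed.

End antiderivative.

(** * The Littlewood-Paley comparison *)

Section littlewood_paley.
Context {R : realType}.
Implicit Types (f g k : R[i] -> R[i]) (z w : R[i]) (r q B e : R).

(** The product equals [(n + 1) / (2 * (2 * n + 1))], which decreases from 1/2 towards 1/4; the two
    bounds serve the two directions of the comparison. *)
Lemma weight_bounds (n : nat) : let w : R := (n.*2.+1%:R)^-1 - (n.*2.+2%:R)^-1 in
  1 <= 4 * (n.+1%:R ^+ 2 * w) /\ n.+1%:R ^+ 2 * w <= 2^-1.
Proof.
pose x : R := n%:R; have x0 : 0 <= x by [].
have E1 : n.*2.+1%:R = 2 * x + 1 :> R by rewrite -addn1 natrD -mul2n natrM.
have E2 : n.*2.+2%:R = 2 * (x + 1) :> R by rewrite -addn2 natrD -mul2n natrM mulrDr mulr1.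
have E3 : n.+1%:R = x + 1 :> R by rewrite natr1.
have h1 : 2 * x + 1 != 0 by apply/eqP => h; lra.
have h2 : x + 1 != 0 by apply/eqP => h; lra.
have h3 : 0 < 2 * (2 * x + 1) by lra.
rewrite /= E1 E2 E3 (_ : (x + 1) ^+ 2 * _ = (x + 1) / (2 * (2 * x + 1))); last by field; rewrite h1 h2.
split; first by rewrite mulrA ler_pdivlMr //; lra.
by rewrite ler_pdivrMr //; lra.
Qed.

Lemma sum_small (J : nat) (F : nat -> nat -> R) e : 0 < e ->
  (forall j d, 0 < d -> exists N0, forall N, (N0 <= N)%N -> F j N <= d) ->
  exists N0, forall N, (N0 <= N)%N -> \sum_(j < J) F j N <= e.
Proof.
move=> + hF; elim: J e => [|J IH] e e0; first by exists 0%N => N _; rewrite big_ord0 ltW.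
have e2 : 0 < e / 2 by rewrite divr_gt0.
have [N1 h1] := IH _ e2; have [N2 h2] := hF J _ e2.
exists (maxn N1 N2) => N; rewrite geq_max => /andP[n1 n2].
by rewrite big_ord_recr /= [e]splitr lerD ?h1 ?h2.
Qed.

(* With L h = int_0^1 (1 - r) m2 h (rho r) dr, Parseval bounds m2 of a primitive
   of k by 4 L k and L h' by m2 h / 2; so an inequality between the means of the
   derivatives passes to the functions. *)
Lemma littlewood_paley k (J : nat) (h : nat -> R[i] -> R[i]) (rho c eps : R) :
  holomorphic_disk k -> (forall j, holomorphic_disk (h j)) ->
  0 <= rho -> rho < 1 -> 0 <= c -> 0 <= eps ->
  (forall s, 0 <= s <= rho -> c * m2 k s <= \sum_(j < J) m2 (cderiv (h j)) s + eps) ->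
  c * m2 (segment_integral k) rho <= 2 * (\sum_(j < J) m2 (h j) rho) + 4 * eps.
Proof.
move=> hk hh rho0 rho1 c0 eps0 hm.
have rho01 : 0 <= rho < 1 by rewrite rho0.
have S0 : 0 <= \sum_(j < J) m2 (h j) rho by apply: sumr_ge0 => j _; exact: m2_ge0.
move: c0; rewrite le_eqVlt => /predU1P[<-|c0].
  by rewrite mul0r addr_ge0 ?mulr_ge0.
rewrite mulrC -ler_pdivlMr //.
have pk := hol_psr hk; have ph j := hol_psr (hh j).
apply: (parseval_ge (psr_segment_integral pk)) => // N; rewrite ler_pdivlMr //.
apply: le_lim => e e0; have e4 : 0 < e / 4 by rewrite divr_gt0.
pose b j := dcoef (tcoef (h j)).
have pb j : psr (b j) (cderiv (h j)) by exact: psr_deriv.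
(* One truncation level, taken at the outer radius [rho], is used at every smaller radius through
   [m2_mono_tail]. *)
have [M hM] := @sum_small J (fun j M => m2 (cderiv (h j)) rho - \sum_(n < M) cmod (b j n) ^+ 2 * (rho ^+ n) ^+ 2)
  _ e4 (fun j d d0 => parseval_small (pb j) rho01 d0).
have {hM} := hM M (leqnn _) => hM.
case: N => [|N].
  by rewrite big_ord0 mul0r !addr_ge0 ?mulr_ge0 // ltW.
pose x n := c * (cmod (tcoef k n) ^+ 2 * (rho ^+ n) ^+ 2).
pose y n := \sum_(j < J) cmod (b j n) ^+ 2 * (rho ^+ n) ^+ 2.
pose w n : R := (n.*2.+1%:R)^-1 - (n.*2.+2%:R)^-1.
have key s : 0 <= s <= 1 -> \sum_(n < N) x n * (s ^+ n) ^+ 2 <= \sum_(n < M) y n * (s ^+ n) ^+ 2 + (e / 4 + eps).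
  move=> /andP[s0 s1]; pose sg := rho * s.
  have sg0 : 0 <= sg by rewrite mulr_ge0.
  have sgr : sg <= rho by rewrite ler_piMr.
  have sg01 : 0 <= sg < 1 by rewrite sg0 (le_lt_trans sgr).
  have E n : (sg ^+ n) ^+ 2 = (rho ^+ n) ^+ 2 * (s ^+ n) ^+ 2 by rewrite !exprMn.
  have L1 : \sum_(n < N) x n * (s ^+ n) ^+ 2 = c * \sum_(n < N) cmod (tcoef k n) ^+ 2 * (sg ^+ n) ^+ 2.
    by rewrite mulr_sumr; apply: eq_bigr => n _; rewrite E /x; ring.
  have L2 : \sum_(n < M) y n * (s ^+ n) ^+ 2 = \sum_(j < J) \sum_(n < M) cmod (b j n) ^+ 2 * (sg ^+ n) ^+ 2.
    rewrite exchange_big /=; apply: eq_bigr => n _; rewrite /y mulr_suml; apply: eq_bigr => j _.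
    by rewrite E mulrA.
  rewrite L1 L2.
  apply: le_trans (ler_wpM2l (ltW c0) (parseval_le N pk sg01)) _.
  apply: le_trans (hm _ _) _; first by rewrite sg0.
  rewrite addrA lerD2r -lerBlDl -sumrB; apply: le_trans hM; apply: ler_sum => j _.
  exact: m2_mono_tail.
have {key} int_le : \sum_(n < N) x n * w n <= \sum_(n < M) y n * w n + (e / 4 + eps).
  have [i1 r1] := rint_weight_poly N x; have [i2 r2] := rint_weight_poly M y.
  have [i3 r3] := rint_weight_poly 1 (fun=> e / 4 + eps).
  rewrite -r1 -r2.
  apply: (@le_trans _ _ (rint 0 1 (fun s => (1 - s) * (\sum_(i < M) y i * (s ^+ i) ^+ 2)
      + (1 - s) * (\sum_(i < 1) (e / 4 + eps) * (s ^+ i) ^+ 2)))).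
    apply: le_rint => //; first exact: intbleD.
    move=> s s01; rewrite -mulrDr big_ord1 expr0 expr1n mulr1; apply: ler_wpM2l; last exact: key.
    by rewrite subr_ge0; case/andP: s01.
  rewrite rintD // lerD2l r3 big_ord1 /= invr1.
  have E0 : 0 <= e / 4 + eps by rewrite addr_ge0 // ltW.
  by rewrite ler_piMr //; lra.
rewrite big_ord_recl (_ : acoef _ ord0 = 0) // cmod0 expr0n mul0r add0r.
have w0 n : 0 <= w n.
  rewrite /w subr_ge0 lef_pV2 ?posrE ?ltr0n // ler_nat; exact: leqnSn.
have x0 n : 0 <= x n by rewrite /x mulr_ge0 ?(ltW c0) // mulr_ge0 ?sqr_ge0.
apply: (@le_trans _ _ (4 * rho ^+ 2 * (\sum_(n < N) x n * w n))).
  rewrite mulr_suml mulr_sumr; apply: ler_sum => n _.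
  have [h1 _] := weight_bounds n; rewrite -/(w n) in h1.
  rewrite lift0 /acoef cmodM cmodR ger0_norm ?invr_ge0 // exprMn [rho ^+ n.+1]exprS exprMn.
  pose v : R := n.+1%:R; have v0 : v != 0 by rewrite pnatr_eq0.
  have -> : cmod (tcoef k n) ^+ 2 * n.+1%:R^-1 ^+ 2 * (rho ^+ 2 * (rho ^+ n) ^+ 2) * c =
     rho ^+ 2 * (x n * n.+1%:R^-1 ^+ 2) by rewrite /x; ring.
  rewrite [X in _ <= X](_ : _ = rho ^+ 2 * (x n * (4 * w n))); last by ring.
  rewrite ler_wpM2l ?sqr_ge0 // ler_wpM2l //.
  rewrite exprVn -[X in X <= _]mul1r ler_pdivrMr ?exprn_gt0 ?ltr0n //.
  by apply: le_trans h1 _; rewrite le_eqVlt; apply/orP; left; apply/eqP; ring.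
have r2 : rho ^+ 2 <= 1 by rewrite exprn_ile1 // ltW.
apply: (@le_trans _ _ (4 * rho ^+ 2 * (\sum_(n < M) y n * w n + (e / 4 + eps)))).
  by rewrite ler_wpM2l // mulr_ge0 // sqr_ge0.
rewrite mulrDr -addrA; apply: lerD; last first.
  have E0 : 0 <= e / 4 + eps by rewrite addr_ge0 // ltW.
  have -> : 4 * eps + e = 4 * (e / 4 + eps) by field.
  by rewrite ler_wpM2r // ler_piMr.
rewrite -mulrA [X in X <= _](_ : _ = 2 * (2 * rho ^+ 2 * \sum_(n < M) y n * w n)); last by ring.
rewrite ler_wpM2l //.
apply: (@le_trans _ _ (\sum_(j < J) \sum_(n < M.+1) cmod (tcoef (h j) n) ^+ 2 * (rho ^+ n) ^+ 2)); last first.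
  by apply: ler_sum => j _; exact: parseval_le.
rewrite mulr_sumr.
apply: (@le_trans _ _ (\sum_(n < M) \sum_(j < J) cmod (tcoef (h j) n.+1) ^+ 2 * (rho ^+ n.+1) ^+ 2)).
  apply: ler_sum => n _; rewrite /y mulr_suml mulr_sumr; apply: ler_sum => j _.
  have [_ h2] := weight_bounds n; rewrite -/(w n) in h2.
  rewrite /b /dcoef cmodM cmod_ge_natr exprMn [rho ^+ n.+1]exprS [in X in _ <= X]exprMn.
  have -> : 2 * rho ^+ 2 * (n.+1%:R ^+ 2 * cmod (tcoef (h j) n.+1) ^+ 2 * (rho ^+ n) ^+ 2 * w n) =
    (2 * (n.+1%:R ^+ 2 * w n)) * (cmod (tcoef (h j) n.+1) ^+ 2 * (rho ^+ 2 * (rho ^+ n) ^+ 2)) by ring.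
  apply: ler_piMl; first by rewrite mulr_ge0 ?sqr_ge0 // mulr_ge0 ?sqr_ge0.
  by rewrite -ler_pdivlMl // mulr1.
rewrite exchange_big /=; apply: ler_sum => j _; rewrite big_ord_recl lerDr.
by rewrite mulr_ge0 ?sqr_ge0.
Qed.

End littlewood_paley.

(** * The Hardy norm through square means *)

Section hardy_space.
Context {R : realType}.
Implicit Types (f g : R[i] -> R[i]) (r K : R).

Lemma sqrt_m2E f r : cont_disk f -> 0 <= r -> r < 1 ->
  (sqrte (((2 * pi)^-1)%R%:E *
     \int[lebesgue_measure]_(t in `[0%R, (2 * pi)%R])
        (cmod (f (r%:C%C * cis t)) ^+ 2)%R%:E) = (Num.sqrt (m2 f r))%:E)%E.
Proof. by move=> cf r0 r1; rewrite rint_EFin //; exact: intble_circle2. Qed.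

Lemma H2norm_le f K : cont_disk f -> 0 <= K -> (forall r, 0 <= r -> r < 1 -> m2 f r <= K ^+ 2) ->
  (H2norm f <= K%:E)%E.
Proof.
move=> cf K0 h; apply: ge_ereal_sup => x [r /=]; rewrite in_itv /= => /andP[r0 r1] <-.
rewrite sqrt_m2E // lee_fin -(ger0_norm K0) -sqrtr_sqr ler_sqrt ?sqr_ge0 //.
exact: h.
Qed.

Lemma H2norm_ge f r : cont_disk f -> 0 <= r -> r < 1 -> ((Num.sqrt (m2 f r))%:E <= H2norm f)%E.
Proof.
move=> cf r0 r1; rewrite -sqrt_m2E //; apply: ereal_sup_ubound.
by exists r => //=; rewrite in_itv /= r0.
Qed.

Lemma H2norm_ge0 f : cont_disk f -> (0 <= H2norm f)%E.
Proof.
move=> cf; apply: le_trans (H2norm_ge cf (lexx 0) ltr01).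
by rewrite lee_fin sqrtr_ge0.
Qed.

Lemma H2_bound f : H2 f -> exists K, [/\ 0 <= K, H2norm f = K%:E &
  forall r, 0 <= r -> r < 1 -> m2 f r <= K ^+ 2].
Proof.
move=> [hf ff]; have cf := hol_cont hf; have f0 := H2norm_ge0 cf.
have fE : (H2norm f) = (fine (H2norm f))%:E by rewrite fineK // ge0_fin_numE.
have K0 : 0 <= fine (H2norm f) by exact: fine_ge0.
exists (fine (H2norm f)); split => // r r0 r1.
have := H2norm_ge cf r0 r1; rewrite {1}fE lee_fin => h.
rewrite -[X in X <= _](sqr_sqrtr (m2_ge0 f r)).
by rewrite lerXn2r ?nnegrE ?sqrtr_ge0.
Qed.

Lemma m2_H2 f K : holomorphic_disk f -> 0 <= K ->
  (forall r, 0 <= r -> r < 1 -> m2 f r <= K ^+ 2) -> H2 f.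
Proof.
move=> hf K0 h; split => //; apply: le_lt_trans (H2norm_le (hol_cont hf) K0 h) _.
exact: ltry.
Qed.

Lemma H2norm_bounded (S : (R[i] -> R[i]) -> R[i] -> R[i]) f K : 0 <= K ->
  H2 f -> holomorphic_disk (S f) ->
  (forall r, 0 <= r -> r < 1 -> forall C, (forall r, 0 <= r -> r < 1 -> m2 f r <= C) -> m2 (S f) r <= K ^+ 2 * C) ->
  H2 (S f) /\ (H2norm (S f) <= K%:E * H2norm f)%E.
Proof.
move=> K0 hf hS h; have [C [C0 fC mC]] := H2_bound hf.
have key r : 0 <= r -> r < 1 -> m2 (S f) r <= (K * C) ^+ 2.
  by move=> r0 r1; rewrite exprMn; apply: h.
have KC : 0 <= K * C by rewrite mulr_ge0.
split; first exact: m2_H2 key.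
rewrite fC -EFinM; exact: H2norm_le (hol_cont hS) KC key.
Qed.

End hardy_space.

(** * Square summable sequences *)

Section l2_sequences.
Context {R : realType}.
Implicit Types (x : nat -> R) (C e r : R).

Lemma bernoulli_pow r n : 0 <= r <= 1 -> 1 - n%:R * (1 - r) <= r ^+ n.
Proof.
move=> /andP[r0 r1]; elim: n => [|n IH]; first by rewrite mul0r subr0 expr0.
rewrite exprS -natr1; have rn1 : r ^+ n <= 1 by rewrite exprn_ile1.
have : (1 - r) * r ^+ n <= 1 - r by rewrite ler_piMr // subr_ge0.
rewrite mulrBl mul1r => h; rewrite mulrDl mul1r; lra.
Qed.

(** With [N] fixed all radial factors tend to 1: at radius [1 - d], Bernoulli's inequality bounds
    the total loss by [d * S]. *)
Lemma sum_le_of_radial x C N : (forall n, 0 <= x n) ->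
  (forall r, 0 <= r -> r < 1 -> \sum_(n < N) x n * (r ^+ n) ^+ 2 <= C) -> \sum_(n < N) x n <= C.
Proof.
move=> x0 h; apply: le_lim => e e0; pose S := \sum_(n < N) x n * (n * 2)%:R.
have S0 : 0 <= S by apply: sumr_ge0 => n _; rewrite mulr_ge0.
have S1 : 0 < S + 1 by rewrite ltr_wpDl.
pose d := Num.min 1 (e / (S + 1)).
have d0 : 0 < d by rewrite lt_min ltr01 divr_gt0.
have d1 : d <= 1 by rewrite ge_min lexx.
have dS : d * (S + 1) <= e by rewrite -ler_pdivlMr // ge_min lexx orbT.
clearbody d; have r0 : 0 <= 1 - d by lra.
have r1 : 1 - d < 1 by lra.
have r01 : 0 <= 1 - d <= 1 by rewrite r0 ltW.
have := h _ r0 r1.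
have : \sum_(n < N) x n - d * S <= \sum_(n < N) x n * ((1 - d) ^+ n) ^+ 2.
  rewrite /S mulr_sumr -sumrB; apply: ler_sum => n _.
  have := bernoulli_pow (n * 2) r01; rewrite exprM => hb.
  have := ler_wpM2l (x0 n) hb.
  rewrite (_ : 1 - (1 - d) = d); last by ring.
  by apply: le_trans; rewrite le_eqVlt; apply/orP; left; apply/eqP; ring.
lra.
Qed.

Lemma l2_tail x C : (forall n, 0 <= x n) -> (forall N, \sum_(n < N) x n <= C) ->
  forall e, 0 < e -> exists M, forall N, \sum_(n < N) (if (n < M)%N then 0 else x n) <= e.
Proof.
move=> x0 hC e e0; pose A := [set \sum_(n < N) x n | N in setT].
have sA : has_sup A by split; [exists 0, 0%N => //; rewrite big_ord0|exists C => _ [N _ <-]].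
have [_ [M _ <-] hM] := sup_adherent e0 sA.
exists M => N.
have mono m k : \sum_(n < m) x n <= \sum_(n < m + k) x n.
  by rewrite big_split_ord /= lerDl; apply: sumr_ge0.
have le_sup m : \sum_(n < m) x n <= sup A by apply: sup_upper_bound => //; exists m.
have : \sum_(n < N) (if (n < M)%N then 0 else x n) <= \sum_(n < M + N) x n - \sum_(n < M) x n.
  apply: (@le_trans _ _ (\sum_(n < N + M) (if (n < M)%N then 0 else x n))).
    rewrite big_split_ord /= lerDl; apply: sumr_ge0 => i _; by case: ifP.
  rewrite addnC big_split_ord /= [X in _ <= X - _]big_split_ord /= big1 => [|i _]; last by rewrite ltn_ord.
  rewrite add0r addrAC subrr add0r; apply: ler_sum => i _.
  by rewrite ltnNge leq_addr.
have := le_sup (M + N)%N; lra.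
Qed.

End l2_sequences.

(** * The Poisson formula and bounds on the kernel *)

Section poisson_formula.
Context {R : realType}.
Implicit Types (f g : R[i] -> R[i]) (z w : R[i]) (a b r s t e d : R).
Local Notation T := (2 * pi : R).

Lemma psum_cdiff (c : nat -> R[i]) N z : exists d : R[i], cdiff (psum c N) z d.
Proof.
elim: N => [|N [d IH]].
  exists 0; apply: (cdiff_ext ltr01 _ (cdiff_cst 0 z)) => w _.
  by rewrite /psum big_ord0.
have [d' hd'] : exists d : R[i], cdiff (fun w => w ^+ N) z d.
  elim: N {d IH} => [|N [d IH]]; first by exists 0; exact: cdiff_cst.
  eexists; apply: (cdiff_ext ltr01 _ (cdiffM (cdiff_id z) IH)) => w _.
  by rewrite exprS.
eexists; apply: (cdiff_ext ltr01 _ (cdiffD IH (cdiffM (cdiff_cst (c N) z) hd'))) => w _.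
by rewrite psumS.
Qed.

Lemma psr_sub_psum (a : nat -> R[i]) f M : psr a f ->
  psr (fun n => if (n < M)%N then 0 else a n) (fun z => f z - psum a M z).
Proof.
move=> fa r r01; have [B [q [B0 q01 h1 h2]]] := fa r r01; have /andP[q0 q1] := q01.
have /andP[r0 r1] := r01.
have tail z N : psum (fun n => if (n < M)%N then 0 else a n) N z =
    if (N <= M)%N then 0 else psum a N z - psum a M z.
  case: leqP => NM.
    by rewrite /psum big1 // => i _; rewrite (leq_trans (ltn_ord i) NM) mul0r.
  rewrite -(subnKC (ltnW NM)) /psum !big_split_ord /= big1 => [|i _]; last by rewrite ltn_ord mul0r.
  rewrite add0r addrAC subrr add0r; apply: eq_bigr => i _.
  by rewrite ltnNge leq_addr.
exists B, q; split => //.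
  by move=> n; case: ifP => _ //; rewrite cmod0 mul0r mulr_ge0 ?exprn_ge0.
move=> z N zr; rewrite tail; case: leqP => NM.
  rewrite subr0; apply: le_trans (h2 z M zr) _.
  by rewrite ler_wpM2l // ler_wiXn2l // ltW.
have -> : f z - psum a M z - (psum a N z - psum a M z) = f z - psum a N z by ring.
exact: h2.
Qed.

Lemma fc_circle0 f s : holomorphic_disk f -> 0 < s -> s < 1 ->
  (forall n, fc (fun t => f (s%:C * cis t)) (- n%:R) = (2 * pi * s ^+ n)%:C * tcoef f n) /\
  (forall n, (0 < n)%N -> fc (fun t => f (s%:C * cis t)) n%:R = 0).
Proof.
by move=> hf s0 s1; split => n; [exact: fcoef_neg|move=> n0; exact: fcoef_pos0].
Qed.

(** On a circle the coefficients of [f] at positive frequencies vanish, so its Poisson series is the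
    Taylor series at [s z]. Radius 0 is treated apart because the coefficient formulas need a
    positive one. *)
Lemma poisson_hol f s z : holomorphic_disk f -> 0 <= s -> s < 1 -> cmod z < 1 ->
  cint 0 T (fun t => (poisson z t)%:C * f (s%:C * cis t)) = f (s%:C * z) * T%:C.
Proof.
move=> hf; rewrite le_eqVlt => /predU1P[<- _ z1|s0 s1 z1].
  rewrite mul0r (@eq_cint _ _ _ _ (fun t => f 0 * (poisson z t)%:C)); last first.
    by move=> t _; rewrite mul0r mulrC.
  have iP : cintble 0 T (fun t => (poisson z t)%:C).
    by apply: eq_cintble (cintble_poisson z1 (cintble_cst 0 T 1)) => t _; rewrite mulr1.
  rewrite cintZ //; congr (_ * _); rewrite cintE; apply: complex_ext => /=.
    exact: poisson_one.
  by rewrite rint_cst ?T_ge0 // mul0r.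
have [h1 h2] := fc_circle0 hf s0 s1; have cf := hol_cont hf.
pose v t := f (s%:C * cis t).
have iv : cintble 0 T v by apply: cintble_circle => //; exact: ltW.
have z01 : 0 <= cmod z < 1 by rewrite cmod_ge0.
have sz1 : cmod (s%:C * z) < 1.
  rewrite cmodM cmodR gtr0_norm //; apply: le_lt_trans z1; rewrite ler_piMl ?cmod_ge0 //.
  exact: ltW.
have sz01 : 0 <= cmod (s%:C * z) < 1 by rewrite cmod_ge0.
have [B [q [B0 q01 _ h4]]] := hol_psr hf sz01.
have /andP[q0 q1] := q01.
pose D := 2 * cmod z / (1 - cmod z) * rint 0 T (fun t => cmod (v t)).
pose Q := Num.max (cmod z) q.
have Q0 : 0 <= Q by rewrite le_max q0 orbT.
have Q01 : 0 <= Q < 1 by rewrite Q0 gt_max z1.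
have D0 : 0 <= D.
  rewrite /D mulr_ge0 //; last by apply: rint_ge0 => x _; exact: cmod_ge0.
  by rewrite divr_ge0 ?mulr_ge0 ?cmod_ge0 // subr_ge0 ltW.
apply/eqP; rewrite -subr_eq0 -cmod_eq0 eq_le cmod_ge0 andbT.
apply: (@le_lim_pow _ _ _ (D + B * T) _ Q01) => N; rewrite add0r.
apply: le_trans (cmodDB _ _ (psum (tcoef f) N.+1 (s%:C * z) * T%:C)) _.
rewrite [X in _ <= X]mulrDl; apply: lerD.
  have := poisson_series N iv z1.
  have -> : fc v 0 + \sum_(k < N) z ^+ k.+1 * fc v (- k.+1%:R) + \sum_(k < N) z^* ^+ k.+1 * fc v k.+1%:R
      = psum (tcoef f) N.+1 (s%:C * z) * T%:C.
    rewrite [X in _ + X]big1 ?addr0 => [|k _]; last by rewrite h2 // mulr0.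
    rewrite /psum big_ord_recl mulrDl; congr (_ + _).
      by have := h1 0%N; rewrite oppr0 => ->; rewrite !expr0 !mulr1 mulrC.
    rewrite mulr_suml; apply: eq_bigr => k _; rewrite h1 exprMn [(_ * s ^+ _)%:C]rmorphM rmorphXn lift0 /=.
    by ring.
  move=> h; apply: le_trans h _.
  rewrite exprS [X in X <= _](_ : _ = D * cmod z ^+ N); last by rewrite /D; ring.
  by rewrite ler_wpM2l // lerXn2r ?nnegrE ?cmod_ge0 // le_max lexx.
rewrite -mulrBl cmodM cmodR ger0_norm ?T_ge0 // mulrAC ler_wpM2r ?T_ge0 //.
rewrite cmodB; apply: le_trans (h4 _ N.+1 (lexx _)) _; rewrite ler_wpM2l //.
apply: (@le_trans _ _ (q ^+ N)); first by rewrite exprS ler_piMl ?exprn_ge0 // ltW.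
by rewrite lerXn2r ?nnegrE // le_max lexx orbT.
Qed.

(** Up to 1/2, two uses of the mean value theorem give [sin y >= y / 2]. Beyond, monotonicity keeps
    the sine at least 1/4, which suffices as [x <= 2]. *)
Lemma sin_lower (x : R) : 0 <= x <= pi / 2 -> x / 8 <= sin x.
Proof.
have half (y : R) : 0 <= y -> y <= 2^-1 -> y / 2 <= sin y.
  move=> y0 y1; have cc (f : R -> R) a b : continuous f -> {within `[a, b], continuous f}.
    by move=> cf; exact: continuous_subspaceT.
  have [c /[!in_itv]/= /andP[c0 cy]] := @MVT_segment R (@sin R) (@cos R) 0 y y0
    (fun u _ => is_derive_sin u) (cc _ _ _ (@continuous_sin R)).
  rewrite sin0 !subr0 => ->.
  have [c' /[!in_itv]/= /andP[c'0 c'c]] := @MVT_segment R (@cos R) (fun u => - sin u) 0 c c0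
    (fun u _ => is_derive_cos u) (cc _ _ _ (@continuous_cos R)).
  rewrite cos0 subr0 => hc.
  have hs : c * sin c' <= c by rewrite ler_piMr // sin_le1.
  rewrite mulrC ler_wpM2r //; have : - sin c' * c = - (c * sin c') by ring.
  lra.
move=> /andP[x0 xp]; have p2 := @pihalf_lt2 R; have p1 := @pihalf_ge1 R.
have [x1|x1] := leP x 2^-1; first by apply: le_trans (half _ x0 x1); lra.
have h2 : (0:R) <= 2^-1 by lra.
have := half 2^-1 h2 (lexx _); have : sin 2^-1 <= sin x.
  apply: ltW; rewrite ltr_sin // in_itv /=; apply/andP; split; lra.
lra.
Qed.

(** The half-angle formula and [sin_lower] give [2 * (s / 16) ^+ 2], which is [s ^+ 2 / 128]. *)
Lemma cos_upper s : `|s| <= pi -> s ^+ 2 / 128 <= 1 - cos s.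
Proof.
move=> sp; have -> : 1 - cos s = 2 * sin (`|s| / 2) ^+ 2.
  have -> : cos s = cos `|s| by case: (leP 0 s) => h; [rewrite ger0_norm|rewrite ltr0_norm // cosN].
  have -> : cos `|s| = cos ((`|s| / 2) *+ 2) by congr cos; rewrite mulr2n -splitr.
  by rewrite cos_mulr2n; have := cos2Dsin2 (`|s| / 2); move: (cos _ ^+ 2) (sin _ ^+ 2) => c d; rewrite mulr2n; lra.
have h : `|s| / 2 / 8 <= sin (`|s| / 2) by apply: sin_lower; rewrite divr_ge0 //= ler_pM2r.
have h0 : 0 <= `|s| / 2 / 8 by rewrite !divr_ge0.
have E : (`|s| / 2 / 8) ^+ 2 = `|s| ^+ 2 / 256 by field.
have := ler_pM h0 h0 h h; rewrite -!expr2 E -[s ^+ 2]real_normK ?num_real //.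
lra.
Qed.

(* Unlocked, the numeral is expanded to unary form by unification. *)
Definition pc : R := locked 256.
Lemma pcE : pc = 256. Proof. by rewrite /pc -lock. Qed.
Lemma pc_ge0 : 0 <= pc. Proof. by rewrite pcE ler0n. Qed.

(** In the second bound the numerator [1 - r ^+ 2] is at most [2 * (1 - r)] and the denominator at
    least [(t - th) ^+ 2 / 128]: this is the origin of the 256 in [pc]. *)
Lemma poisson_bounds r th t : 0 <= r -> r < 1 ->
  poisson (r%:C * cis th) t <= 2 / (1 - r) /\
  (t != th -> `|t - th| <= pi -> poisson (r%:C * cis th) t <= pc * (1 - r) / (t - th) ^+ 2).
Proof.
move=> r0 r1; have z1 := circle_lt1 th r0 r1.
split; first by apply: le_trans (poisson_le t z1) _; rewrite cmod_circle.
move=> tth tp; rewrite poissonE // cmod_circle //.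
set s := t - th in tp *.
have s0 : 0 < s ^+ 2 by rewrite exprn_even_gt0 //= subr_eq0.
have -> : cmod (cis t - r%:C * cis th) ^+ 2 = (1 - r) ^+ 2 + 2 * r * (1 - cos s).
  have -> : cis t - r%:C * cis th = cis th * (cis s - r%:C).
    by rewrite mulrBr -cisD; congr (cis _ - _); rewrite /s; ring.
  rewrite cmodM cmod_cis mul1r sqr_cmod /cis /= oppr0 addr0.
  by have := cos2Dsin2 s; move: (cos s) (sin s) => c d; lra.
have hc := cos_upper tp.
have p4 : pi < 4 :> R by have := @pihalf_lt2 R; lra.
have s16 : s ^+ 2 <= 16.
  rewrite -[s ^+ 2]real_normK ?num_real // (_ : 16 = 4 ^+ 2); last by rewrite -natrX.
  by rewrite lerXn2r ?nnegrE // ltW // (le_lt_trans tp).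
have den : s ^+ 2 / 128 <= (1 - r) ^+ 2 + 2 * r * (1 - cos s).
  have c0 : 0 <= 1 - cos s by apply: le_trans hc; rewrite divr_ge0 ?sqr_ge0.
  (* For [r] at least 1/2 the cosine term suffices; for smaller [r] the square [(1 - r) ^+ 2] is at
     least 1/4, while [s ^+ 2 / 128] is at most 1/8. *)
  have [rh|rh] := leP 2^-1 r.
    have : 1 * (1 - cos s) <= 2 * r * (1 - cos s) by rewrite ler_wpM2r //; lra.
    have := sqr_ge0 (1 - r); lra.
  have : 2^-1 * 2^-1 <= (1 - r) ^+ 2 by rewrite expr2; apply: ler_pM => //; lra.
  have : 0 <= 2 * r * (1 - cos s) by rewrite !mulr_ge0.
  lra.
have den0 : 0 < s ^+ 2 / 128 by rewrite divr_gt0.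
rewrite ler_pdivrMr; last exact: lt_le_trans den.
rewrite mulrAC ler_pdivlMr //.
apply: (@le_trans _ _ (2 * (1 - r) * s ^+ 2)).
  rewrite ler_wpM2r ?sqr_ge0 //; have := sqr_ge0 (1 - r); rewrite !expr2; nra.
have c0 : 0 <= pc * (1 - r) by rewrite mulr_ge0 ?pc_ge0 // subr_ge0 ltW.
apply: le_trans (ler_wpM2l c0 den).
by rewrite pcE le_eqVlt; apply/orP; left; apply/eqP; field.
Qed.

(* Half-length of the k-th arc of the dyadic decomposition around th, d = 1 - r. *)
Definition darc d k : R := Num.min (2 ^+ k * d) pi.
Definition avg (v : R -> R) th l : R := (2 * l)^-1 * rint (th - l) (th + l) v.

Lemma darc_gt0 d k : 0 < d -> 0 < darc d k.
Proof. by move=> d0; rewrite lt_min pi_gt0 mulr_gt0 // exprn_gt0. Qed.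

Lemma darc_le d k : darc d k <= 2 ^+ k * d.
Proof. by rewrite ge_min lexx. Qed.

Lemma darc_pi d k : darc d k <= pi.
Proof. by rewrite ge_min lexx orbT. Qed.

Lemma darcS d k : 0 < d -> darc d k <= darc d k.+1 <= 2 * darc d k.
Proof.
move=> d0; have X0 : 0 < 2 ^+ k * d by rewrite mulr_gt0 // exprn_gt0.
have p0 := @pi_gt0 R; rewrite /darc exprS -mulrA; move: (2 ^+ k * d) X0 => X X0.
by rewrite /Num.min; case: ifP; case: ifP; move=> *; apply/andP; split; lra.
Qed.

Lemma avg_int v th l : 0 < l -> rint (th - l) (th + l) v = 2 * l * avg v th l.
Proof. by move=> l0; rewrite /avg mulrA divff ?mul1r // mulf_neq0 // gt_eqF. Qed.

(** Between the arcs [K] and [K + 1] the kernel is at most [pc / (4 ^+ K * d)], while the larger arc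
    has length at most [4 * 2 ^+ K * d]. The product is [8 * pc / 2 ^+ K.+1], and the central arc
    obeys the same constant by the uniform bound [2 / d]. *)
Lemma poisson_dyadic (v : R -> R) r th K : (forall t, 0 <= v t) -> (forall a b, intble a b v) ->
  0 <= r -> r < 1 ->
  rint (th - darc (1 - r) K) (th + darc (1 - r) K) (fun t => poisson (r%:C * cis th) t * v t) <=
  (8 * pc) * \sum_(k < K.+1) avg v th (darc (1 - r) k) / 2 ^+ k.
Proof.
move=> v0 iv r0 r1; set d := 1 - r; have d0 : 0 < d by rewrite subr_gt0.
have z1 := circle_lt1 th r0 r1.
pose P t := poisson (r%:C * cis th) t.
have iP a b : intble a b (fun t => P t * v t) by apply: intble_poissonM.
have A0 k : 0 <= avg v th (darc d k).
  rewrite mulr_ge0 // ?invr_ge0; last by apply: rint_ge0.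
  by rewrite mulr_ge0 // ltW // darc_gt0.
elim: K => [|K IH].
  rewrite big_ord1 expr0 divr1.
  apply: (@le_trans _ _ (rint (th - darc d 0) (th + darc d 0) (fun t => 2 / d * v t))).
    apply: le_rint => //; first exact: intbleZ.
    by move=> t _; rewrite ler_wpM2r //; case: (poisson_bounds th t r0 r1).
  rewrite rintZ // avg_int ?darc_gt0 // mulrA ler_wpM2r //.
  have := darc_le d 0; rewrite expr0 mul1r => h.
  by rewrite mulrAC ler_pdivrMr // pcE; lra.
set l := darc d K in IH *; set l' := darc d K.+1.
have l0 : 0 < l by exact: darc_gt0.
have l'0 : 0 < l' by exact: darc_gt0.
have := darcS K d0; rewrite -/l -/l' => /andP[ll' l'l].
pose M := pc / (4 ^+ K * d).
have M0 : 0 <= M by rewrite divr_ge0 ?pc_ge0 // mulr_ge0 ?exprn_ge0 // ltW.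
have pc8 : 0 <= 8 * pc by rewrite mulr_ge0 ?pc_ge0.
rewrite big_ord_recr /= mulrDr -/l'.
have t0 : 0 <= (8 * pc) * (avg v th l' / 2 ^+ K.+1) by rewrite mulr_ge0 // divr_ge0 ?A0 // exprn_ge0.
(* If the two arcs coincide, both have reached half-length [pi]: the integral is unchanged and the
   right-hand side only gains a nonnegative term. *)
move: ll'; rewrite le_eqVlt => /predU1P[E|lt].
  by move: t0; rewrite -E => t0; apply: le_trans IH _; rewrite lerDl.
have side t : l <= `|t - th| -> `|t - th| <= l' -> P t <= M.
  move=> h1 h2; have lE : l = 2 ^+ K * d.
    rewrite /l /darc; apply/min_idPl; rewrite leNgt; apply/negP => h.
    have : l = pi by apply/min_idPr; exact: ltW.
    by move=> E; have := darc_pi d K.+1; rewrite -/l' -E leNgt lt.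
  have tth : t != th by apply/eqP => E; move: h1; rewrite E subrr normr0 leNgt l0.
  have [_ /(_ tth (le_trans h2 (darc_pi _ _))) hP] := poisson_bounds th t r0 r1.
  apply: le_trans hP _; rewrite -/d /M -[(t - th) ^+ 2]real_normK ?num_real //.
  have hl : (2 ^+ K * d) ^+ 2 <= `|t - th| ^+ 2.
    by rewrite lerXn2r ?nnegrE // -?lE // ltW.
  have E4 : (2 ^+ K * d) ^+ 2 = 4 ^+ K * d * d.
    have E22 : 2 ^+ 2 = 4 :> R by ring.
    by rewrite exprMn -exprM mulnC exprM E22 [d ^+ 2]expr2 mulrA.
  have c0 : 0 < 4 ^+ K * d by rewrite mulr_gt0 // exprn_gt0.
  have c1 : 0 < 4 ^+ K * d * d by rewrite mulr_gt0.
  apply: (@le_trans _ _ (pc * d / (4 ^+ K * d * d))).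
    rewrite E4 in hl; apply: ler_wpM2l; first by rewrite mulr_ge0 ?pc_ge0 // ltW.
    by rewrite lef_pV2 ?posrE //; apply: lt_le_trans hl.
  have K0 : 4 ^+ K != 0 :> R by rewrite expf_neq0.
  have d00 : d != 0 by rewrite gt_eqF.
  by rewrite le_eqVlt; apply/orP; left; apply/eqP; field; rewrite d00 K0.
have cut u : (forall a b, intble a b u) ->
    rint (th - l') (th + l') u = rint (th - l') (th - l) u + (rint (th - l) (th + l) u + rint (th + l) (th + l') u).
  move=> iu; rewrite (@rint_cat _ _ _ (th - l)) //; [|lra|lra].
  by rewrite (@rint_cat _ (th - l) _ (th + l)) //; lra.
have sideint a b : (forall t, a <= t <= b -> l <= `|t - th| <= l') ->
    rint a b (fun t => P t * v t) <= M * rint a b v.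
  move=> hab; rewrite -rintZ //; apply: le_rint => //; first exact: intbleZ.
  by move=> t /hab /andP[h1 h2]; rewrite ler_wpM2r // side.
have s1 : rint (th - l') (th - l) (fun t => P t * v t) <= M * rint (th - l') (th - l) v.
  apply: sideint => t /andP[h1 h2]; rewrite ltr0_norm; last by lra.
  by apply/andP; split; lra.
have s2 : rint (th + l) (th + l') (fun t => P t * v t) <= M * rint (th + l) (th + l') v.
  apply: sideint => t /andP[h1 h2]; rewrite gtr0_norm; last by lra.
  by apply/andP; split; lra.
have mid0 : 0 <= M * rint (th - l) (th + l) v by rewrite mulr_ge0 // rint_ge0.
have tot : M * (rint (th - l') (th - l) v + (rint (th - l) (th + l) v + rint (th + l) (th + l') v)) <=
    (8 * pc) * (avg v th l' / 2 ^+ K.+1).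
  rewrite -cut // avg_int //; move: (A0 K.+1); rewrite -/l' => A0'.
  have -> : M * (2 * l' * avg v th l') = M * (2 * l') * avg v th l' by ring.
  have -> : (8 * pc) * (avg v th l' / 2 ^+ K.+1) = ((8 * pc) / 2 ^+ K.+1) * avg v th l' by ring.
  rewrite ler_wpM2r //.
  apply: (@le_trans _ _ (M * (2 * (2 ^+ K.+1 * d)))).
    by rewrite ler_wpM2l // ler_wpM2l // darc_le.
  rewrite /M (_ : 4 ^+ K = 2 ^+ K * 2 ^+ K); last by rewrite -exprMn; congr (_ ^+ _); ring.
  have p2 : 2 ^+ K != 0 :> R by rewrite expf_neq0.
  rewrite exprS le_eqVlt; apply/orP; left; apply/eqP; field.
  by rewrite p2 gt_eqF.
rewrite cut //; move: IH s1 s2 mid0 tot; rewrite -/P.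
rewrite !mulrDr; set I1 := rint _ _ _; set I2 := rint _ _ _; set I3 := rint _ _ _.
lra.
Qed.

End poisson_formula.

(** * Boundary values *)

Section radial_limits.
Context {R : realType}.
Implicit Types (f g h : R[i] -> R[i]) (z w : R[i]) (r s t th e d lam eta : R).
Local Notation T := (2 * pi : R).
Local Notation mu := (@lebesgue_measure R).

Lemma poisson_periodic z t : poisson z (t + T) = poisson z t.
Proof. by rewrite /poisson /herglotz opprD cisD !cisN -[T]add0r cis_periodic cis0 conj1 mulr1. Qed.

(** Once the dyadic arcs fill a whole period, the geometric weights add up to at most 2, which
    doubles the constant of [poisson_dyadic]. *)
Lemma poisson_le_sup (v : R -> R) r th (A : R) : (forall t, 0 <= v t) -> (forall a b, intble a b v) ->
  measurable_fun [set: R] v -> (forall t, v (t + T) = v t) -> 0 <= r -> r < 1 ->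
  (forall l, 0 < l -> l <= pi -> avg v th l <= A) ->
  rint 0 T (fun t => poisson (r%:C * cis th) t * v t) <= 16 * pc * A.
Proof.
move=> v0 iv mv pv r0 r1 hA; have z1 := circle_lt1 th r0 r1.
have A0 : 0 <= A.
  apply: le_trans (hA pi (pi_gt0 R) (lexx _)).
  by rewrite mulr_ge0 ?rint_ge0 // invr_ge0 mulr_ge0 // pi_ge0.
have d0 : 0 < 1 - r by rewrite subr_gt0.
have [K hK] := half_pow_lt pi d0.
have lK : darc (1 - r) K = pi.
  by apply/min_idPr; rewrite mulrC -ler_pdivrMr ?exprn_gt0 // ltW.
have E : rint 0 T (fun t => poisson (r%:C * cis th) t * v t) =
    rint (th - pi) (th + pi) (fun t => poisson (r%:C * cis th) t * v t).
  have -> : th + pi = th - pi + T by ring.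
  rewrite rint_periodic //; first exact: twopi_gt0.
  - by apply: measurable_funM => //; exact: measurable_poisson.
  - by move=> t; rewrite poisson_periodic pv.
  - exact: intble_poissonM.
rewrite E -lK; apply: le_trans (poisson_dyadic th K v0 iv r0 r1) _.
have -> : 16 * pc * A = (8 * pc) * (A * 2) by ring.
rewrite ler_wpM2l ?mulr_ge0 ?pc_ge0 //.
apply: (@le_trans _ _ (A * \sum_(k < K.+1) 2^-1 ^+ k)).
  rewrite mulr_sumr; apply: ler_sum => k _; rewrite exprVn ler_wpM2r ?invr_ge0 ?exprn_ge0 //.
  by apply: hA; rewrite ?darc_gt0 ?darc_pi.
rewrite ler_wpM2l // (le_trans (sum_geom_le _ _)) //.
  by apply/andP; split; lra.
by have -> : (1 - 2^-1 : R)^-1 = 2 by field.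
Qed.

(* A point is charged by the maximal function of the restriction of |h_rho| to a
   neighbourhood of [0, 2 pi]. *)
Lemma maximal_dilate h rho lam eta : holomorphic_disk h -> 0 < rho -> rho < 1 -> 0 < lam -> 0 < eta ->
  m2 h rho <= eta ^+ 2 ->
  exists G : set R, [/\ measurable G, (mu G <= (96 * pc * eta / lam)%:E)%E &
    forall th, 0 <= th <= T -> forall r, 0 <= r -> r < 1 ->
      lam < cmod (h ((rho * r)%:C * cis th)) -> G th].
Proof.
move=> hh rho0 rho1 lam0 eta0 hm; have ch := hol_cont hh.
have r00 := ltW rho0; have p0 := pi_gt0 R; have T0 := @twopi_gt0 R.
pose u t := cmod (h (rho%:C * cis t)).
have u0 t : 0 <= u t by exact: cmod_ge0.
have iu a b : intble a b u by apply: cintble_cmod; exact: cintble_circle.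
have mu_ : measurable_fun [set: R] u by apply: cmeas_cmod => //; exact: cmeas_circle.
have pu t : u (t + T) = u t by rewrite /u cis_periodic.
pose I := `[- pi, 3 * pi]%classic : set R.
pose U := u \_ I.
have lU : locally_integrable [set: R] U by exact: (integrable_locally_restrict (mitv _ _) (iu _ _)).
have pcp : 0 < pc :> R by rewrite pcE ltr0n.
(* Chosen so that the bound [16 * pc * c] from [poisson_le_sup] equals [lam * T]. The constant 3 of
   the maximal inequality and the two periods contained in [I] then give [96 = 3 * 2 * 16]. *)
pose c := lam * T / (16 * pc).
have c0 : 0 < c by rewrite /c divr_gt0 ?mulr_gt0.
exists [set x | (HL_maximal U x > c%:E)%E]; split.
- rewrite -[X in measurable X]setTI; apply: emeasurable_fun_o_infty => //.
  exact: measurable_HL_maximal.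
- apply: le_trans (maximal_inequality lU c0) _.
  have iE : (\int[mu]_(y in [set: R]) `|(U y)%:E| = (rint (- pi) (3 * pi) u)%:E)%E.
    rewrite -rint_EFin // [RHS]integral_mkcond; apply: eq_integral => y _.
    rewrite /U /patch; case: ifP => _ /=; first by rewrite ger0_norm ?u0.
    by rewrite normr0.
  rewrite iE -EFinM lee_fin.
  have -> : rint (- pi) (3 * pi) u = 2 * rint 0 T u.
    rewrite (@rint_cat _ _ _ pi) //; [|lra|lra].
    have -> : 3 * pi = pi + T by ring.
    have E1 : - pi + T = pi by ring.
    have := rint_periodic T0 mu_ pu (iu _ _) (- pi); rewrite E1 => ->.
    by rewrite rint_periodic //; ring.
  (* Cauchy-Schwarz, done pointwise by the inequality between arithmetic and geometric means. *)
  have hI : rint 0 T u <= T * eta.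
    apply: (@le_trans _ _ (rint 0 T (fun t => (2 * eta)^-1 * (u t ^+ 2) + eta / 2))).
      apply: le_rint => //.
        by apply: intbleD; [apply: intbleZ; exact: intble_circle2|exact: intble_cst].
      move=> t _; rewrite -subr_ge0.
      have e0 : eta != 0 by rewrite gt_eqF.
      have -> : (2 * eta)^-1 * u t ^+ 2 + eta / 2 - u t = (2 * eta)^-1 * (u t - eta) ^+ 2 by field.
      by rewrite mulr_ge0 ?sqr_ge0 // invr_ge0 mulr_ge0 // ltW.
    rewrite rintD; [|by apply: intbleZ; exact: intble_circle2|exact: intble_cst].
    rewrite (rintZ _ (intble_circle2 0 T ch r00 rho1)) rint_cst ?(ltW T0) // subr0.
    have hm' : rint 0 T (fun t => u t ^+ 2) <= T * eta ^+ 2.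
      by move: hm; rewrite /m2 ler_pdivrMl.
    have i0 : 0 <= (2 * eta)^-1 by rewrite invr_ge0 mulr_ge0 // ltW.
    apply: le_trans (lerD (ler_wpM2l i0 hm') (lexx _)) _.
    rewrite le_eqVlt; apply/orP; left; apply/eqP; move: (@pi R) => p; field.
    by rewrite gt_eqF.
  have i0 : 0 <= 3 / c by rewrite divr_ge0 // ltW.
  apply: (@le_trans _ _ (3 / c * (2 * (T * eta)))).
    by rewrite ler_wpM2l // ler_wpM2l.
  rewrite /c le_eqVlt; apply/orP; left; apply/eqP; move: (@pi R) p0 => p p0; field.
  by rewrite (gt_eqF pcp) (gt_eqF lam0) (gt_eqF p0).
move=> th /andP[th0 thT] r r0 r1 hl; rewrite /= ltNge; apply/negP => hHL.
move: hl; apply/negP; rewrite -leNgt.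
have z1 := circle_lt1 th r0 r1.
have hA l : 0 < l -> l <= pi -> avg u th l <= c.
  move=> l0 lp; rewrite -lee_fin; apply: le_trans hHL.
  apply: ereal_sup_ubound; exists l; first by rewrite /= in_itv /= l0.
  rewrite /iavg lebesgue_measure_ball ?(ltW l0) // ball_itv.
  have mU : measurable_fun [set: R] (fun y => `|(U y)%:E|%E).
    by apply: measurableT_comp => //; apply/measurable_EFinP; case: lU.
  rewrite -(@integral_itv_bndoo R (th - l) (th + l) (fun y => `|(U y)%:E|%E) true false); last first.
    exact: measurable_funTS.
  have -> : (\int[mu]_(z in `[(th - l)%R, (th + l)%R]) `|(U z)%:E| = (rint (th - l) (th + l) u)%:E)%E.
    rewrite -rint_EFin //; apply: eq_integral => y; rewrite inE /= in_itv /= => /andP[y1 y2].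
    rewrite /U /patch mem_set /=; first by rewrite ger0_norm ?u0.
    by rewrite /I /= in_itv /=; apply/andP; split; lra.
  by rewrite inver ifF ?mulrn_eq0 ?gt_eqF //= -EFinM /avg mulr_natl.
have := poisson_le_sup u0 iu mu_ pu r0 r1 hA.
have -> : 16 * pc * c = lam * T by rewrite /c; field; rewrite gt_eqF.
have := poisson_hol hh r00 rho1 z1 => hP.
have iP : cintble 0 T (fun t => (poisson (r%:C * cis th) t)%:C * h (rho%:C * cis t)).
  by apply: cintble_poisson => //; exact: cintble_circle.
have := cint_le iP; rewrite hP cmodM cmodR (gtr0_norm T0) => h1 h2.
have E : rint 0 T (fun t => cmod ((poisson (r%:C * cis th) t)%:C * h (rho%:C * cis t))) =
    rint 0 T (fun t => poisson (r%:C * cis th) t * u t).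
  by apply: eq_rint => t _; rewrite cmodM cmodR ger0_norm ?poisson_ge0.
rewrite E in h1; have := le_trans h1 h2; rewrite ler_pM2r //.
by rewrite rmorphM /= mulrA.
Qed.

(** A point where [h] is large at radius [r] is charged by [G n] as soon as [rho n] exceeds [r],
    hence lies in the lower limit of the sets [G n]. That set is an increasing union of the [H m],
    each contained in [G m], so it inherits the bound on the measure. *)
Lemma maximal_disk h lam eta : holomorphic_disk h -> 0 < lam -> 0 < eta ->
  (forall r, 0 <= r -> r < 1 -> m2 h r <= eta ^+ 2) ->
  exists G : set R, [/\ measurable G, (mu G <= (96 * pc * eta / lam)%:E)%E &
    forall th, 0 <= th <= T -> forall r, 0 <= r -> r < 1 -> lam < cmod (h (r%:C * cis th)) -> G th].
Proof.
move=> hh lam0 eta0 hm; pose rho (n : nat) : R := 1 - n.+2%:R^-1.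
have i0 n : 0 < (n.+2%:R : R)^-1 by rewrite invr_gt0.
have i1 n : (n.+2%:R : R)^-1 < 1 by rewrite invf_lt1 // ltr1n.
have rho01 n : 0 < rho n < 1 by rewrite /rho subr_gt0 i1 ltrBlDr ltrDl i0.
have /choice [G hG] n : exists G : set R, [/\ measurable G, (mu G <= (96 * pc * eta / lam)%:E)%E &
    forall th, 0 <= th <= T -> forall r, 0 <= r -> r < 1 ->
      lam < cmod (h ((rho n * r)%:C * cis th)) -> G th].
  have /andP[h1 h2] := rho01 n.
  by apply: maximal_dilate => //; apply: hm => //; exact: ltW.
pose H m := \bigcap_(n in [set n | (m <= n)%N]) G n.
have mH m : measurable (H m) by apply: bigcap_measurable => [|n _]; [exists m => /=|case: (hG n)].
have mUH : measurable (\bigcup_m H m) by exact: bigcup_measurable.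
exists (\bigcup_m H m); split => //.
- have ndH : nondecreasing_seq H.
    by move=> m n mn; apply/subsetPset => x hx k /= nk; apply: hx => /=; exact: leq_trans nk.
  have hc := @nondecreasing_cvg_mu _ _ _ mu H mH mUH ndH.
  rewrite -(cvg_lim _ hc) //; apply: lime_le; first by apply/cvg_ex; eexists; exact: hc.
  apply: nearW => m /=; have [mG bG _] := hG m; apply: le_trans bG.
  by apply: le_measure; [rewrite inE; exact: mH|rewrite inE|move=> x hx; exact: (hx m (leqnn m))].
- move=> th hth r r0 r1 hl.
  have [m hm'] : exists m, forall n, (m <= n)%N -> r < rho n.
    have d0 : 0 < 1 - r by rewrite subr_gt0.
    exists (Num.bound (1 - r)^-1) => n mn.
    have := archi_boundP (_ : 0 <= (1 - r)^-1); rewrite invr_ge0 (ltW d0) => /(_ isT) hb.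
    have : (1 - r)^-1 < n.+2%:R by apply: lt_le_trans hb _; rewrite ler_nat (leq_trans mn) // leqW.
    by move=> h1; rewrite /rho ltrBrDr addrC -ltrBrDr invf_plt ?posrE ?ltr0n.
  exists m => // n /= mn; have [_ _ hn] := hG n; have /andP[h1 h2] := rho01 n.
  apply: (hn th hth (r / rho n)).
  + by rewrite divr_ge0 // ltW.
  + by rewrite ltr_pdivrMr // mul1r hm'.
  + by rewrite mulrCA divff ?mulr1 // gt_eqF.
Qed.

(* [bval] is a [lim], which only returns the radial limit where this holds. *)
Definition rlim f z l := forall e, 0 < e -> exists2 s, s < 1 & forall r, s < r -> r < 1 -> cmod (f (r%:C * z) - l) <= e.

Lemma near_left1 (Q : R -> Prop) : (\forall r \near (1 : R)^'-, Q r) <-> exists2 s, s < 1 & forall r, s < r -> r < 1 -> Q r.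
Proof.
split; rewrite near_withinE.
  move=> /nbhs_ballP[d /= d0 hd]; exists (1 - d) => [|r h1 h2]; first by rewrite ltrBlDr ltrDl.
  by apply: hd => //; rewrite /ball /= gtr0_norm ?subr_gt0 // ltrBlDr addrC -ltrBlDr.
move=> [s s1 hs]; apply/nbhs_ballP; exists (1 - s) => [|r]; first by rewrite /= subr_gt0.
by rewrite /ball /= => h1 h2; apply: hs => //; move: h1; rewrite ltr_norml => /andP[_]; lra.
Qed.

Lemma rlim_cvg f z l : rlim f z l <-> (f (r%:C * z) : R[i]^o) @[r --> (1 : R)^'-] --> (l : R[i]^o).
Proof.
split=> [fl|/cvgrPdist_le fl e e0].
  apply/cvgrPdist_le => e /posC_real[x x0 ->]; apply/near_left1.
  have [s s1 hs] := fl x x0; exists s => // r h1 h2.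
  by rewrite -[`|_|]/((cmod _)%:C) lecR cmodB hs.
have := fl e%:C; rewrite ltcR => /(_ e0)/near_left1 [s s1 hs]; exists s => // r h1 h2.
by have := hs r h1 h2; rewrite -[`|_|]/((cmod _)%:C) lecR cmodB.
Qed.

Lemma rlim_bval f z l : rlim f z l -> bval f z = l.
Proof.
by move=> /rlim_cvg fl; exact: (@cvg_lim _ (@norm_hausdorff _ R[i]^o) _ _ _ _ _ fl).
Qed.

(** Divergent radii all receive the same value, so [bval f] is constant off the set of convergence;
    its measurability and its boundedness rest on this. *)
Lemma bval_default : exists p : R[i], forall f z, ~ (exists l, rlim f z l) -> bval f z = p.
Proof.
exists (point : R[i]^o) => f z nl.
apply: (@getPN _ (fun l : R[i]^o => (f (r%:C * z) : R[i]^o) @[r --> (1 : R)^'-] --> l)) => l fl.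
by apply: nl; exists l; exact/rlim_cvg.
Qed.

Lemma rlim_cauchy f z : (forall e, 0 < e -> exists2 s, s < 1 & forall r r', s < r -> r < 1 -> s < r' -> r' < 1 ->
    cmod (f (r%:C * z) - f (r'%:C * z)) <= e) -> exists l, rlim f z l.
Proof.
move=> fc; have key (p : R[i] -> R) : (forall u v, `|p u - p v| <= cmod (u - v)) ->
    exists x, (p (f (r%:C * z))) @[r --> (1 : R)^'-] --> (x : R).
  move=> hp; apply/cvg_ex/cauchy_cvgP/cauchy_exP => e e0.
  have [s s1 hs] := fc (e / 2) (divr_gt0 e0 (ltr0Sn _ 1)).
  pose r0 := (Num.max s 0 + 1) / 2.
  have m1 : Num.max s 0 < 1 by rewrite gt_max s1 ltr01.
  have sm : s <= Num.max s 0 by rewrite le_max lexx.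
  exists (p (f (r0%:C * z))); apply/near_left1; exists s => // r h1 h2.
  rewrite /ball /=; apply: le_lt_trans (hp _ _) _.
  apply: le_lt_trans (hs r0 r _ _ h1 h2) _; rewrite /r0; lra.
have [x hx] := key (@complex.Re R) (fun u v => ltac:(rewrite -ReB; exact: Re_le_cmod)).
have [y hy] := key (@complex.Im R) (fun u v => ltac:(rewrite -ImB; exact: Im_le_cmod)).
exists (x +i* y) => e e0; have e2 : 0 < e / 2 by rewrite divr_gt0.
move/cvgrPdist_le/(_ _ e2)/near_left1 : hx => [s1 s11 h1].
move/cvgrPdist_le/(_ _ e2)/near_left1 : hy => [s2 s21 h2].
exists (Num.max s1 s2) => [|r]; rewrite ?gt_max ?s11 //= => /andP[r1 r2] r3.
apply: le_trans (cmod_le_ReIm _) _; rewrite ReB ImB /= [e]splitr.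
by apply: lerD; rewrite distrC; [exact: h1|exact: h2].
Qed.

(** Subtracting a Taylor polynomial, which is continuous up to the circle, leaves a remainder of
    small square means. Outside a set of small measure, [maximal_disk] makes it small along whole
    radii, which gives Cauchy's criterion there. *)
Theorem radial_limit_ae f : H2 f -> exists Z : set R, [/\ measurable Z, mu Z = 0%E &
  forall th, 0 <= th <= T -> ~ Z th -> exists l, rlim f (cis th) l].
Proof.
move=> Hf; have [hf _] := Hf; have [K [K0 _ mK]] := H2_bound Hf.
pose a := tcoef f; have fa : psr a f by exact: hol_psr.
have sumK N : \sum_(n < N) cmod (a n) ^+ 2 <= K ^+ 2.
  apply: (sum_le_of_radial (x := fun n => cmod (a n) ^+ 2)) => [n|r r0 r1]; first exact: sqr_ge0.
  by apply: le_trans (mK r r0 r1); apply: parseval_le => //; rewrite r0.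
have pcp : 0 < pc :> R by rewrite pcE ltr0n.
have dense lam B : 0 < lam -> 0 < B -> exists MG : nat * set R, [/\ measurable MG.2, (mu MG.2 <= B%:E)%E &
    forall th, 0 <= th <= T -> ~ MG.2 th -> forall r, 0 <= r -> r < 1 ->
      cmod (f (r%:C * cis th) - psum a MG.1 (r%:C * cis th)) <= lam].
  move=> lam0 B0; pose eta := B * lam / (96 * pc).
  have eta0 : 0 < eta by rewrite divr_gt0 ?mulr_gt0.
  have [M hM] := l2_tail (fun n => sqr_ge0 (cmod (a n))) sumK (exprn_gt0 2 eta0).
  have ph := psr_sub_psum M fa; have hh := psr_hol ph.
  have mh r : 0 <= r -> r < 1 -> m2 (fun z => f z - psum a M z) r <= eta ^+ 2.
    move=> r0 r1; apply: (parseval_ge ph); first by rewrite r0.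
    move=> N; apply: le_trans (hM N); apply: ler_sum => n _; case: ifP => _.
      by rewrite cmod0 expr0n mul0r.
    by rewrite ler_piMr ?sqr_ge0 // -exprM exprn_ile1 // ltW.
  have [G [mG bG hG]] := maximal_disk hh lam0 eta0 mh.
  exists (M, G); split => //=.
    apply: le_trans bG _; rewrite lee_fin /eta le_eqVlt; apply/orP; left; apply/eqP; field.
    by rewrite !gt_eqF.
  move=> th hth nG r r0 r1; rewrite leNgt; apply/negP => h; apply: nG.
  exact: hG hth r r0 r1 h.
have inv0 (n : nat) : 0 < (n.+1%:R : R)^-1 by rewrite invr_gt0.
have /choice [F hF] (p : nat * nat) := dense _ _ (inv0 p.1) (inv0 p.2).
(* [F (m, j)] has tolerance [1 / (m + 1)] and an exceptional set of measure at most [1 / (j + 1)]. A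
   direction is bad if, for some tolerance, it is exceptional for every [j]. *)
pose Z := \bigcup_m \bigcap_j (F (m, j)).2.
have mI m : measurable (\bigcap_j (F (m, j)).2) by apply: bigcapT_measurable => j; case: (hF (m, j)).
exists Z; split.
- exact: bigcup_measurable.
- have mZ : measurable Z by exact: bigcup_measurable.
  refine (@measure_negligible _ (measurableTypeR R) R mu Z mZ _); apply: negligible_bigcup => m.
  exists (\bigcap_j (F (m, j)).2); split => //; first exact: mI.
  apply/eqP; rewrite -measure_le0; apply/lee_addgt0Pr => e e0; rewrite add0e.
  have [j hj] : exists j : nat, j.+1%:R^-1 <= e.
    exists (Num.bound e^-1); rewrite invf_ple ?posrE //.
    have := archi_boundP (_ : 0 <= e^-1); rewrite invr_ge0 (ltW e0) => /(_ isT) hb.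
    by apply: le_trans (ltW hb) _; rewrite ler_nat.
  have [mG bG _] := hF (m, j); apply: (@le_trans _ _ (mu (F (m, j)).2)).
    by apply: le_measure; [rewrite inE; exact: mI|rewrite inE|move=> x hx; exact: (hx j I)].
  by apply: le_trans bG _; rewrite lee_fin.
move=> th hth nZ; apply: rlim_cauchy => e e0.
have [m hm] : exists m : nat, m.+1%:R^-1 <= e / 4.
  have e4 : 0 < e / 4 by rewrite divr_gt0.
  exists (Num.bound (e / 4)^-1); rewrite invf_ple ?posrE //.
  have := archi_boundP (_ : 0 <= (e / 4)^-1); rewrite invr_ge0 (ltW e4) => /(_ isT) hb.
  by apply: le_trans (ltW hb) _; rewrite ler_nat.
have [j nj] : exists j, ~ (F (m, j)).2 th.
  apply: contrapT => /forallNP h; apply: nZ; exists m => // j _.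
  exact: (contrapT (h j)).
have [_ _ /(_ th hth nj) hr] := hF (m, j); move: (F (m, j)).1 hr => M hr.
have [d pd] := psum_cdiff a M (cis th).
have e8 : 0 < e / 4 by rewrite divr_gt0.
have [s s0 hs] := cdiff_cont pd e8.
have pr r : 1 - s < r -> r < 1 -> cmod (psum a M (r%:C * cis th) - psum a M (cis th)) <= e / 4.
  move=> r1 r2; have -> : r%:C * cis th = cis th + (r - 1)%:C * cis th by rewrite rmorphB /=; ring.
  apply: hs; rewrite cmodM cmod_cis mulr1 cmodR ltr0_norm; last by rewrite subr_lt0.
  lra.
exists (Num.max 0 (1 - s)) => [|r r']; first by rewrite gt_max ltr01 ltrBlDr ltrDl.
rewrite !gt_max => /andP[r0 r1] r2 /andP[r'0 r'1] r'2.
have h1 := hr r (ltW r0) r2; have h2 := hr r' (ltW r'0) r'2.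
have h3 := pr r r1 r2; have h4 := pr r' r'1 r'2.
have {}h1 := le_trans h1 hm; have {}h2 := le_trans h2 hm.
rewrite cmodB in h4; rewrite cmodB in h2.
apply: le_trans (cmodDB _ _ (psum a M (r%:C * cis th))) _.
have k1 := cmodDB (psum a M (r%:C * cis th)) (f (r'%:C * cis th)) (psum a M (cis th)).
have k2 := cmodDB (psum a M (cis th)) (f (r'%:C * cis th)) (psum a M (r'%:C * cis th)).
have k3 := le_trans k1 (lerD h3 (le_trans k2 (lerD h4 h2))).
by apply: le_trans (lerD h1 k3) _; rewrite le_eqVlt; apply/orP; left; apply/eqP; field.
Qed.

End radial_limits.

(** * Measurability of boundary values and Fatou's lemma *)

Section boundary_values.
Context {R : realType}.
Implicit Types (f g h : R[i] -> R[i]) (z w : R[i]) (r s t th e d : R).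
Local Notation T := (2 * pi : R).
Local Notation mu := (@lebesgue_measure R).

(** The offset [N] lets the sequence of radii start beyond a prescribed radius below 1. *)
Definition rseq (N n : nat) : R := 1 - (n + N).+2%:R^-1.

Lemma rseq01 N n : 0 <= rseq N n < 1.
Proof.
rewrite /rseq subr_ge0 ltrBlDr ltrDl invr_gt0 ltr0n andbT invf_le1 ?ltr0n //.
by rewrite ler1n.
Qed.

Lemma rseq_gt r : r < 1 -> exists N, forall n M, (N <= n + M)%N -> r < rseq M n.
Proof.
move=> r1; have d0 : 0 < 1 - r by rewrite subr_gt0.
exists (Num.bound (1 - r)^-1) => n M mn.
have := archi_boundP (_ : 0 <= (1 - r)^-1); rewrite invr_ge0 (ltW d0) => /(_ isT) hb.
have : (1 - r)^-1 < (n + M).+2%:R.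
  by apply: lt_le_trans hb _; rewrite ler_nat (leq_trans mn) // leqW.
by move=> h1; rewrite /rseq ltrBrDr addrC -ltrBrDr invf_plt ?posrE ?ltr0n.
Qed.

Lemma rlim_rseq f z l M : rlim f z l -> forall e, 0 < e -> exists N, forall n, (N <= n)%N ->
  cmod (f ((rseq M n)%:C * z) - l) <= e.
Proof.
move=> fl e e0; have [s s1 hs] := fl e e0; have [N hN] := rseq_gt s1.
exists N => n Nn; apply: hs; last by case/andP: (rseq01 M n).
by apply: hN; exact: leq_trans (leq_addr _ _).
Qed.

Lemma continuous_of_ccont (u : R -> R[i]) : (forall a b, ccont a b u) -> continuous (fun t => cmod (u t)).
Proof.
move=> cu x; apply/cvgrPdist_le => e e0; have xx : x - 1 <= x <= x + 1 by apply/andP; split; lra.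
have [d d0 ud] := cu _ _ x xx e e0.
apply/nbhs_ballP; exists (Num.min 1 d); first by rewrite /= lt_min ltr01 d0.
move=> y; rewrite /ball /= lt_min => /andP[h1 h2].
have h : cmod (u y - u x) <= e.
  apply: ud; last by rewrite distrC.
  by move: h1; rewrite ltr_norml => /andP[h3 h4]; apply/andP; split; lra.
have k1 := ler_cmodB (u x) (u y); have k2 := ler_cmodB (u y) (u x).
rewrite cmodB in k1; rewrite ler_norml; apply/andP; split.
  by rewrite lerNl opprB; exact: le_trans k2 h.
exact: le_trans k1 h.
Qed.

Lemma ccontB (a b : R) (u v : R -> R[i]) : ccont a b u -> ccont a b v -> ccont a b (fun t => u t - v t).
Proof.
move=> cu cv x xab e e0; have e2 : 0 < e / 2 by rewrite divr_gt0.
have [d d0 ud] := cu x xab _ e2; have [s s0 vs] := cv x xab _ e2.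
exists (Num.min d s) => [|y yab]; rewrite lt_min ?d0 // => /andP[yd ys].
have -> : u y - v y - (u x - v x) = (u y - u x) - (v y - v x) by ring.
by apply: le_trans (cmodB_le _ _) _; rewrite [e]splitr lerD ?ud ?vs.
Qed.

Lemma cmeasB (D : set R) (u v : R -> R[i]) : cmeas D u -> cmeas D v -> cmeas D (fun t => u t - v t).
Proof.
move=> cu cv; apply: (eq_cmeas _ (cmeasD cu (cmeasM (cmeas_cst D (-1)) cv))) => t.
by rewrite mulN1r.
Qed.

(** Cauchy's criterion needs only countably many tolerances and thresholds. The remaining
    quantification over [r] and [r'] is uncountable, but it intersects closed conditions on [t], so
    each [C m n] is closed. *)
Lemma measurable_radial_set f : cont_disk f -> measurable [set t : R | exists l, rlim f (cis t) l].
Proof.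
move=> cf.
pose C (m n : nat) := [set t : R | forall r r', rseq 0 n < r -> r < 1 -> rseq 0 n < r' -> r' < 1 ->
   cmod (f (r%:C * cis t) - f (r'%:C * cis t)) <= m.+1%:R^-1].
have -> : [set t : R | exists l, rlim f (cis t) l] = \bigcap_m \bigcup_n C m n.
  apply/seteqP; split=> t /=.
    move=> [l fl] m _; have e0 : 0 < (m.+1%:R : R)^-1 / 2 by rewrite divr_gt0 // invr_gt0.
    have [s s1 hs] := fl _ e0; have [N hN] := rseq_gt s1.
    have sN : s < rseq 0 N by apply: hN; rewrite addn0.
    exists N => // r r' h1 h2 h3 h4; apply: le_trans (cmodDB _ _ l) _.
    rewrite [m.+1%:R^-1]splitr; apply: lerD; first by apply: hs => //; exact: lt_trans h1.
    by rewrite cmodB; apply: hs => //; exact: lt_trans h3.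
  move=> hC; apply: rlim_cauchy => e e0.
  have [m hm] : exists m : nat, m.+1%:R^-1 <= e.
    exists (Num.bound e^-1); rewrite invf_ple ?posrE //.
    have := archi_boundP (_ : 0 <= e^-1); rewrite invr_ge0 (ltW e0) => /(_ isT) hb.
    by apply: le_trans (ltW hb) _; rewrite ler_nat.
  have [n _ hn] := hC m I; exists (rseq 0 n); first by case/andP: (rseq01 0 n).
  by move=> r r' h1 h2 h3 h4; apply: le_trans hm; exact: hn.
apply: bigcapT_measurable => m; apply: bigcup_measurable => n _.
apply: closed_measurable.
have -> : C m n = \bigcap_(p in [set p : R * R | rseq 0 n < p.1 < 1 /\ rseq 0 n < p.2 < 1])
    ((fun t => cmod (f (p.1%:C * cis t) - f (p.2%:C * cis t))) @^-1` [set y | y <= m.+1%:R^-1]).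
  apply/seteqP; split=> t.
    by move=> hC [r r'] /= [/andP[h1 h2] /andP[h3 h4]]; exact: hC.
  by move=> hC r r' h1 h2 h3 h4; apply: (hC (r, r')) => /=; rewrite h1 h2 h3 h4.
apply: closed_bigI => -[r r'] /= [/andP[h1 h2] /andP[h3 h4]].
have /andP[q0 _] := rseq01 0 n.
apply: preimage_closed; last exact: closed_le.
move=> t _; apply: continuous_of_ccont => a b; apply: ccontB; apply: ccont_circle => //.
  exact: le_trans (ltW h1).
exact: le_trans (ltW h3).
Qed.

Lemma cmeas_bval f : cont_disk f -> cmeas [set: R] (fun t => bval f (cis t)).
Proof.
move=> cf; have mE := measurable_radial_set cf; set E := [set t | _] in mE.
have [p hp] := @bval_default R.
have key (P : R[i] -> R) : (forall u v, `|P u - P v| <= cmod (u - v)) ->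
    (forall r, 0 <= r -> r < 1 -> measurable_fun [set: R] (fun t => P (f (r%:C * cis t)))) ->
    measurable_fun [set: R] (fun t => P (bval f (cis t))).
  move=> hP mP; rewrite -(setUv E); apply/measurable_funU => //; first exact: measurableC.
  split.
    apply: (@measurable_fun_cvg _ _ _ _ (fun n t => P (f ((rseq 0 n)%:C * cis t)))).
      by move=> n; have /andP[h1 h2] := rseq01 0 n; apply: measurable_funTS; exact: mP.
    move=> t [l fl]; rewrite (rlim_bval fl); apply/cvgrPdist_le => e e0.
    have [N hN] := rlim_rseq 0 fl e0; exists N => // n /= Nn.
    by rewrite distrC; apply: le_trans (hP _ _) (hN n Nn).
  apply: (eq_measurable_fun (fun=> P p)); last exact: measurable_cst.
  by move=> t; rewrite inE => nE; rewrite hp.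
split; [apply: key => [u v|r r0 r1]|apply: key => [u v|r r0 r1]].
- by rewrite -ReB; exact: Re_le_cmod.
- by case: (cmeas_circle cf r0 r1).
- by rewrite -ImB; exact: Im_le_cmod.
- by case: (cmeas_circle cf r0 r1).
Qed.

Lemma bval_periodic f t : bval f (cis (t + T)) = bval f (cis t).
Proof. by rewrite cis_periodic. Qed.

Lemma bval_bounded f M : (forall z, disk z -> cmod (f z) <= M) ->
  exists M', forall t, cmod (bval f (cis t)) <= M'.
Proof.
(* The bound is asked at every [t], so the default value [p] of divergent radii has to be allowed
   for. *)
move=> hM; have [p hp] := @bval_default R; exists (Num.max M (cmod p)) => t.
rewrite le_max; have [[l fl]|nl] := pselect (exists l, rlim f (cis t) l); last first.
  by rewrite hp // lexx orbT.
rewrite (rlim_bval fl); apply/orP; left; apply: le_lim => e e0.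
have [s s1 hs] := fl e e0; pose r := (Num.max s 0 + 1) / 2.
have m1 : Num.max s 0 < 1 by rewrite gt_max s1 ltr01.
have m2 : s <= Num.max s 0 by rewrite le_max lexx.
have m3 : 0 <= Num.max s 0 by rewrite le_max lexx orbT.
have r1 : r < 1 by rewrite /r; lra.
have r0 : 0 <= r by rewrite /r; lra.
have sr : s < r by rewrite /r; lra.
have := hs r sr r1; have := hM (r%:C * cis t); rewrite diskE cmod_circle // => /(_ r1) h1 h2.
have -> : l = f (r%:C * cis t) - (f (r%:C * cis t) - l) by ring.
by apply: le_trans (cmodB_le _ _) _; exact: lerD.
Qed.

Lemma fatou_bval f (u : R -> R[i]) (K : R) N : H2 f -> cmeas [set: R] u ->
  (forall n, intble 0 T (fun t => cmod (f ((rseq N n)%:C * cis t) - u t) ^+ 2)) ->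
  (forall n, rint 0 T (fun t => cmod (f ((rseq N n)%:C * cis t) - u t) ^+ 2) <= K) ->
  intble 0 T (fun t => cmod (bval f (cis t) - u t) ^+ 2) /\
  rint 0 T (fun t => cmod (bval f (cis t) - u t) ^+ 2) <= K.
Proof.
move=> Hf mu_ iu hK; have [Z [mZ Z0 hZ]] := radial_limit_ae Hf.
have cf : cont_disk f by apply: hol_cont; case: Hf.
pose F t := cmod (bval f (cis t) - u t) ^+ 2.
pose G n t := cmod (f ((rseq N n)%:C * cis t) - u t) ^+ 2.
have mcB (v w : R -> R[i]) : cmeas [set: R] v -> cmeas [set: R] w ->
    measurable_fun [set: R] (fun t => cmod (v t - w t) ^+ 2).
  move=> mv mw; apply: measurable_funX; apply: cmeas_cmod => //.
  exact: cmeasB.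
have mF : measurable_fun [set: R] F by apply: mcB => //; exact: cmeas_bval.
have mG n : measurable_fun [set: R] (G n).
  by have /andP[h1 h2] := rseq01 N n; apply: mcB => //; exact: cmeas_circle.
(* On the null set [Z] the sequence is replaced by its intended limit, so that it converges at every
   point of the interval, as the pointwise use of Fatou's lemma requires. *)
pose H n t := if t \in Z then F t else G n t.
have mH n : measurable_fun [set: R] (H n).
  rewrite -(setUv Z); apply/measurable_funU => //; first exact: measurableC.
  split.
    apply: (eq_measurable_fun F); last exact: measurable_funTS.
    by move=> t tZ; rewrite /H tZ.
  apply: (eq_measurable_fun (G n)); last exact: measurable_funTS.
  by move=> t; rewrite inE => tZ; rewrite /H memNset.
have H0 n t : 0 <= H n t by rewrite /H; case: ifP => _; exact: sqr_ge0.
have HF t : 0 <= t <= T -> H ^~ t @ \oo --> F t.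
  move=> ht; have [tZ|tZ] := boolP (t \in Z).
    by rewrite /H tZ; exact: cvg_cst.
  have nZ : ~ Z t by move=> h; move: tZ; rewrite mem_set.
  rewrite /H (negPf tZ) /F /G; have [l fl] := hZ t ht nZ.
  rewrite (rlim_bval fl).
  apply: (@cvg_comp _ _ _ (fun n => cmod (f ((rseq N n)%:C * cis t) - u t)) (fun y => y ^+ 2) _ (nbhs (cmod (l - u t)))).
    apply/cvgrPdist_le => e e0; have [M hM] := rlim_rseq N fl e0.
    exists M => // n /= Mn; have hn := hM n Mn; set v := f _ in hn *.
    have k1 := ler_cmodB (l - u t) (v - u t); have k2 := ler_cmodB (v - u t) (l - u t).
    have E1 : l - u t - (v - u t) = l - v by ring.
    have E2 : v - u t - (l - u t) = v - l by ring.
    rewrite E1 (cmodB l v) in k1; rewrite E2 in k2.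
    by rewrite ler_norml; apply/andP; split; [rewrite lerNl opprB; exact: le_trans k2 hn|exact: le_trans k1 hn].
  exact: exprn_continuous.
have mHD n : measurable_fun `[0, T]%classic (fun t => (H n t)%:E).
  by apply/measurable_EFinP; exact: (measurable_funTS (mH n)).
have intH n : (\int[mu]_(t in `[0%R, T]) (H n t)%:E <= K%:E)%E.
  apply: (@le_trans _ _ (\int[mu]_(t in `[0%R, T]) (G n t)%:E)%E); last by rewrite (rint_EFin (iu n)) lee_fin; exact: hK.
  rewrite le_eqVlt; apply/orP; left; apply/eqP; apply: ge0_ae_eq_integral => //; first exact: mHD.
  - by apply/measurable_EFinP; exact: (measurable_funTS (mG n)).
  - by move=> t _; rewrite lee_fin.
  - by move=> t _; rewrite lee_fin sqr_ge0.
  - exists Z; split => // t /= h; apply: contrapT => nZ; apply: h => _.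
    by rewrite /H ifF //; apply/negbTE/negP; rewrite inE.
have intF : (\int[mu]_(t in `[0%R, T]) (F t)%:E <= K%:E)%E.
  have HD0 n t : `[0%R, T]%classic t -> (0 <= (H n t)%:E)%E by move=> _; rewrite lee_fin.
  have fat := fatou mu (mitv 0 T) mHD HD0.
  apply: (@le_trans _ _ (\int[mu]_(t in `[0%R, T]) limn_einf (fun n => (H n t)%:E))%E).
    rewrite le_eqVlt; apply/orP; left; apply/eqP; apply: eq_integral => t.
    rewrite inE /= in_itv /= => ht; apply/esym.
    have hc : (fun n => (H n t)%:E) @ \oo --> (F t)%:E.
      by apply/fine_cvgP; split; [exact: nearW|exact: HF].
    by have [-> _] := cvg_limn_einf_sup hc.
  apply: le_trans fat _; rewrite limn_einf_lim; apply: lime_le; first exact: is_cvg_einfs.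
  apply: nearW => n; apply: le_trans (intH n); apply: ereal_inf_lbound.
  by exists n => /=.
have iF : intble 0 T F.
  apply: intble_ge0P; first exact: (measurable_funTS mF).
    by move=> t _; exact: sqr_ge0.
  exact: le_lt_trans intF (ltry _).
by split => //; rewrite -lee_fin -(rint_EFin iF).
Qed.

End boundary_values.

(** * Mean square convergence to the boundary values *)

Section boundary_L2.
Context {R : realType}.
Implicit Types (f g h : R[i] -> R[i]) (z w : R[i]) (r s t th e d : R).
Local Notation T := (2 * pi : R).

Lemma psr_dilateB (a : nat -> R[i]) f c : psr a f -> 0 <= c <= 1 ->
  psr (fun n => a n * (c%:C ^+ n - 1)) (fun z => f (c%:C * z) - f z).
Proof.
move=> af /andP[c0 c1] r r01; have [B [q [B0 q01 hB hf]]] := af r r01.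
have cc n : cmod (c%:C ^+ n - 1 : R[i]) <= 1.
  have -> : (c%:C ^+ n - 1 : R[i]) = - (1 - c ^+ n)%:C.
    by rewrite -rmorphXn rmorphB /= opprB.
  have h0 : 0 <= c ^+ n by apply: exprn_ge0.
  have h1 : c ^+ n <= 1 by apply: exprn_ile1.
  by rewrite cmodN cmodR ger0_norm; lra.
exists (2 * B), q; split => // [|n|z N zr]; first by rewrite mulr_ge0.
  rewrite cmodM; apply: (@le_trans _ _ (cmod (a n) * r ^+ n)).
    apply: ler_wpM2r; first by apply: exprn_ge0; case/andP: r01.
    by apply: ler_piMr; [exact: cmod_ge0|exact: cc].
  apply: le_trans (hB n) _; have : 0 <= B * q ^+ n.
    by case/andP: q01 => q0 _; rewrite mulr_ge0 // exprn_ge0.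
  by move=> h; rewrite -mulrA mulr_natl mulr2n lerDr.
have -> : f (c%:C * z) - f z - psum (fun n => a n * (c%:C ^+ n - 1)) N z =
    (f (c%:C * z) - psum a N (c%:C * z)) - (f z - psum a N z).
  have -> : psum (fun n => a n * (c%:C ^+ n - 1)) N z = psum a N (c%:C * z) - psum a N z.
    rewrite /psum -sumrB; apply: eq_bigr => i _; rewrite exprMn; ring.
  ring.
have czr : cmod (c%:C * z) <= r.
  rewrite cmodM cmodR ger0_norm //; apply: le_trans zr.
  by apply: ler_piMl => //; exact: cmod_ge0.
apply: le_trans (cmodB_le _ _) _; have -> : 2 * B * q ^+ N = B * q ^+ N + B * q ^+ N by ring.
by apply: lerD; exact: hf.
Qed.

Lemma psr_H2_sum (a : nat -> R[i]) f : psr a f -> H2 f -> exists C, forall N, \sum_(n < N) cmod (a n) ^+ 2 <= C.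
Proof.
move=> pf Hf; have [K [K0 _ hK]] := H2_bound Hf; exists (K ^+ 2) => N.
apply: (@sum_le_of_radial _ (fun n => cmod (a n) ^+ 2)) => [n|r r0 r1]; first exact: sqr_ge0.
by apply: le_trans (hK r r0 r1); apply: parseval_le => //; rewrite r0 r1.
Qed.

(** The difference has coefficients [a n * (s ^+ n - r ^+ n)] up to sign. For [n < M] Bernoulli's
    inequality makes them small once [r] is near 1; the others form a tail of a square summable
    sequence. *)
Lemma radial_cauchy f e : H2 f -> 0 < e -> exists r0, [/\ 0 < r0, r0 < 1 &
  forall r s, r0 <= r -> r <= s -> s < 1 ->
    rint 0 T (fun t => cmod (f (s%:C * cis t) - f (r%:C * cis t)) ^+ 2) <= e].
Proof.
move=> Hf e0; have pf := hol_psr (proj1 Hf); set a := tcoef f in pf.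
have [C hC] := psr_H2_sum pf Hf.
have T0 := @twopi_gt0 R.
have C0 : 0 <= C by move: (hC 0%N); rewrite big_ord0.
pose e1 := e / T / 2.
have e10 : 0 < e1 by rewrite !divr_gt0.
have [M hM] := l2_tail (fun n => sqr_ge0 (cmod (a n))) hC e10.
pose D := C * M%:R + 1.
have D0 : 0 < D by rewrite /D ltr_wpDl ?ltr01 // mulr_ge0 ?ler0n.
pose r0 := Num.max 2^-1 (1 - e1 / D).
have r0gt : 0 < r0 by rewrite lt_max invr_gt0 ltr0n.
exists r0; split => //.
  by rewrite gt_max invf_lt1 ?ltr0n // ltr1n /= ltrBlDr ltrDl divr_gt0.
move=> r s r0r rs s1.
have rp : 0 < r := lt_le_trans r0gt r0r; have sp : 0 < s := lt_le_trans rp rs.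
have c01 : 0 <= r / s <= 1.
  by apply/andP; split; [exact: divr_ge0 (ltW rp) (ltW sp)|rewrite ler_pdivrMr // mul1r].
have ph := psr_dilateB pf c01; set b := (fun n => _) in ph.
have E t : f ((r / s)%:C * (s%:C * cis t)) = f (r%:C * cis t).
  by rewrite mulrA -rmorphM /= divfK // gt_eqF.
have s01 : 0 <= s < 1 by rewrite (ltW sp).
have -> : rint 0 T (fun t => cmod (f (s%:C * cis t) - f (r%:C * cis t)) ^+ 2) =
    T * m2 (fun z => f ((r / s)%:C * z) - f z) s.
  rewrite /m2 mulrA divff ?T_neq0 // mul1r; apply: eq_rint => t _.
  by rewrite E cmodB.
have -> : e = T * (2 * e1) by rewrite (mulrC 2 e1) /e1 divfK // mulrC divfK // T_neq0.
rewrite ler_pM2l //; apply: (parseval_ge ph s01) => N.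
have r1 : r < 1 := le_lt_trans rs s1.
have bn n : cmod (b n) ^+ 2 * (s ^+ n) ^+ 2 <=
    cmod (a n) ^+ 2 * (M%:R * (1 - r)) + (if (n < M)%N then 0 else cmod (a n) ^+ 2).
  have -> : cmod (b n) ^+ 2 * (s ^+ n) ^+ 2 = cmod (a n) ^+ 2 * (s ^+ n - r ^+ n) ^+ 2.
    have -> : cmod (b n) = cmod (a n) * `|(r / s) ^+ n - 1|.
      by rewrite /b cmodM -rmorphXn -(rmorph1 (real_complex R)) -rmorphB cmodR.
    rewrite exprMn real_normK ?num_real // -mulrA -exprMn; congr (_ * _).
    rewrite -sqrrN; congr (_ ^+ 2); rewrite expr_div_n; field.
    by rewrite expf_neq0 // gt_eqF.
  have h0 : 0 <= r ^+ n by apply: exprn_ge0; exact: ltW.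
  have h1 : r ^+ n <= s ^+ n by apply: lerXn2r; rewrite ?nnegrE ?(ltW rp) ?(ltW sp).
  have h2 : s ^+ n <= 1 by apply: exprn_ile1; exact: ltW.
  have h3 : (s ^+ n - r ^+ n) ^+ 2 <= 1 - r ^+ n.
    by have -> : (s ^+ n - r ^+ n) ^+ 2 = (s ^+ n - r ^+ n) * (s ^+ n - r ^+ n) by []; nra.
  have An := sqr_ge0 (cmod (a n)).
  case: ifP => nM.
    rewrite addr0; apply: ler_wpM2l => //; apply: le_trans h3 _.
    have r01 : 0 <= r <= 1 by rewrite (ltW rp) (ltW r1).
    have := bernoulli_pow n r01; have : n%:R * (1 - r) <= M%:R * (1 - r).
      by apply: ler_wpM2r; [lra|rewrite ler_nat ltnW].
    by lra.
  rewrite -[leLHS]add0r; apply: lerD; first by apply: mulr_ge0 => //; apply: mulr_ge0; [exact: ler0n|lra].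
  by apply: ler_piMr => //; lra.
apply: (@le_trans _ _ (\sum_(n < N) (cmod (a n) ^+ 2 * (M%:R * (1 - r)) + (if (n < M)%N then 0 else cmod (a n) ^+ 2)))).
  by apply: ler_sum => n _; exact: bn.
have -> : 2 * e1 = e1 + e1 by rewrite mulr_natl mulr2n.
rewrite big_split /= -mulr_suml; apply: lerD; last exact: hM.
have hr : 1 - r <= e1 / D.
  have : 1 - e1 / D <= r by apply: le_trans r0r; rewrite le_max lexx orbT.
  by lra.
apply: (@le_trans _ _ (C * (M%:R * (1 - r)))).
  by apply: ler_wpM2r; [apply: mulr_ge0; [exact: ler0n|lra]|exact: hC].
apply: (@le_trans _ _ (D * (1 - r))).
  by rewrite mulrA; apply: ler_wpM2r; [lra|rewrite /D; lra].
by move: hr; rewrite ler_pdivlMr // [X in X <= _ -> _]mulrC.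
Qed.

Lemma cmeas_bvalB f (u : R -> R[i]) : H2 f -> cmeas [set: R] u ->
  cmeas [set: R] (fun t => bval f (cis t) - u t).
Proof.
by move=> [hf _] mu_; apply: cmeasB => //; exact: cmeas_bval (hol_cont hf).
Qed.

Lemma bval_intble2 f : H2 f -> intble 0 T (fun t => cmod (bval f (cis t)) ^+ 2).
Proof.
move=> Hf; have cf : cont_disk f by apply: hol_cont; case: Hf.
have [K [K0 _ hK]] := H2_bound Hf.
have i1 n : intble 0 T (fun t => cmod (f ((rseq 0 n)%:C * cis t) - 0) ^+ 2).
  have /andP[h1 h2] := @rseq01 R 0 n.
  by apply: eq_intble (intble_circle2 _ _ cf h1 h2) => t _; rewrite subr0.
have i2 n : rint 0 T (fun t => cmod (f ((rseq 0 n)%:C * cis t) - 0) ^+ 2) <= T * K ^+ 2.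
  have /andP[h1 h2] := @rseq01 R 0 n.
  have := hK _ h1 h2; rewrite /m2 ler_pdivrMl ?twopi_gt0 // => h; apply: le_trans h.
  by rewrite (eq_rint (v := fun t => cmod (f ((rseq 0 n)%:C * cis t)) ^+ 2)) // => t _; rewrite subr0.
have [h _] := fatou_bval Hf (cmeas_cst _ 0) i1 i2.
by apply: eq_intble h => t _; rewrite subr0.
Qed.

(** Fatou's lemma sends the outer radius of [radial_cauchy] to 1 while the inner one stays fixed. *)
Lemma bval_cvg_L2 f e : H2 f -> 0 < e -> exists r0, [/\ 0 < r0, r0 < 1 &
  forall r, r0 <= r -> r < 1 ->
    intble 0 T (fun t => cmod (bval f (cis t) - f (r%:C * cis t)) ^+ 2) /\
    rint 0 T (fun t => cmod (bval f (cis t) - f (r%:C * cis t)) ^+ 2) <= e].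
Proof.
move=> Hf e0; have cf : cont_disk f by apply: hol_cont; case: Hf.
have [r0 [r00 r01 hr]] := radial_cauchy Hf e0; exists r0; split => // r r0r r1.
have rp : 0 <= r by apply: le_trans r0r; exact: ltW.
have [N hN] := rseq_gt r1.
have hN' n : r <= rseq N n by apply/ltW/hN; exact: leq_addl.
apply: (@fatou_bval _ _ _ _ N) => //.
- exact: cmeas_circle.
- move=> n; have /andP[h1 h2] := @rseq01 R N n.
  have [B B0 hB] := cont_disk_bounded cf h2.
  apply: (@intble_sqcmod _ _ _ _ (B + B)).
    apply: cintble_cmeas; apply: cintbleB; exact: cintble_circle.
  move=> x _; apply: le_trans (cmodB_le _ _) _.
  by apply: lerD; apply: hB; rewrite cmod_circle.
- by move=> n; have /andP[h1 h2] := @rseq01 R N n; apply: hr.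
Qed.

Lemma intble_of_sq (u : R -> R[i]) (a b : R) : cmeas `[a, b]%classic u ->
  intble a b (fun t => cmod (u t) ^+ 2) -> cintble a b u.
Proof.
move=> mu_ iu; apply: (@cintble_dom _ _ _ _ (fun t => 1 + cmod (u t) ^+ 2)) => //.
  by apply: intbleD => //; exact: intble_cst.
by move=> x _; have := cmod_ge0 (u x); have := sqr_ge0 (cmod (u x) - 1); nra.
Qed.

Lemma measurable_sqcmod (u : R -> R[i]) : cmeas [set: R] u ->
  measurable_fun [set: R] (fun t => cmod (u t) ^+ 2).
Proof. by move=> mu_; apply: measurable_funX; exact: cmeas_cmod. Qed.

Lemma cmeas_sub (u : R -> R[i]) (a b : R) : cmeas [set: R] u -> cmeas `[a, b]%classic u.
Proof. by move=> [h1 h2]; split; apply: measurable_funTS. Qed.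

Lemma bval_intble2_all f (a b : R) : H2 f -> intble a b (fun t => cmod (bval f (cis t)) ^+ 2).
Proof.
move=> Hf; apply: (@intble_periodic _ _ T) => //; first exact: twopi_gt0.
- by apply: measurable_sqcmod; apply: cmeas_bval; apply: hol_cont; case: Hf.
- by move=> t; rewrite bval_periodic.
- exact: bval_intble2.
Qed.

Lemma bval_cintble f (a b : R) : H2 f -> cintble a b (fun t => bval f (cis t)).
Proof.
move=> Hf; apply: intble_of_sq; last exact: bval_intble2_all.
by apply: cmeas_sub; apply: cmeas_bval; apply: hol_cont; case: Hf.
Qed.

(** The pointwise inequality [y <= d + y ^+ 2 / d] takes the place of Cauchy-Schwarz. *)
Lemma rint_cmod_le (u : R -> R[i]) d : 0 < d -> cmeas [set: R] u ->
  intble 0 T (fun t => cmod (u t) ^+ 2) ->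
  rint 0 T (fun t => cmod (u t) ^+ 2) <= d ^+ 2 -> rint 0 T (fun t => cmod (u t)) <= d * (T + 1).
Proof.
move=> d0 mu_ iu hu.
have ic : intble 0 T (fun t => cmod (u t)).
  by apply: cintble_cmod; apply: intble_of_sq => //; exact: cmeas_sub.
apply: (@le_trans _ _ (rint 0 T (fun t => d + d^-1 * cmod (u t) ^+ 2))).
  apply: le_rint => //; first by apply: intbleD; [exact: intble_cst|exact: intbleZ].
  move=> x _; set y := cmod _; have y0 : 0 <= y by exact: cmod_ge0.
  have [yd|yd] := leP y d; first by apply: ler_wpDr => //; rewrite mulr_ge0 ?sqr_ge0 // invr_ge0 ltW.
  apply: ler_wpDl; first exact: ltW.
  by rewrite ler_pdivlMl // -[leRHS]/(y * y) ler_wpM2r // ltW.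
rewrite rintD ?rint_cst ?(T_ge0) //; last 2 first.
- exact: intble_cst.
- exact: intbleZ.
rewrite (rintZ _ iu) subr0 (mulrDr d T 1); apply: lerD => //.
by rewrite mulr1 ler_pdivrMl // -[leRHS]/(d ^+ 2).
Qed.

Lemma bval_cvg_L1 f e : H2 f -> 0 < e -> exists r0, [/\ 0 < r0, r0 < 1 &
  forall r, r0 <= r -> r < 1 -> rint 0 T (fun t => cmod (bval f (cis t) - f (r%:C * cis t))) <= e].
Proof.
move=> Hf e0; have T0 := @twopi_gt0 R.
pose d := e / (T + 1); have T1 : 0 < T + 1 by lra.
have d0 : 0 < d by rewrite divr_gt0.
have d2 : 0 < d ^+ 2 by rewrite exprn_gt0.
have [r0 [r00 r01 hr]] := bval_cvg_L2 Hf d2; exists r0; split => // r h1 h2.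
have [i1 i2] := hr r h1 h2.
have -> : e = d * (T + 1) by rewrite /d divfK // gt_eqF.
apply: rint_cmod_le => //; apply: cmeas_bvalB => //; apply: cmeas_circle => //.
  by apply: hol_cont; case: Hf.
exact: ltW (lt_le_trans r00 h1).
Qed.

(** Limit of [poisson_hol] as the circle grows: for fixed [z] the kernel is bounded, so convergence
    in mean of the dilates suffices on one side and continuity of [f] at [z] on the other. *)
Lemma poisson_bval f z : H2 f -> cmod z < 1 ->
  cint 0 T (fun t => (poisson z t)%:C * bval f (cis t)) = f z * T%:C.
Proof.
move=> Hf z1; have hf := proj1 Hf; have cf := hol_cont hf; have T0 := @twopi_gt0 R.
apply: cdisk_eq0 => e e0; have e2 : 0 < e / 2 by rewrite divr_gt0.
pose A := 2 / (1 - cmod z).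
have A0 : 0 < A by rewrite divr_gt0 // subr_gt0.
have [r0 [r00 r01 hr]] := bval_cvg_L1 Hf (divr_gt0 e2 A0).
have [d d0 hd] := cf z z1 _ (divr_gt0 e2 T0).
pose r := Num.max r0 (1 - d / 2).
have r0r : r0 <= r by rewrite le_max lexx.
have r1 : r < 1 by rewrite gt_max r01 /= ltrBlDr ltrDl divr_gt0.
have rp : 0 <= r by apply: le_trans r0r; exact: ltW.
have rd : 1 - d / 2 <= r by rewrite le_max lexx orbT.
have ib := bval_cintble 0 T Hf.
have ic : cintble 0 T (fun t => f (r%:C * cis t)) by exact: cintble_circle.
apply: le_trans (cmodDB _ _ (f (r%:C * z) * T%:C)) _.
rewrite [e]splitr; apply: lerD.
  rewrite -(poisson_hol hf rp r1 z1) -cintB; try exact: cintble_poisson.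
  have -> : cint 0 T (fun t => (poisson z t)%:C * bval f (cis t) - (poisson z t)%:C * f (r%:C * cis t)) =
      cint 0 T (fun t => (poisson z t)%:C * (bval f (cis t) - f (r%:C * cis t))).
    by apply: eq_cint => t _; rewrite mulrBr.
  have ii := cintbleB ib ic.
  apply: le_trans (cint_le (cintble_poisson z1 ii)) _.
  apply: (@le_trans _ _ (rint 0 T (fun t => A * cmod (bval f (cis t) - f (r%:C * cis t))))).
    apply: le_rint.
    - by apply: cintble_cmod; exact: cintble_poisson.
    - by apply: intbleZ; exact: cintble_cmod.
    - move=> t _; rewrite cmodM cmodR ger0_norm ?poisson_ge0 //.
      by apply: ler_wpM2r; [exact: cmod_ge0|exact: poisson_le].
  rewrite (rintZ _ (cintble_cmod ii)); apply: le_trans (ler_wpM2l (ltW A0) (hr r r0r r1)) _.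
  by rewrite (mulrC A) divfK // gt_eqF.
rewrite -mulrBl cmodM cmodR (ger0_norm (ltW T0)) -ler_pdivlMr //.
have -> : r%:C * z = z + (r - 1)%:C * z by rewrite rmorphB /=; ring.
apply: hd; rewrite cmodM cmodR.
have h : `|r - 1| <= d / 2 by rewrite ler_norml; apply/andP; split; lra.
apply: (@le_lt_trans _ _ (d / 2 * 1)); last by lra.
by apply: ler_pM => //; [exact: cmod_ge0|exact: ltW].
Qed.

End boundary_L2.

(** * The John-Nirenberg inequality *)

Section john_nirenberg.
Context {R : realType}.
Implicit Types (a b c d r s t e x y : R) (k p z : R[i]).

Lemma rint_subset (v : R -> R) a b c d : a <= c -> c <= d -> d <= b -> (forall t, 0 <= v t) ->
  intble a b v -> rint c d v <= rint a b v.
Proof.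
move=> ac cd db v0 iv; have ad := le_trans ac cd.
rewrite (rint_cat ad db iv) (rint_cat ac cd (intble_sub (lexx a) db iv)).
have h1 : 0 <= rint a c v by apply: rint_ge0.
have h2 : 0 <= rint d b v by apply: rint_ge0.
by lra.
Qed.

Lemma sqr_cmodD_le p k : cmod (p + k) ^+ 2 <= 2 * cmod p ^+ 2 + 2 * cmod k ^+ 2.
Proof.
apply: (@le_trans _ _ ((cmod p + cmod k) ^+ 2)).
  by apply: lerXn2r; rewrite ?nnegrE ?addr_ge0 ?cmod_ge0 // cmodD.
by have := sqr_ge0 (cmod p - cmod k); rewrite sqrrB sqrrD; lra.
Qed.

Definition cavg (u : R -> R[i]) a b : R[i] := ((b - a)^-1)%:C * cint a b u.

Lemma cavg_dev (u : R -> R[i]) a b k : a < b -> cintble a b u ->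
  (b - a) * cmod (cavg u a b - k) <= rint a b (fun t => cmod (u t - k)).
Proof.
move=> ab iu; have h0 : 0 < b - a by rewrite subr_gt0.
have E : (b - a)%:C * (cavg u a b - k) = cint a b (fun t => u t - k).
  rewrite cintB ?cint_cst ?(ltW ab) //; last exact: cintble_cst.
  by rewrite mulrBr /cavg mulrA -rmorphM /= divff ?gt_eqF // mul1r (mulrC k).
rewrite -[X in X * _](gtr0_norm h0) -cmodR -cmodM E.
by apply: cint_le; apply: cintbleB => //; exact: cintble_cst.
Qed.

Lemma ccont_uniform (w : R -> R[i]) a b e : a <= b -> ccont a b w -> 0 < e ->
  exists2 d, 0 < d & forall x y, a <= x <= b -> a <= y <= b -> `|x - y| <= d -> cmod (w x - w y) <= e.
Proof.
move=> ab cw e0.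
(* With the degenerate second side [[0, 0]], [quadrisection] becomes ordinary bisection. Only [x] is
   localised; [y] ranges over the whole interval so that two halves can be glued. *)
pose P s1 s2 (t1 t2 : R) := exists2 d, 0 < d &
  forall x y, s1 <= x <= s2 -> a <= y <= b -> `|x - y| <= d -> cmod (w x - w y) <= e.
apply: (@quadrisection _ P a b 0 0) => //.
  move=> a' b' c d _ _ _ _ _ _ m n [d1 d10 h1] [d2 d20 h2] _ _.
  exists (Num.min d1 d2) => [|x y]; first by rewrite lt_min d10.
  move=> /andP[xa xb] yab; rewrite le_min => /andP[l1 l2].
  have [xm|xm] := leP x m; first by apply: h1 => //; rewrite xa.
  by apply: h2 => //; rewrite xb ltW.
move=> x y xab _; have e2 : 0 < e / 2 by rewrite divr_gt0.
have [d d0 hd] := cw x xab _ e2.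
exists (d / 2) => [|a' b' c c' aa bb _ _ /andP[ax xb] _ ba _]; first by rewrite divr_gt0.
exists (d / 3) => [|x' y' /andP[h1 h2] yab h3]; first by rewrite divr_gt0.
have k1 : `|x' - x| <= d / 2 by rewrite ler_norml; apply/andP; split; lra.
apply: le_trans (cmodDB _ _ (w x)) _; rewrite [e]splitr; apply: lerD.
  apply: hd; last by apply: le_lt_trans k1 _; lra.
  by apply/andP; split; lra.
rewrite cmodB; apply: hd => //; move: k1 h3; rewrite !ler_norml ltr_norml => /andP[? ?] /andP[? ?].
by apply/andP; split; lra.
Qed.

Section tree.
Variables (u : R -> R[i]) (L M : R).
Hypothesis mu_ : cmeas [set: R] u.
Hypothesis iu2 : forall a b, intble a b (fun t => cmod (u t) ^+ 2).
Hypothesis M0 : 0 < M.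
Hypothesis osc : forall a b, a < b -> b <= a + L ->
  rint a b (fun t => cmod (u t - cavg u a b)) <= M * (b - a).

Lemma iu a b : cintble a b u.
Proof. by apply: intble_of_sq => //; exact: cmeas_sub. Qed.

Lemma iuB a b k : intble a b (fun t => cmod (u t - k)).
Proof. by apply: cintble_cmod; apply: cintbleB; [exact: iu|exact: cintble_cst]. Qed.

Lemma iuB2 a b k : intble a b (fun t => cmod (u t - k) ^+ 2).
Proof.
apply: (@intble_dom _ _ _ _ (fun t => 2 * cmod (u t) ^+ 2 + 2 * cmod (- k) ^+ 2)).
- apply: measurable_funX; apply: cmeas_cmod => //.
  by apply: cintble_cmeas; apply: cintbleB; [exact: iu|exact: cintble_cst].
- by apply: intbleD; [exact: intbleZ|exact: intble_cst].
- by move=> x _; rewrite ger0_norm ?sqr_ge0 //; exact: sqr_cmodD_le.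
Qed.

Lemma cavg_sub a b c d : a <= c -> c < d -> d <= b -> b <= a + L -> b - a <= 2 * (d - c) ->
  cmod (cavg u c d - cavg u a b) <= 2 * M.
Proof.
move=> ac cd db bL h; have ab : a < b by lra.
have h1 := cavg_dev (cavg u a b) cd (iu c d).
have h2 := rint_subset ac (ltW cd) db (fun t => cmod_ge0 (u t - cavg u a b)) (iuB a b _).
have h3 := osc ab bL; have h4 := le_trans h1 (le_trans h2 h3).
have dc : 0 < d - c by rewrite subr_gt0.
rewrite -(ler_pM2l dc); apply: le_trans h4 _.
by have := ler_wpM2l (ltW M0) h; lra.
Qed.

Lemma cavg_half a b : a < b -> b <= a + L ->
  cmod (cavg u a ((a + b) / 2) - cavg u a b) <= 2 * M /\
  cmod (cavg u ((a + b) / 2) b - cavg u a b) <= 2 * M.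
Proof. by move=> ab bL; split; apply: cavg_sub => //; lra. Qed.

(** The mean square deviation from [k] of the averages over the [2 ^ n] dyadic subintervals. At
    finite depth the self-improving estimate below is an induction on [n], with no finiteness to
    assume beforehand. *)
Fixpoint tree_var n k a b : R := if n is m.+1 then
  (tree_var m k a ((a + b) / 2) + tree_var m k ((a + b) / 2) b) / 2
  else cmod (cavg u a b - k) ^+ 2.

(** The fraction of [[a, b]] covered by the stopping intervals of a Calderon-Zygmund decomposition
    cut off at depth [n]: the maximal dyadic ones whose average is further than [4 * M] from [k]. *)
Fixpoint tree_stop n k a b : R := if 4 * M < cmod (cavg u a b - k) then 1 else if n is m.+1 then
  (tree_stop m k a ((a + b) / 2) + tree_stop m k ((a + b) / 2) b) / 2 else 0.

Lemma tree_stopS n k a b : tree_stop n.+1 k a b = if 4 * M < cmod (cavg u a b - k) then 1 else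
  (tree_stop n k a ((a + b) / 2) + tree_stop n k ((a + b) / 2) b) / 2.
Proof. by []. Qed.

Lemma tree_varS n k a b : tree_var n.+1 k a b =
  (tree_var n k a ((a + b) / 2) + tree_var n k ((a + b) / 2) b) / 2.
Proof. by []. Qed.

Lemma tree_var_shift n k p a b : tree_var n k a b <= 2 * tree_var n p a b + 2 * cmod (p - k) ^+ 2.
Proof.
elim: n a b => [|n IH] a b /=; last by have := IH a ((a + b) / 2); have := IH ((a + b) / 2) b; lra.
have -> : cavg u a b - k = (cavg u a b - p) + (p - k) by ring.
exact: sqr_cmodD_le.
Qed.

(** Chebyshev's inequality on the stopping intervals: their interiors are disjoint, and the integral
    over each is at least [4 * M] times its length. *)
Lemma tree_stop_le n k a b : a < b ->
  4 * M * tree_stop n k a b * (b - a) <= rint a b (fun t => cmod (u t - k)).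
Proof.
elim: n a b => [|n IH] a b ab /=; case: ifP => h.
- have ba : 0 < b - a by rewrite subr_gt0.
  apply: le_trans (cavg_dev k ab (iu a b)); rewrite mulr1 (mulrC (b - a)).
  by rewrite ler_pM2r // ltW.
- by rewrite mulr0 mul0r rint_ge0 // => t _; exact: cmod_ge0.
- have ba : 0 < b - a by rewrite subr_gt0.
  apply: le_trans (cavg_dev k ab (iu a b)); rewrite mulr1 (mulrC (b - a)).
  by rewrite ler_pM2r // ltW.
- set m := (a + b) / 2; have am : a < m by rewrite /m; lra.
  have mb : m < b by rewrite /m; lra.
  rewrite (rint_cat (ltW am) (ltW mb) (iuB a b k)).
  apply: le_trans (lerD (IH a m am) (IH m b mb)).
  have -> : m - a = (b - a) / 2 by rewrite /m; field.
  have -> : b - m = (b - a) / 2 by rewrite /m; field.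
  by rewrite le_eqVlt; apply/orP; left; apply/eqP; field.
Qed.

(* On a stopping interval the mean has moved by at most 6M from k, so the variation
   below it is controlled by the variation around its own mean. *)
Lemma tree_var_stop n k a b D : 0 <= D -> a < b -> b <= a + L ->
  (forall m a b, (m <= n)%N -> a < b -> b <= a + L -> tree_var m (cavg u a b) a b <= D) ->
  cmod (cavg u a b - k) <= 6 * M ->
  tree_var n k a b <= 16 * M ^+ 2 + tree_stop n k a b * (2 * D + 72 * M ^+ 2).
Proof.
move=> D0; elim: n a b => [|n IH] a b ab bL hD hk /=; case: ifP => h.
- have := hD 0%N a b (leqnn _) ab bL; have M2 := sqr_ge0 M.
  rewrite mul1r => _; have : cmod (cavg u a b - k) ^+ 2 <= (6 * M) ^+ 2.
    by apply: lerXn2r; rewrite ?nnegrE ?cmod_ge0 // mulr_ge0 // ltW.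
  by rewrite exprMn; lra.
- rewrite mul0r addr0; move/negbT: h; rewrite -leNgt => h.
  have -> : 16 * M ^+ 2 = (4 * M) ^+ 2 by ring.
  by apply: lerXn2r; rewrite ?nnegrE ?cmod_ge0 // mulr_ge0 // ltW.
(* Recentring at the interval's own mean doubles the variation and adds twice the squared shift,
   [2 * (6 * M) ^+ 2 = 72 * M ^+ 2]. *)
- rewrite mul1r; have h1 := hD n.+1 a b (leqnn _) ab bL.
  have h2 := tree_var_shift n.+1 k (cavg u a b) a b.
  have h3 : cmod (cavg u a b - k) ^+ 2 <= (6 * M) ^+ 2.
    by apply: lerXn2r; rewrite ?nnegrE ?cmod_ge0 // mulr_ge0 // ltW.
  by move: h2 h1 h3; rewrite exprMn /=; have := sqr_ge0 M; lra.
- move/negbT: h; rewrite -leNgt => h.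
  have [k1 k2] := cavg_half ab bL; set m := (a + b) / 2 in k1 k2 *.
  have am : a < m by rewrite /m; lra.
  have mb : m < b by rewrite /m; lra.
  have hD' j a' b' : (j <= n)%N -> a' < b' -> b' <= a' + L -> tree_var j (cavg u a' b') a' b' <= D.
    by move=> jn; apply: hD; exact: leqW.
  (* A parent that does not stop is within [4 * M] of [k], and halving moves the mean by at most
     [2 * M]. *)
  have q1 : cmod (cavg u a m - k) <= 6 * M.
    by apply: le_trans (cmodDB _ _ (cavg u a b)) _; lra.
  have q2 : cmod (cavg u m b - k) <= 6 * M.
    by apply: le_trans (cmodDB _ _ (cavg u a b)) _; lra.
  have mL : m <= a + L by lra.
  have bL' : b <= m + L by lra.
  by have := IH a m am mL hD' q1; have := IH m b mb bL' hD' q2; lra.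
Qed.

(** Around the interval's own mean the root does not stop and the stopping fraction is at most 1/4.
    So a bound [D] for smaller depths yields [16 * M ^+ 2 + (2 * D + 72 * M ^+ 2) / 4], and
    [68 * M ^+ 2] is the fixed point of this map. *)
Lemma tree_var_le n a b : a < b -> b <= a + L -> tree_var n (cavg u a b) a b <= 68 * M ^+ 2.
Proof.
have M2 := sqr_ge0 M; have D0 : 0 <= 68 * M ^+ 2 by rewrite mulr_ge0.
elim/ltn_ind: n a b => -[|n] IH a b ab bL.
  by rewrite -[tree_var _ _ _ _]/(cmod (cavg u a b - cavg u a b) ^+ 2) subrr cmod0 expr0n.
have [k1 k2] := cavg_half ab bL.
have P1 := tree_stop_le n.+1 (cavg u a b) ab; have P2 := osc ab bL.
have ba : 0 < b - a by rewrite subr_gt0.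
have P3 : 4 * tree_stop n.+1 (cavg u a b) a b <= 1.
  have Mb : 0 < M * (b - a) by rewrite mulr_gt0.
  rewrite -(ler_pM2l Mb) mulr1; apply: le_trans (le_trans P1 P2).
  by rewrite le_eqVlt; apply/orP; left; apply/eqP; ring.
move: P3; rewrite tree_stopS tree_varS subrr cmod0 ltNge mulr_ge0 ?(ltW M0) //=.
set m := (a + b) / 2 in k1 k2 *.
have am : a < m by rewrite /m; lra.
have mb : m < b by rewrite /m; lra.
have mL : m <= a + L by lra.
have bL' : b <= m + L by lra.
have hD j a' b' : (j <= n)%N -> a' < b' -> b' <= a' + L -> tree_var j (cavg u a' b') a' b' <= 68 * M ^+ 2.
  by move=> jn; apply: IH.
have M26 : 2 * M <= 6 * M by rewrite ler_pM2r // ler_nat.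
have q1 := le_trans k1 M26.
have q2 := le_trans k2 M26.
have R1 := tree_var_stop D0 am mL hD q1.
have R2 := tree_var_stop D0 mb bL' hD q2.
set s1 := tree_stop _ _ _ _ in R1 *; set s2 := tree_stop _ _ _ _ in R2 *.
move: R1 R2; have -> : 2 * (68 * M ^+ 2) + 72 * M ^+ 2 = 208 * M ^+ 2 by ring.
by move=> R1 R2 h; have := ler_wpM2r M2 h; lra.
Qed.

(** Any centre [p] may be used to measure the spread inside a leaf, since the average is at most as
    far from [p] as [u] is in mean square; [p] will be a value of a continuous approximant. *)
Lemma var_leaf a b k p : a < b -> rint a b (fun t => cmod (u t - k) ^+ 2) <=
  2 * (b - a) * cmod (cavg u a b - k) ^+ 2 + 8 * rint a b (fun t => cmod (u t - p) ^+ 2).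
Proof.
move=> ab; have ba : 0 < b - a by rewrite subr_gt0.
set A := cavg u a b; pose D := cmod (A - p); set Q := rint a b (fun t => cmod (u t - p) ^+ 2).
have DQ : (b - a) * D ^+ 2 <= Q.
  have h : rint a b (fun t => cmod (u t - p)) >= (b - a) * D by exact: cavg_dev (iu a b).
  have : rint a b (fun t => 2 * D * cmod (u t - p)) <= rint a b (fun t => D ^+ 2 + cmod (u t - p) ^+ 2).
    apply: le_rint; first by apply: intbleZ; exact: iuB.
      by apply: intbleD; [exact: intble_cst|exact: iuB2].
    by move=> t _; have := sqr_ge0 (D - cmod (u t - p)); rewrite sqrrB; lra.
  rewrite (rintZ _ (iuB a b p)) (rintD (intble_cst a b _) (iuB2 a b p)) rint_cst ?(ltW ab) // -/Q.
  have := ler_wpM2l (cmod_ge0 (A - p)) h; rewrite -/D.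
  have -> : D * ((b - a) * D) = (b - a) * D ^+ 2 by ring.
  by set I := rint _ _ _; lra.
have : rint a b (fun t => cmod (u t - k) ^+ 2) <=
    rint a b (fun t => (2 * cmod (A - k) ^+ 2 + 4 * D ^+ 2) + 4 * cmod (u t - p) ^+ 2).
  apply: le_rint; first exact: iuB2.
    by apply: intbleD; [exact: intble_cst|apply: intbleZ; exact: iuB2].
  move=> t _; have -> : u t - k = (A - k) + ((u t - p) + (p - A)) by ring.
  have h1 := sqr_cmodD_le (A - k) ((u t - p) + (p - A)).
  have h2 := sqr_cmodD_le (u t - p) (p - A).
  by move: h2; rewrite (cmodB p) -/D; lra.
rewrite (rintD (intble_cst a b _) (intbleZ _ (iuB2 a b p))) rint_cst ?(ltW ab) // (rintZ _ (iuB2 a b p)) -/Q.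
by move=> h; apply: le_trans h _; lra.
Qed.

(** This takes the place of Lebesgue differentiation: at depth [n] the approximant [w] varies by at
    most [e] on each leaf, so the averages determine the variance up to [e] and the distance from
    [u] to [w]. *)
Lemma var_tree (w : R -> R[i]) e n k a b : (forall a b, cintble a b w) ->
  (forall a b, intble a b (fun t => cmod (u t - w t) ^+ 2)) -> a < b -> 0 <= e ->
  (forall x y, a <= x <= b -> a <= y <= b -> `|x - y| <= (b - a) / 2 ^+ n -> cmod (w x - w y) <= e) ->
  rint a b (fun t => cmod (u t - k) ^+ 2) <= 2 * (b - a) * tree_var n k a b +
    16 * rint a b (fun t => cmod (u t - w t) ^+ 2) + 16 * e ^+ 2 * (b - a).
Proof.
move=> iw iuw ab e0; elim: n a b ab => [|n IH] a b ab hw /=.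
  apply: le_trans (var_leaf k (w a) ab) _; rewrite -addrA; apply: lerD => //.
  have : rint a b (fun t => cmod (u t - w a) ^+ 2) <=
      rint a b (fun t => 2 * cmod (u t - w t) ^+ 2 + 2 * e ^+ 2).
    apply: le_rint; first exact: iuB2.
      by apply: intbleD; [exact: intbleZ|exact: intble_cst].
    move=> t tab; have -> : u t - w a = (u t - w t) + (w t - w a) by ring.
    apply: le_trans (sqr_cmodD_le _ _) _; apply: lerD => //; rewrite ler_pM2l //.
    apply: lerXn2r; rewrite ?nnegrE ?cmod_ge0 //; apply: hw => //.
      by rewrite lexx ltW.
    by rewrite expr0 divr1; case/andP: tab => ? ?; rewrite ger0_norm; lra.
  rewrite (rintD (intbleZ _ (iuw a b)) (intble_cst a b _)) (rintZ _ (iuw a b)) rint_cst ?(ltW ab) //.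
  by set I := rint _ _ _; set J := rint _ _ _; lra.
set m := (a + b) / 2; have am : a < m by rewrite /m; lra.
have mb : m < b by rewrite /m; lra.
have ma2 : m - a = (b - a) / 2 by rewrite /m; field.
have bm2 : b - m = (b - a) / 2 by rewrite /m; field.
have E : (b - a) / 2 / 2 ^+ n = (b - a) / 2 ^+ n.+1.
  by rewrite exprS invfM mulrA.
have h1 : rint a m (fun t => cmod (u t - k) ^+ 2) <= 2 * (m - a) * tree_var n k a m +
    16 * rint a m (fun t => cmod (u t - w t) ^+ 2) + 16 * e ^+ 2 * (m - a).
  apply: IH => // x y /andP[x1 x2] /andP[y1 y2]; rewrite ma2 E => h.
  by apply: hw => //; apply/andP; split; lra.
have h2 : rint m b (fun t => cmod (u t - k) ^+ 2) <= 2 * (b - m) * tree_var n k m b +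
    16 * rint m b (fun t => cmod (u t - w t) ^+ 2) + 16 * e ^+ 2 * (b - m).
  apply: IH => // x y /andP[x1 x2] /andP[y1 y2]; rewrite bm2 E => h.
  by apply: hw => //; apply/andP; split; lra.
rewrite (rint_cat (ltW am) (ltW mb) (iuB2 a b k)) (rint_cat (ltW am) (ltW mb) (iuw a b)).
apply: le_trans (lerD h1 h2) _; rewrite ma2 bm2.
set I := rint _ _ _; set J := rint _ _ _; set A := tree_var _ _ _ _; set B := tree_var _ _ _ _.
by rewrite le_eqVlt; apply/orP; left; apply/eqP; field.
Qed.

(** The tree bound 68 enters with the factor 2 of [var_tree], giving 136; each of its two error
    terms, with factor 16, is kept below [e / 2]. For boundary values the dilates provide the
    continuous approximants. *)
Lemma john_nirenberg_L2 a b : a < b -> b <= a + L ->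
  (forall e, 0 < e -> exists w : R -> R[i], [/\ forall a b, ccont a b w,
     forall a b, intble a b (fun t => cmod (u t - w t) ^+ 2) &
     rint a b (fun t => cmod (u t - w t) ^+ 2) <= e]) ->
  rint a b (fun t => cmod (u t - cavg u a b) ^+ 2) <= 136 * M ^+ 2 * (b - a).
Proof.
move=> ab bL happ; have ba : 0 < b - a by rewrite subr_gt0.
apply: le_lim => e e0; have e1 : 0 < e / 32 by rewrite divr_gt0.
have [w [cw iw hw]] := happ _ e1.
pose d := Num.min 1 (e / 32 / (b - a)); have d0 : 0 < d by rewrite lt_min ltr01 !divr_gt0.
have [x x0 hx] := ccont_uniform (ltW ab) (cw a b) d0.
have [n hn] := half_pow_lt (b - a) x0.
have h : rint a b (fun t => cmod (u t - cavg u a b) ^+ 2) <= 2 * (b - a) * tree_var n (cavg u a b) a b +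
    16 * rint a b (fun t => cmod (u t - w t) ^+ 2) + 16 * d ^+ 2 * (b - a).
  apply: var_tree => //; first by move=> *; exact: ccont_cintble.
    exact: ltW.
  by move=> x' y' h1 h2 h3; apply: hx => //; exact: le_trans h3 (ltW hn).
apply: le_trans h _; rewrite -addrA.
have -> : 136 * M ^+ 2 * (b - a) = 2 * (b - a) * (68 * M ^+ 2) by ring.
apply: lerD; first by apply: ler_wpM2l; [lra|exact: tree_var_le].
have dd : d ^+ 2 * (b - a) <= e / 32.
  have d1 : d <= 1 by rewrite ge_min lexx.
  have d2 : d * (b - a) <= e / 32 by rewrite -ler_pdivlMr // ge_min lexx orbT.
  rewrite expr2 -mulrA; apply: le_trans d2; apply: ler_piMl => //.
  by rewrite mulr_ge0 // ltW.
by move: hw; set I := rint _ _ _; lra.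
Qed.

End tree.
End john_nirenberg.

(** * Garsia's estimate for Poisson means *)

Section garsia.
Context {R : realType}.
Implicit Types (f g : R[i] -> R[i]) (z w k : R[i]) (a b r s t th e d : R).
Local Notation T := (2 * pi : R).

Lemma polar z : exists th, z = (cmod z)%:C * cis th.
Proof.
have [->|z0] := eqVneq z 0; first by exists 0; rewrite cmod0 mul0r.
pose w := z / (cmod z)%:C.
have n0 : 0 < cmod z by rewrite cmod_gt0.
have zw : z = (cmod z)%:C * w.
  by rewrite /w mulrC divfK //; apply/eqP => /(congr1 (@complex.Re R)) /= /eqP; rewrite gt_eqF.
have w1 : cmod w = 1 by rewrite /w cmodM cmodV cmodR ger0_norm ?ltW // divff // gt_eqF.
have := sqr_cmod w; rewrite w1 expr1n => E.
have h1 : -1 <= Re w <= 1 by rewrite -ler_norml -w1; exact: Re_le_cmod.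
have hI : `|Im w| = Num.sqrt (1 - Re w ^+ 2).
  by rewrite E addrC addKr sqrtr_sqr.
have [I0|I0] := leP 0 (Im w).
  exists (acos (Re w)); rewrite {1}zw; congr (_ * _); apply: complex_ext => /=.
    by rewrite acosK.
  by rewrite sin_acos // -hI ger0_norm.
exists (- acos (Re w)); rewrite {1}zw; congr (_ * _); apply: complex_ext => /=.
  by rewrite cosN acosK.
by rewrite sinN sin_acos // -hI ltr0_norm // opprK.
Qed.

Lemma sum_sq_half K : \sum_(k < K) (k%:R ^+ 2 / 2 ^+ k : R) <= 6.
Proof.
have -> : \sum_(k < K) (k%:R ^+ 2 / 2 ^+ k : R) = 6 - 2 * (K%:R ^+ 2 + 2 * K%:R + 3) / 2 ^+ K.
  elim: K => [|K IH]; first by rewrite big_ord0 expr0; field.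
  rewrite big_ord_recr IH (exprS _ K) [LHS]/=.
  have -> : K.+1%:R = K%:R + 1 :> R by rewrite natr1.
  have : 2 ^+ K != 0 :> R by rewrite expf_neq0 // pnatr_eq0.
  by move: (2 ^+ K : R) => x x0; field.
rewrite gerBl divr_ge0 ?exprn_ge0 // mulr_ge0 // !addr_ge0 ?mulr_ge0 ?ler0n // sqr_ge0 //.
Qed.

(** Expanding the square leaves a cross term that sees only the Poisson mean of [bval f], which is
    [f z]. The choice [k = f z] shows that the Poisson mean of the square dominates the square at
    [z]; a [k] near the local averages gives the converse up to a constant. *)
Lemma poisson_sqB f z k : H2 f -> cmod z < 1 ->
  rint 0 T (fun t => poisson z t * cmod (bval f (cis t) - k) ^+ 2) =
  rint 0 T (fun t => poisson z t * cmod (bval f (cis t)) ^+ 2) +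
    T * (cmod (f z - k) ^+ 2 - cmod (f z) ^+ 2).
Proof.
move=> Hf z1; have i1 := bval_cintble 0 T Hf; have i2 := bval_intble2 Hf.
have ik : cintble 0 T (fun t => - k^* * ((poisson z t)%:C * bval f (cis t))).
  by apply: cintbleZ; exact: cintble_poisson.
have ip := intble_poissonM z1 i2; have ip1 := intble_poisson 0 T z1.
have E t : poisson z t * cmod (bval f (cis t) - k) ^+ 2 = poisson z t * cmod (bval f (cis t)) ^+ 2
   + (2 * Re (- k^* * ((poisson z t)%:C * bval f (cis t))) + cmod k ^+ 2 * poisson z t).
  rewrite sqr_cmodD cmodN; set b := bval f _; set p := poisson z t.
  have -> : Re (- k^* * (p%:C * b)) = p * Re (b * (- k)^*).
    by case: (b) => b1 b2; case: (k) => k1 k2 /=; ring.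
  by ring.
rewrite (eq_rint (fun t _ => E t)) rintD //; last first.
  by apply: intbleD; apply: intbleZ => //; case: ik.
congr (_ + _); rewrite rintD; last 2 first.
- by apply: intbleZ; case: ik.
- exact: intbleZ.
rewrite (rintZ _ ip1) (rintZ 2 (proj1 ik)) poisson_one //.
have := cintZ (- k^*) (cintble_poisson z1 i1); rewrite cintE => /(congr1 (@complex.Re R)) /= ->.
rewrite poisson_bval // (sqr_cmodD (f z)) cmodN.
by case: (f z) => b1 b2; case: (k) => k1 k2 /=; ring.
Qed.

Lemma poisson_sq_ge f z : H2 f -> cmod z < 1 ->
  T * cmod (f z) ^+ 2 <= rint 0 T (fun t => poisson z t * cmod (bval f (cis t)) ^+ 2).
Proof.
move=> Hf z1; have := poisson_sqB (f z) Hf z1.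
have : 0 <= rint 0 T (fun t => poisson z t * cmod (bval f (cis t) - f z) ^+ 2).
  by apply: rint_ge0 => t _; rewrite mulr_ge0 ?poisson_ge0 // sqr_ge0.
rewrite subrr cmod0 expr0n /= sub0r mulrN => h E; move: h; rewrite E subr_ge0.
by [].
Qed.

Lemma BMO_osc g : H2 g -> BMO (bval g) -> exists2 M, 0 < M &
  forall a b, a < b -> b <= a + T ->
  rint a b (fun t => cmod (bval g (cis t) - cavg (fun t => bval g (cis t)) a b)) <= M * (b - a).
Proof.
move=> Hg [_ [M hM]]; exists (Num.max M 1); first by rewrite lt_max ltr01 orbT.
move=> a b ab bT; have ba : 0 < b - a by rewrite subr_gt0.
have := hM a b ab bT.
have ii : intble a b (fun t => cmod (bval g (cis t) - cavg (fun t => bval g (cis t)) a b)).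
  by apply: cintble_cmod; apply: cintbleB; [exact: bval_cintble|exact: cintble_cst].
rewrite -[arc_mean _ _ _]/(cavg (fun t => bval g (cis t)) a b) (rint_EFin ii) -EFinM lee_fin.
rewrite ler_pdivrMl // mulrC => h; apply: le_trans h _.
by rewrite ler_pM2r // le_max lexx.
Qed.

Lemma BMO_var g : H2 g -> BMO (bval g) -> exists2 M, 0 < M &
  forall a b, a < b -> b <= a + T ->
  rint a b (fun t => cmod (bval g (cis t) - cavg (fun t => bval g (cis t)) a b)) <= M * (b - a) /\
  rint a b (fun t => cmod (bval g (cis t) - cavg (fun t => bval g (cis t)) a b) ^+ 2) <=
    136 * M ^+ 2 * (b - a).
Proof.
move=> Hg Bg; have [M M0 hM] := BMO_osc Hg Bg; exists M => // a b ab bT.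
split; first exact: hM.
have cg : cont_disk g by apply: hol_cont; case: Hg.
apply: (john_nirenberg_L2 _ _ M0 hM) => //; first exact: cmeas_bval.
  by move=> *; exact: bval_intble2_all.
move=> e e0; have [r0 [r00 r01 hr]] := bval_cvg_L2 Hg e0.
have [i1 i2] := hr r0 (lexx _) r01.
have rp := ltW r00.
have mm : measurable_fun [set: R] (fun t => cmod (bval g (cis t) - g (r0%:C * cis t)) ^+ 2).
  by apply: measurable_sqcmod; apply: cmeas_bvalB => //; exact: cmeas_circle.
have pp t : cmod (bval g (cis (t + T)) - g (r0%:C * cis (t + T))) ^+ 2 =
    cmod (bval g (cis t) - g (r0%:C * cis t)) ^+ 2 by rewrite cis_periodic.
exists (fun t => g (r0%:C * cis t)); split.
- by move=> *; exact: ccont_circle.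
- exact: intble_periodic (@twopi_gt0 R) mm pp i1.
- apply: le_trans i2; rewrite -(rint_periodic (@twopi_gt0 R) mm pp i1 a).
  apply: rint_subset => //; first exact: ltW.
    by move=> t; exact: sqr_ge0.
  exact: intble_periodic (@twopi_gt0 R) mm pp i1 _ _.
Qed.

(** The means over the dyadic arcs around the argument of [z] drift by at most [2 * M] per doubling.
    The mean square deviation from the innermost mean thus grows only like the square of the arc's
    index, which the weights of [poisson_dyadic] sum. *)
Lemma garsia_dev g : H2 g -> BMO (bval g) -> exists2 K, 0 <= K & forall z, cmod z < 1 -> exists k : R[i],
  rint 0 T (fun t => poisson z t * cmod (bval g (cis t) - k) ^+ 2) <= K.
Proof.
move=> Hg Bg; have [M M0 hM] := BMO_var Hg Bg.
have cg : cont_disk g by apply: hol_cont; case: Hg.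
(* The [k]-th arc contributes [272 * M ^+ 2 + 8 * M ^+ 2 * k ^ 2] with weight [2 ^- k]; the two
   weighted sums are at most 2 and 6, and [592 = 272 * 2 + 8 * 6]. *)
exists ((8 * pc) * (592%:R * M ^+ 2)) => [|z z1].
  apply: mulr_ge0; apply: mulr_ge0; [exact: ler0n|exact: pc_ge0|exact: ler0n|exact: sqr_ge0].
have [th zE] := polar z; set r := cmod z in zE z1.
have r0 : 0 <= r by exact: cmod_ge0.
have d0 : 0 < 1 - r by rewrite subr_gt0.
pose u t := bval g (cis t).
have mu_ : cmeas [set: R] u by exact: cmeas_bval.
have iu2 a b : intble a b (fun t => cmod (u t) ^+ 2) by exact: bval_intble2_all.
pose l (k : nat) := darc (1 - r) k.
pose m (k : nat) := cavg u (th - l k) (th + l k).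
have l0 (k : nat) : 0 < l k by exact: darc_gt0.
have lpi (k : nat) : l k <= pi by exact: darc_pi.
have hl (k : nat) : th - l k < th + l k by have := l0 k; lra.
have hlT (k : nat) : th + l k <= th - l k + T by have := lpi k; lra.
have osc a b : a < b -> b <= a + T -> rint a b (fun t => cmod (u t - cavg u a b)) <= M * (b - a).
  by move=> ab bT; have [] := hM a b ab bT.
have mS (k : nat) : cmod (m k.+1 - m k) <= 2 * M.
  rewrite cmodB; have /andP[s1 s2] := darcS k d0.
  by apply: (cavg_sub mu_ iu2 M0 osc) => //; rewrite -/(l k) -/(l k.+1) in s1 s2 *; lra.
have m0 (k : nat) : cmod (m k - m 0%N) <= 2 * M * k%:R.
  elim: k => [|k IH]; first by rewrite subrr cmod0 mulr0.
  apply: le_trans (cmodDB _ _ (m k)) _.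
  have -> : 2 * M * k.+1%:R = 2 * M + 2 * M * k%:R by rewrite [k.+1%:R]mulrSr mulrDr mulr1 addrC.
  exact: lerD.
pose v t := cmod (u t - m 0%N) ^+ 2.
have iv a b : intble a b v by exact: iuB2.
have mv : measurable_fun [set: R] v.
  by apply: measurable_sqcmod; apply: cmeas_bvalB => //; exact: cmeas_cst.
have pv t : v (t + T) = v t by rewrite /v /u bval_periodic.
have v0 t : 0 <= v t by exact: sqr_ge0.
exists (m 0%N).
have [K hK] := half_pow_lt pi d0.
have lK : darc (1 - r) K = pi.
  by apply/min_idPr; rewrite mulrC -ler_pdivrMr ?exprn_gt0 // ltW.
have z1' := circle_lt1 th r0 z1.
have -> : rint 0 T (fun t => poisson z t * cmod (bval g (cis t) - m 0%N) ^+ 2) =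
    rint (th - pi) (th + pi) (fun t => poisson (r%:C * cis th) t * v t).
  have -> : th + pi = th - pi + T by ring.
  rewrite -zE rint_periodic //; first exact: twopi_gt0.
  - by apply: measurable_funM => //; apply: measurable_poisson.
  - by move=> t; rewrite poisson_periodic pv.
  - exact: intble_poissonM.
rewrite -lK; apply: le_trans (poisson_dyadic th K v0 iv r0 z1) _.
apply: ler_wpM2l; first by rewrite mulr_ge0 // pc_ge0.
have M2 : 0 <= M ^+ 2 by exact: sqr_ge0.
have hav (k : nat) : avg v th (l k) <= 272 * M ^+ 2 + 8 * M ^+ 2 * k%:R ^+ 2.
  have l2 : 0 < 2 * l k by rewrite mulr_gt0.
  rewrite /avg ler_pdivrMl //.
  have [_ hV] := hM _ _ (hl k) (hlT k); rewrite -/(m k) in hV.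
  have : rint (th - l k) (th + l k) v <= rint (th - l k) (th + l k)
      (fun t => 2 * cmod (u t - m k) ^+ 2 + 2 * (2 * M * k%:R) ^+ 2).
    apply: le_rint => //; first by apply: intbleD; [apply: intbleZ; exact: iuB2|exact: intble_cst].
    move=> t _; rewrite /v; have -> : u t - m 0%N = (u t - m k) + (m k - m 0%N) by ring.
    apply: le_trans (sqr_cmodD_le _ _) _; apply: lerD => //; rewrite ler_pM2l //.
    by apply: lerXn2r; rewrite ?nnegrE ?cmod_ge0 // !mulr_ge0 ?ler0n // ltW.
  have iV := iuB2 mu_ iu2 (th - l k) (th + l k) (m k).
  rewrite (rintD (intbleZ _ iV) (intble_cst _ _ _)) (rintZ _ iV) rint_cst ?(ltW (hl k)) //.
  have -> : th + l k - (th - l k) = 2 * l k by ring.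
  move: hV; have -> : th + l k - (th - l k) = 2 * l k by ring.
  rewrite -/(u _) => hV h; apply: le_trans h _.
  have -> : 2 * l k * (272 * M ^+ 2 + 8 * M ^+ 2 * k%:R ^+ 2) =
     2 * (136 * M ^+ 2 * (2 * l k)) + 2 * (2 * M * k%:R) ^+ 2 * (2 * l k) by ring.
  by apply: lerD => //; rewrite ler_pM2l.
apply: (@le_trans _ _ (\sum_(k < K.+1) (272 * M ^+ 2 * 2^-1 ^+ k + 8 * M ^+ 2 * (k%:R ^+ 2 / 2 ^+ k)))).
  apply: ler_sum => k _; rewrite exprVn.
  have -> : 272 * M ^+ 2 * (2 ^+ k)^-1 + 8 * M ^+ 2 * (k%:R ^+ 2 / 2 ^+ k) =
     (272 * M ^+ 2 + 8 * M ^+ 2 * k%:R ^+ 2) / 2 ^+ k by ring.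
  by apply: ler_wpM2r; [rewrite invr_ge0 exprn_ge0|exact: hav].
rewrite big_split /= -!mulr_sumr.
have h1 : \sum_(k < K.+1) (2^-1 : R) ^+ k <= 2.
  apply: le_trans (sum_geom_le _ _) _; first by apply/andP; split; lra.
  by have -> : (1 - 2^-1 : R)^-1 = 2 by field.
have h2 := sum_sq_half K.+1.
have := ler_wpM2l M2 h1; have := ler_wpM2l M2 h2.
by set S1 := \sum_(_ < _) _; set S2 := \sum_(_ < _) _; lra.
Qed.

(** The unknown constant [k] disappears: by [poisson_sqB] it enters only through the term
    [T * cmod (g z - k) ^+ 2], which has a favourable sign. *)
Theorem garsia g : H2 g -> BMO (bval g) -> exists2 K, 0 <= K & forall z, cmod z < 1 ->
  rint 0 T (fun t => poisson z t * cmod (bval g (cis t)) ^+ 2) <= T * cmod (g z) ^+ 2 + K.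
Proof.
move=> Hg Bg; have [K K0 hK] := garsia_dev Hg Bg; exists K => // z z1.
have [k hk] := hK z z1; move: hk; rewrite poisson_sqB // => h.
have : 0 <= T * cmod (g z - k) ^+ 2 by rewrite mulr_ge0 ?sqr_ge0 // T_ge0.
by move: h; rewrite mulrBr; set I := rint _ _ _; set A := T * _; set B := T * _; lra.
Qed.

End garsia.

(** * Boundedness of the Volterra operator *)

Section volterra.
Context {R : realType}.
Implicit Types (f g : R[i] -> R[i]) (z w : R[i]) (a b r s t x e : R).
Local Notation T := (2 * pi : R).

Definition expsum n x : R := \sum_(j < n) x ^+ j / j`!%:R.

Lemma expsumS n x : expsum n.+1 x = expsum n x + x ^+ n / n`!%:R.
Proof. by rewrite /expsum big_ord_recr. Qed.

Lemma expsum_term n x : 0 <= x -> 0 <= x ^+ n / n`!%:R.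
Proof. by move=> x0; rewrite mulr_ge0 ?invr_ge0 ?exprn_ge0. Qed.

Lemma expsum_ge0 n x : 0 <= x -> 0 <= expsum n x.
Proof. by move=> x0; apply: sumr_ge0 => j _; exact: expsum_term. Qed.

Lemma expsum_cvg x e : 0 < e -> exists N, forall n, (N <= n)%N -> `|expR x - expsum n x| <= e.
Proof.
move=> e0; have h : series (exp_coeff x) @ \oo --> expR x := @is_cvg_series_exp_coeff R x.
move/cvgrPdist_le: h => /(_ e e0) [N _ hN].
by exists N => n Nn; have := hN n Nn; rewrite /series /= big_mkord.
Qed.

Lemma expsum_diff n m x y : 0 <= x -> x <= y -> (n <= m)%N ->
  0 <= expsum m x - expsum n x <= expsum m y - expsum n y.
Proof.
move=> x0 xy; elim: m => [|m IH]; first by rewrite leqn0 => /eqP ->; rewrite !subrr lexx.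
rewrite leq_eqVlt => /predU1P[->|]; first by rewrite !subrr lexx.
rewrite ltnS => /IH /andP[h1 h2]; rewrite !expsumS.
have h3 := expsum_term m x0.
have h4 : x ^+ m / m`!%:R <= y ^+ m / m`!%:R.
  by rewrite ler_wpM2r ?invr_ge0 // lerXn2r ?nnegrE // (le_trans x0).
by apply/andP; split; lra.
Qed.

(** The remainders have nonnegative increasing terms, so the remainder at the largest argument
    controls the truncation error uniformly below it. *)
Lemma expsum_tail n x y : 0 <= x -> x <= y -> 0 <= expR x - expsum n x <= expR y - expsum n y.
Proof.
move=> x0 xy; have key e : 0 < e -> - e <= expR x - expsum n x /\
    expR x - expsum n x <= expR y - expsum n y + e.
  move=> e0; have e2 : 0 < e / 2 by rewrite divr_gt0.
  have [N1 h1] := expsum_cvg x e2; have [N2 h2] := expsum_cvg y e2.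
  pose m := maxn n (maxn N1 N2).
  have nm : (n <= m)%N by rewrite leq_max leqnn.
  have := h1 m; have := h2 m; rewrite !leq_max !leqnn !orbT => /(_ isT) k2 /(_ isT) k1.
  have /andP[k3 k4] := expsum_diff x0 xy nm.
  move: k1 k2; rewrite !ler_norml => /andP[? ?] /andP[? ?].
  by split; lra.
apply/andP; split; apply: le_lim => e /key [h1 h2]; lra.
Qed.

(* With x = g, p = g' F and q = F', the j-th term is |G_j'|^2 for
   G_j = g^j F / sqrt (j!). *)
Lemma gauss_sum (x p q : R[i]) n :
  \sum_(j < n.+2) (j`!%:R)^-1 * cmod (j%:R * x ^+ j.-1 * p + x ^+ j * q) ^+ 2 =
  (expsum n.+1 (cmod x ^+ 2) + cmod x ^+ 2 * expsum n (cmod x ^+ 2)) * cmod p ^+ 2 +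
  2 * expsum n.+1 (cmod x ^+ 2) * Re (p * (x * q)^*) + expsum n.+2 (cmod x ^+ 2) * cmod q ^+ 2.
Proof.
set X := cmod x ^+ 2; set c := Re _.
have term i : cmod (i.+1%:R * x ^+ i * p + x ^+ i.+1 * q) ^+ 2 =
    i.+1%:R ^+ 2 * X ^+ i * cmod p ^+ 2 + 2 * i.+1%:R * X ^+ i * c + X ^+ i.+1 * cmod q ^+ 2.
  have -> : i.+1%:R * x ^+ i * p + x ^+ i.+1 * q = x ^+ i * (i.+1%:R * p + x * q) by rewrite exprS; ring.
  rewrite cmodM cmodX exprMn exprAC -/X (sqr_cmodD (i.+1%:R * p)) !cmodM cmod_ge_natr !exprMn -/X.
  have -> : Re (i.+1%:R * p * (x * q)^*) = i.+1%:R * c.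
    have -> : (i.+1%:R : R[i]) = (i.+1%:R : R)%:C by rewrite rmorph_nat.
    by rewrite -mulrA ReM /= mul0r subr0.
  by rewrite (exprS (cmod x) i) /X; ring.
elim: n => [|n IH].
  rewrite big_ord_recr big_ord_recr big_ord0 [LHS]/= (term 0%N) !expsumS /expsum !big_ord0.
  rewrite !mul0r add0r expr0 mul1r fact0 factS fact0 expr1 add0r mul1n !expr0 invr1; ring.
rewrite big_ord_recr IH [LHS]/= (term n.+1) !expsumS.
have f0 : n`!%:R != 0 :> R by rewrite pnatr_eq0 -lt0n fact_gt0.
have n2 : n.+2%:R != 0 :> R by rewrite pnatr_eq0.
have n1 : n.+1%:R != 0 :> R by rewrite pnatr_eq0.
rewrite (factS n.+1) (factS n) !natrM (exprS X n.+1) (exprS X n).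
have E : n.+2%:R = n.+1%:R + 1 :> R by rewrite natr1.
rewrite E in n2 *; move: (n.+1%:R : R) (n`!%:R : R) n1 n2 f0 => N F n1 n2 f0.
by field; rewrite n1 n2 f0.
Qed.

(** Without truncation the sum is [exp (|x|^2)] times [|p|^2 + |q + conj(x) p|^2], and the second
    square is dropped. After truncation, the coefficient of [|x|^2 |p|^2] falls short of the one
    that completes the square by the last exponential term; this is the subtracted correction. *)
Lemma gauss_sum_ge (x p q : R[i]) n :
  (expsum n.+1 (cmod x ^+ 2) - cmod x ^+ 2 * ((cmod x ^+ 2) ^+ n / n`!%:R)) * cmod p ^+ 2 <=
  \sum_(j < n.+2) (j`!%:R)^-1 * cmod (j%:R * x ^+ j.-1 * p + x ^+ j * q) ^+ 2.
Proof.
rewrite gauss_sum (expsumS n.+1); set X := cmod x ^+ 2.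
have X0 : 0 <= X by exact: sqr_ge0.
have A0 := expsum_ge0 n.+1 X0; have B0 := expsum_term n.+1 X0.
have E : X ^+ n / n`!%:R = expsum n.+1 X - expsum n X by rewrite expsumS addrC addKr.
rewrite E; set A := expsum n.+1 X in A0 *; set D := expsum n X; set B := _ / _ in B0 *.
have hc : - (cmod x * cmod p * cmod q) <= Re (p * (x * q)^*).
  have := Re_le_cmod (p * (x * q)^*); rewrite cmodM cmodJ cmodM ler_norml => /andP[h _].
  by apply: le_trans h; rewrite lerN2 le_eqVlt; apply/orP; left; apply/eqP; ring.
have h1 := ler_wpM2l A0 hc.
have h2 : 0 <= A * (cmod x * cmod p - cmod q) ^+ 2 by rewrite mulr_ge0 ?sqr_ge0.
have h3 : 0 <= B * cmod q ^+ 2 by rewrite mulr_ge0 ?sqr_ge0.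
move: h1 h2 h3; rewrite sqrrB /X exprMn; set c := Re _; set px := cmod x; set P := cmod p; set Q := cmod q.
move=> h1 h2 h3; rewrite -subr_ge0.
have -> : (A + px ^+ 2 * D) * P ^+ 2 + 2 * A * c + (A + B) * Q ^+ 2 - (A - px ^+ 2 * (A - D)) * P ^+ 2 =
  A * (px ^+ 2 * P ^+ 2 - px * P * Q *+ 2 + Q ^+ 2) + B * Q ^+ 2 + 2 * (A * c - A * - (px * P * Q)).
  by ring.
by rewrite !addr_ge0 // mulr_ge0 // subr_ge0.
Qed.

Lemma m2_sum (h : nat -> R[i] -> R[i]) J r : (forall j, cont_disk (h j)) -> 0 <= r -> r < 1 ->
  intble 0 T (fun t => \sum_(j < J) cmod (h j (r%:C * cis t)) ^+ 2) /\
  \sum_(j < J) m2 (h j) r = T^-1 * rint 0 T (fun t => \sum_(j < J) cmod (h j (r%:C * cis t)) ^+ 2).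
Proof.
move=> ch r0 r1; elim: J => [|J [i1 IH]].
  split; first by apply: eq_intble (intble_cst _ _ 0) => t _; rewrite big_ord0.
  rewrite big_ord0 (eq_rint (v := fun=> 0)); last by move=> t _; rewrite big_ord0.
  by rewrite rint_cst ?T_ge0 // mul0r mulr0.
have i2 := intble_circle2 0 T (ch J) r0 r1; split.
  by apply: eq_intble (intbleD i1 i2) => t _; rewrite big_ord_recr.
rewrite big_ord_recr [LHS]/= IH /m2 -mulrDr -rintD //; congr (_ * _).
by apply: eq_rint => t _; rewrite big_ord_recr.
Qed.

Lemma cdiffX f z d n : cdiff f z d -> cdiff (fun w => f w ^+ n) z (n%:R * f z ^+ n.-1 * d).
Proof.
move=> fd; elim: n => [|n IH].
  rewrite mul0r mul0r; apply: (cdiff_ext ltr01 _ (cdiff_cst 1 z)) => w _.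
  by rewrite expr0.
have := cdiffM fd IH; have -> : d * f z ^+ n + f z * (n%:R * f z ^+ n.-1 * d) =
    n.+1%:R * f z ^+ n.+1.-1 * d.
  case: n {IH} => [|n]; first by rewrite expr0; ring.
  by rewrite /= -[n.+2%:R]natr1 exprS; ring.
by apply: (cdiff_ext ltr01) => w _; rewrite exprS.
Qed.

Lemma holM f g : holomorphic_disk f -> holomorphic_disk g -> holomorphic_disk (fun z => f z * g z).
Proof.
move=> hf hg; apply: cdiff_hol => z z1; eexists.
apply: cdiffM; exact: hol_cdiff.
Qed.

(** The holomorphic completion of the Poisson integral of [v], which is its real part. *)
Definition herglotz_int (v : R -> R) z : R[i] :=
  (T^-1)%:C * cint 0 T (fun t => herglotz z t * (v t)%:C).

Lemma cintbleR (v : R -> R) a b : intble a b v -> cintble a b (fun t => (v t)%:C).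
Proof.
move=> iv; split; first by apply: eq_intble iv.
by apply: eq_intble (intble_cst a b 0).
Qed.

Lemma Re_herglotz_int (v : R -> R) z : Re (herglotz_int v z) = T^-1 * rint 0 T (fun t => poisson z t * v t).
Proof.
rewrite /herglotz_int ReM /= mul0r subr0; congr (_ * _).
by apply: eq_rint => t _; rewrite ReM /= mulr0 subr0.
Qed.

Lemma fc_le (v : R -> R[i]) k : cintble 0 T v -> cmod (fc v k) <= rint 0 T (fun t => cmod (v t)).
Proof.
move=> iv; apply: le_trans (cint_le (cintble_fc k iv)) _.
rewrite (eq_rint (v := fun t => cmod (v t))) // => t _.
by rewrite cmodM cmod_cis mulr1.
Qed.

Lemma hol_herglotz_int (v : R -> R) : intble 0 T v -> holomorphic_disk (herglotz_int v).
Proof.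
move=> iv; have ic := cintbleR iv; pose V t : R[i] := (v t)%:C.
set I := rint 0 T (fun t => cmod (V t)).
have I0 : 0 <= I by apply: rint_ge0 => t _; exact: cmod_ge0.
have hfc k : cmod (fc V k) <= I by exact: fc_le.
have T0 := @twopi_gt0 R; have iT0 : 0 < T^-1 by rewrite invr_gt0.
pose a n : R[i] := if n is k.+1 then (T^-1)%:C * (2%:R * fc V (- k.+1%:R)) else (T^-1)%:C * fc V 0.
apply: (@psr_hol _ a) => r /andP[r0 r1].
pose B := T^-1 * (2 / (1 - r)) * I.
have r10 : 0 < 1 - r by rewrite subr_gt0.
have B0 : 0 <= B by rewrite !mulr_ge0 // ?invr_ge0 ltW.
have TI0 : 0 <= T^-1 * I by rewrite mulr_ge0 // ltW.
have B2 : T^-1 * (2 * I) <= B.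
  rewrite /B -mulrA; apply: ler_wpM2l; first exact: ltW.
  apply: ler_wpM2r => //; rewrite ler_pdivlMr //; lra.
exists B, r; split => //; first by rewrite r0.
  move=> n; apply: ler_wpM2r; first exact: exprn_ge0.
  apply: le_trans B2; case: n => [|k]; rewrite /a !cmodM cmodR gtr0_norm //;
    apply: ler_wpM2l; rewrite ?(ltW iT0) //.
    by apply: le_trans (hfc 0) _; lra.
  rewrite cmod_ge_natr; apply: ler_wpM2l => //; exact: hfc.
move=> z N zr; have z1 : cmod z < 1 by apply: le_lt_trans r1.
have zz : 0 < 1 - cmod z by rewrite subr_gt0.
have izr : (1 - cmod z)^-1 <= (1 - r)^-1 by rewrite lef_pV2 ?posrE // lerB.
case: N => [|N].
  rewrite /psum big_ord0 subr0 expr0 mulr1 /herglotz_int cmodM cmodR gtr0_norm // /B -mulrA.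
  apply: ler_wpM2l; first exact: ltW.
  apply: le_trans (cint_le (cintble_herglotz z1 ic)) _.
  rewrite -rintZ; last exact: cintble_cmod.
  apply: le_rint; first by apply: cintble_cmod; exact: cintble_herglotz.
    by apply: intbleZ; exact: cintble_cmod.
  move=> t _; rewrite cmodM; apply: ler_wpM2r; first exact: cmod_ge0.
  by apply: le_trans (herglotz_le t z1) _; apply: ler_wpM2l.
have -> : psum a N.+1 z = (T^-1)%:C * (fc V 0 + 2%:R * \sum_(k < N) z ^+ k.+1 * fc V (- k.+1%:R)).
  rewrite /psum big_ord_recl expr0 mulr1 mulrDr !mulr_sumr; congr (_ + _).
  by apply: eq_bigr => k _; rewrite /a lift0; ring.
rewrite /herglotz_int -mulrBr cmodM cmodR gtr0_norm // /B -!mulrA.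
apply: ler_wpM2l; first exact: ltW.
apply: le_trans (herglotz_series N ic z1) _.
have -> : 2 * ((1 - r)^-1 * (I * r ^+ N.+1)) = 2 * r ^+ N.+1 * (1 - r)^-1 * I by ring.
apply: ler_wpM2r => //; apply: ler_pM => //.
- by rewrite mulr_ge0 // exprn_ge0 // cmod_ge0.
- by rewrite invr_ge0 ltW.
- by apply: ler_wpM2l => //; apply: lerXn2r; rewrite ?nnegrE ?cmod_ge0.
Qed.

Lemma volterra_m2 g K f rho : H2 g -> 0 <= K -> (forall z, cmod z < 1 ->
  rint 0 T (fun t => poisson z t * cmod (bval g (cis t)) ^+ 2) <= T * cmod (g z) ^+ 2 + K) ->
  holomorphic_disk f -> 0 <= rho -> rho < 1 ->
  m2 (Vop g f) rho <= 4 * expR (K / T) * m2 f rho.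
Proof.
move=> Hg K0 hK hf rho0 rho1; have hg := proj1 Hg; have T0 := @twopi_gt0 R.
pose U := herglotz_int (fun t => cmod (bval g (cis t)) ^+ 2).
have hU : holomorphic_disk U by apply: hol_herglotz_int; exact: bval_intble2.
have U1 z : cmod z < 1 -> cmod (g z) ^+ 2 <= Re (U z).
  move=> z1; rewrite Re_herglotz_int; have := poisson_sq_ge Hg z1.
  by rewrite mulrC -ler_pdivlMr // mulrC.
have U2 z : cmod z < 1 -> Re (U z) <= cmod (g z) ^+ 2 + K / T.
  move=> z1; rewrite Re_herglotz_int ler_pdivrMl // (mulrDr T) (mulrC T (K / T)) divfK ?gt_eqF //.
  exact: hK.
pose F z := cexp ((- 2^-1 : R)%:C * U z) * f z.
have hF : holomorphic_disk F.
  apply: (holM _ hf); apply: cdiff_hol => z z1; eexists.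
  apply: cdiff_comp; last exact: cdiff_cexp.
  by apply: cdiffM; [exact: cdiff_cst|exact: hol_cdiff].
have F2 z : cmod (F z) ^+ 2 = expR (- Re (U z)) * cmod (f z) ^+ 2.
  rewrite /F cmodM exprMn cmod_cexp; congr (_ * _); rewrite -expRM_natl.
  by congr expR; rewrite ReM [Im _]/= [Re (_%:C)]/= mul0r subr0; move: (Re (U z)) => y; lra.
pose cf (j : nat) : R := Num.sqrt (j`!%:R)^-1.
have cf2 j : cf j ^+ 2 = (j`!%:R)^-1 by rewrite sqr_sqrtr // invr_ge0.
pose G j z := (cf j)%:C * (g z ^+ j * F z).
have dG j z : cmod z < 1 -> cdiff (G j) z
    ((cf j)%:C * (j%:R * g z ^+ j.-1 * cderiv g z * F z + g z ^+ j * cderiv F z)).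
  move=> z1; have := cdiffM (cdiff_cst (cf j)%:C z) (cdiffM (cdiffX j (hol_cdiff hg z1)) (hol_cdiff hF z1)).
  by rewrite mul0r add0r.
have hG j : holomorphic_disk (G j) by apply: cdiff_hol => z z1; eexists; exact: dG.
pose k z := f z * cderiv g z.
have hk : holomorphic_disk k by apply: (holM hf); exact: hol_deriv.
have [Bg Bg0 hBg] := cont_disk_bounded (hol_cont hg) rho1.
pose B := Bg ^+ 2; have B0 : 0 <= B by exact: sqr_ge0.
(* Only half of [expR (- (K / T))] is kept; the other half pays for truncating the exponential
   series. *)
pose c := expR (- (K / T)) / 2.
have c0 : 0 < c by rewrite divr_gt0 // expR_gt0.
have cB : 0 < c / (1 + B) by rewrite divr_gt0 // ltr_pwDl.
(* The factor [1 + B] covers both truncation errors, the tail and [X <= B] times the last term. The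
   level [n] depends on [rho] through [B], but the resulting constant does not. *)
have [n hn] := expsum_cvg B cB; have := hn n (leqnn n).
have /andP[tB0 _] := expsum_tail n B0 (lexx B).
rewrite ger0_norm // => tB.
have low z : cmod z <= rho -> c * cmod (k z) ^+ 2 <= \sum_(j < n.+2) cmod (cderiv (G j) z) ^+ 2.
  move=> zr; have z1 := le_lt_trans zr rho1; set X := cmod (g z) ^+ 2.
  have X0 : 0 <= X by exact: sqr_ge0.
  have XB : X <= B by apply: lerXn2r; rewrite ?nnegrE ?cmod_ge0 // hBg.
  have -> : \sum_(j < n.+2) cmod (cderiv (G j) z) ^+ 2 = \sum_(j < n.+2)
     (j`!%:R)^-1 * cmod (j%:R * g z ^+ j.-1 * (cderiv g z * F z) + g z ^+ j * cderiv F z) ^+ 2.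
    apply: eq_bigr => j _; have [_ ->] := cdiff_cderiv (dG j z z1).
    by rewrite cmodM exprMn cmodR real_normK ?num_real // cf2 mulrA.
  apply: le_trans (gauss_sum_ge _ _ _ n); rewrite -/X.
  have -> : cmod (cderiv g z * F z) ^+ 2 = expR (- Re (U z)) * cmod (k z) ^+ 2.
    by rewrite /k (cmodM (cderiv g z)) (cmodM (f z)) exprMn F2 exprMn; ring.
  rewrite mulrA; apply: ler_wpM2r; first exact: sqr_ge0.
  have /andP[t0 t1] := expsum_tail n X0 XB.
  have E1 : X ^+ n / n`!%:R = expsum n.+1 X - expsum n X by rewrite expsumS addrC addKr.
  have E2 : expsum n.+1 X <= expR X.
    by have /andP[h _] := expsum_tail n.+1 X0 (lexx X); rewrite -subr_ge0.
  have E3 : 0 <= X ^+ n / n`!%:R by exact: expsum_term.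
  have h1 : expR X - c <= expsum n.+1 X - X * (X ^+ n / n`!%:R).
    have h2 : X * (X ^+ n / n`!%:R) <= B * (expR B - expsum n B).
      by apply: ler_pM => //; rewrite E1; lra.
    have h3 : (1 + B) * (expR B - expsum n B) <= c.
      by rewrite mulrC -ler_pdivlMr // ltr_pwDl.
    by move: h3; rewrite mulrDl mul1r; lra.
  apply: (@le_trans _ _ ((expR X - c) * expR (- Re (U z)))); last first.
    by apply: ler_wpM2r => //; exact: expR_ge0.
  rewrite mulrBl -expRD.
  have h2 : 2 * c <= expR (X - Re (U z)).
    by rewrite /c mulrC divfK // ler_expR; have := U2 z z1; rewrite -/X; lra.
  have h3 : c * expR (- Re (U z)) <= c.
    apply: ler_piMr; first exact: ltW.
    by rewrite -expR0 ler_expR; have := U1 z z1; rewrite -/X; lra.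
  by lra.
have up z : cmod z < 1 -> \sum_(j < n.+2) cmod (G j z) ^+ 2 <= cmod (f z) ^+ 2.
  move=> z1; set X := cmod (g z) ^+ 2; have X0 : 0 <= X by exact: sqr_ge0.
  have -> : \sum_(j < n.+2) cmod (G j z) ^+ 2 = expsum n.+2 X * expR (- Re (U z)) * cmod (f z) ^+ 2.
    rewrite -mulrA -F2 /expsum mulr_suml; apply: eq_bigr => j _.
    rewrite /G cmodM (cmodM (_ ^+ _)) cmodX cmodR exprMn real_normK ?num_real // cf2 exprMn.
    by have -> : (cmod (g z) ^+ j) ^+ 2 = X ^+ j; [rewrite exprAC|ring].
  apply: ler_piMl; first exact: sqr_ge0.
  apply: (@le_trans _ _ (expR X * expR (- Re (U z)))).
    apply: ler_wpM2r; first exact: expR_ge0.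
    by have /andP[h _] := expsum_tail n.+2 X0 (lexx X); rewrite -subr_ge0.
  by rewrite -expRD -expR0 ler_expR; have := U1 z z1; rewrite -/X; lra.
have cG j : cont_disk (G j) by exact: (hol_cont (hG j)).
have cdG j : cont_disk (cderiv (G j)) by exact: (hol_cont (hol_deriv (hG j))).
have lp : c * m2 (segment_integral k) rho <= 2 * (\sum_(j < n.+2) m2 (G j) rho) + 4 * 0.
  apply: (littlewood_paley hk hG rho0 rho1 (ltW c0) (lexx 0)) => s /andP[s0 sr]; have s1 := le_lt_trans sr rho1; rewrite addr0.
  have [i1 ->] := m2_sum n.+2 cdG s0 s1; rewrite /m2 mulrCA.
  apply: ler_wpM2l; first by rewrite invr_ge0 T_ge0.
  have ik := intble_circle2 0 T (hol_cont hk) s0 s1.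
  rewrite -(rintZ _ ik); apply: le_rint => //; first exact: intbleZ.
  by move=> t _; apply: low; rewrite cmod_circle.
have h : \sum_(j < n.+2) m2 (G j) rho <= m2 f rho.
  have [i1 ->] := m2_sum n.+2 cG rho0 rho1; rewrite /m2.
  apply: ler_wpM2l; first by rewrite invr_ge0 T_ge0.
  apply: le_rint => //; first exact: intble_circle2 (hol_cont hf) _ _.
  by move=> t _; apply: up; rewrite cmod_circle.
rewrite -(ler_pM2l c0); apply: le_trans lp _.
have -> : c * (4 * expR (K / T) * m2 f rho) = 2 * m2 f rho.
  rewrite /c expRN; field; rewrite gt_eqF ?expR_gt0 //.
by rewrite mulr0 addr0 ler_pM2l.
Qed.

End volterra.

(** * Shifted operators *)

Section operators.
Context {R : realType}.
Implicit Types (f g h : R[i] -> R[i]) (z w : R[i]) (a b c p q : nat -> R[i]) (r s t e : R).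
Local Notation T := (2 * pi : R).

Lemma psr0 a f : psr a f -> f 0 = a 0%N.
Proof.
move=> af; have [B [x [B0 x01 _ hf]]] := af 0 (introT andP (conj (lexx 0) ltr01)).
apply: cdisk_eq0 => e e0; apply: le_trans (ltW e0).
apply: (@le_lim_pow _ _ _ (B * x) _ x01) => N; rewrite add0r.
have := hf 0 N.+1; rewrite cmod0 => /(_ (lexx 0)); rewrite exprS mulrA => h.
apply: le_trans h; rewrite /psum big_ord_recl expr0 mulr1 big1 ?addr0 // => i _.
by rewrite lift0 expr0n mulr0.
Qed.

Lemma psrD a b f g : psr a f -> psr b g -> psr (fun n => a n + b n) (fun z => f z + g z).
Proof.
move=> af bg r r01; have /andP[r0 _] := r01.
have [B [x [B0 /andP[x0 x1] h1 h2]]] := af r r01; have [C [y [C0 /andP[y0 y1] k1 k2]]] := bg r r01.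
pose u := Num.max x y.
have xu n : x ^+ n <= u ^+ n by apply: lerXn2r; rewrite ?nnegrE // ?le_max ?lexx // x0.
have yu n : y ^+ n <= u ^+ n by apply: lerXn2r; rewrite ?nnegrE // ?le_max ?lexx ?orbT // x0.
have hB n : B * x ^+ n + C * y ^+ n <= (B + C) * u ^+ n.
  by rewrite mulrDl; apply: lerD; apply: ler_wpM2l.
exists (B + C), u; split => [||n|z N zr].
- exact: addr_ge0.
- by rewrite le_max x0 gt_max x1.
- apply: le_trans (hB n); apply: le_trans (lerD (h1 n) (k1 n)).
  by rewrite -mulrDl; apply: ler_wpM2r; [exact: exprn_ge0|exact: cmodD].
- apply: le_trans (hB N); apply: le_trans (lerD (h2 z N zr) (k2 z N zr)).
  have -> : psum (fun n => a n + b n) N z = psum a N z + psum b N z.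
    by rewrite /psum -big_split; apply: eq_bigr => i _; rewrite mulrDl.
  have -> : f z + g z - (psum a N z + psum b N z) = (f z - psum a N z) + (g z - psum b N z) by ring.
  exact: cmodD.
Qed.

Lemma psrZ a f (k : R[i]) : psr a f -> psr (fun n => k * a n) (fun z => k * f z).
Proof.
move=> af r r01; have [B [x [B0 x01 h1 h2]]] := af r r01.
exists (cmod k * B), x; split => [||n|z N zr] //; first by rewrite mulr_ge0 ?cmod_ge0.
  by rewrite cmodM -!mulrA; apply: ler_wpM2l; [exact: cmod_ge0|exact: h1].
have -> : psum (fun n => k * a n) N z = k * psum a N z.
  by rewrite /psum mulr_sumr; apply: eq_bigr => i _; rewrite mulrA.
by rewrite -mulrBr cmodM -mulrA; apply: ler_wpM2l; [exact: cmod_ge0|exact: h2].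
Qed.

Definition mulz_coef a n : R[i] := if n is k.+1 then a k else 0.

Lemma psr_mulz a f : psr a f -> psr (mulz_coef a) (fun z => z * f z).
Proof.
move=> af r r01; have /andP[r0 r1] := r01; have [B [x [B0 /andP[x0 x1] h1 h2]]] := af r r01.
pose u := Num.max x 2^-1.
have u0 : 2^-1 <= u by rewrite le_max lexx orbT.
have up : 0 <= u by apply: le_trans u0; rewrite invr_ge0.
have xu n : B * x ^+ n <= 2 * B * u ^+ n.+1.
  have h : x ^+ n <= u ^+ n by apply: lerXn2r; rewrite ?nnegrE // le_max lexx.
  apply: (@le_trans _ _ (B * u ^+ n)); first exact: ler_wpM2l.
  have -> : 2 * B * u ^+ n.+1 = B * u ^+ n * (2 * u) by rewrite exprS; ring.
  apply: ler_peMr; first by rewrite mulr_ge0 // exprn_ge0.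
  by lra.
have rr y (n : nat) : 0 <= y -> r * y <= y by move=> y0; apply: ler_piMl => //; exact: ltW.
exists (2 * B), u; split.
- exact: mulr_ge0.
- rewrite up /= gt_max x1 invf_lt1 ?ltr1n //.
- case=> [|n].
    rewrite /mulz_coef cmod0 mul0r; apply: mulr_ge0; first exact: mulr_ge0.
    exact: exprn_ge0.
  apply: le_trans (xu n); apply: le_trans (h1 n); rewrite exprS mulrCA; apply: (rr _ n).
  by rewrite mulr_ge0 ?cmod_ge0 // exprn_ge0.
- move=> z [|N] zr.
    rewrite /psum big_ord0 subr0 expr0 mulr1 cmodM.
    have := h2 z 0%N zr; rewrite /psum big_ord0 subr0 expr0 mulr1 => h.
    apply: (@le_trans _ _ (1 * B)); last by lra.
    by apply: ler_pM => //; rewrite ?cmod_ge0 // (le_trans zr) // ltW.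
  apply: le_trans (xu N); apply: le_trans (h2 z N zr).
  have -> : z * f z - psum (mulz_coef a) N.+1 z = z * (f z - psum a N z).
    rewrite /psum big_ord_recl [mulz_coef _ _]/= mul0r add0r mulrBr mulr_sumr; congr (_ - _).
    by apply: eq_bigr => i _; rewrite lift0 [mulz_coef _ _]/= exprS; ring.
  rewrite cmodM; apply: ler_piMl; first exact: cmod_ge0.
  by apply: le_trans zr _; exact: ltW.
Qed.

Lemma psr_backward_shift a f : psr a f -> psr (fun n => a n.+1) (backward_shift f).
Proof.
move=> af; have f0 := psr0 af; have f'0 := psr0 (psr_deriv af).
have key r : 0 < r -> r < 1 -> exists B x, [/\ 0 <= B, 0 <= x < 1,
    forall n, cmod (a n.+1) * r ^+ n <= B * x ^+ n &
    forall z N, cmod z <= r -> cmod (backward_shift f z - psum (fun n => a n.+1) N z) <= B * x ^+ N].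
  move=> r0 r1; have r01 : 0 <= r < 1 by rewrite (ltW r0).
  have [B [x [B0 /andP[x0 x1] h1 h2]]] := af r r01.
  have x01 : 0 <= x < 1 by rewrite x0.
  pose C := B / r; have C0 : 0 <= C by rewrite divr_ge0 // ltW.
  have hC n : cmod (a n.+1) * r ^+ n <= C * x ^+ n.
    rewrite /C mulrAC ler_pdivlMr // -mulrA -exprSr; apply: le_trans (h1 n.+1) _.
    apply: ler_wpM2l => //; rewrite exprS; apply: ler_piMl; first exact: exprn_ge0.
    exact: ltW.
  have X0 : 0 < 1 - x by rewrite subr_gt0.
  exists (2 * (C / (1 - x))), x; split => //.
  - by rewrite mulr_ge0 // divr_ge0 // ltW.
  - move=> n; apply: le_trans (hC n) _; apply: ler_wpM2r; first exact: exprn_ge0.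
    apply: (@le_trans _ _ (C / (1 - x))).
      by rewrite ler_pdivlMr //; apply: ler_piMr => //; lra.
    by rewrite ler_peMl ?ler1n // divr_ge0 // ltW.
  move=> z N zr; have [l hl] := psum_lim (ltW r0) C0 x01 hC zr.
  suff -> : backward_shift f z = l by exact: hl.
  (* The value assigned at 0 must be the constant term of the shifted series, that is the
     coefficient [a 1]; elsewhere division by [z] is undone. *)
  rewrite /backward_shift; case: eqVneq => [z0|z0].
    rewrite f'0 /dcoef mul1r; apply/esym/cdisk_eq0 => e e0.
    apply: le_trans (ltW e0); apply: (@le_lim_pow _ _ _ (2 * (C / (1 - x)) * x) _ x01) => M; rewrite add0r.
    have := hl M.+1; rewrite z0 /psum big_ord_recl expr0 mulr1 big1 ?addr0.
      by rewrite exprS mulrA.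
    by move=> i _; rewrite lift0 expr0n mulr0.
  suff E : f z - f 0 = l * z by rewrite E mulfK.
  apply: cdisk_eq0 => e e0; apply: le_trans (ltW e0).
  apply: (@le_lim_pow _ _ _ (B * x + 2 * (C / (1 - x))) _ x01) => M; rewrite add0r.
  have -> : f z - f 0 - l * z = (f z - psum a M.+1 z) - (l - psum (fun n => a n.+1) M z) * z.
    rewrite f0 [psum a _ _]/psum big_ord_recl expr0 mulr1 mulrBl /psum mulr_suml.
    have -> : \sum_(i < M) a (lift ord0 i) * z ^+ lift ord0 i = \sum_(i < M) a i.+1 * z ^+ i * z.
      by apply: eq_bigr => i _; rewrite lift0 exprSr mulrA.
    ring.
  apply: le_trans (cmodB_le _ _) _; rewrite [leRHS]mulrDl; apply: lerD.
    by rewrite -mulrA -exprS; exact: h2.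
  rewrite cmodM; apply: le_trans (hl M); apply: ler_piMr; first exact: cmod_ge0.
  by apply: le_trans zr _; exact: ltW.
move=> r /andP[r0 r1]; have [|rp] := ltP 0 r; first by move=> h; exact: key.
(* The estimate above divides by the radius; at radius 0 the bounds obtained for 1/2 serve as
   well. *)
have -> : r = 0 by apply/eqP; rewrite eq_le rp.
have k1 : 0 < 2^-1 :> R by rewrite invr_gt0.
have k2 : 2^-1 < 1 :> R by rewrite invf_lt1 // ltr1n.
have [B [x [B0 x01 h1 h2]]] := key _ k1 k2.
exists B, x; split => // [n|z N z0].
  apply: le_trans (h1 n); apply: ler_wpM2l; first exact: cmod_ge0.
  by apply: lerXn2r; rewrite ?nnegrE ?invr_ge0.
by apply: h2; apply: le_trans z0 _; rewrite invr_ge0.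
Qed.

Lemma psr_iter_backward a f n : psr a f -> psr (fun m => a (n + m)%N) (iter n (@backward_shift R) f).
Proof.
move=> af; elim: n => [|n IH]; first exact: af.
rewrite iterS; have := psr_backward_shift IH.
by have -> : (fun m => a (n + m.+1)%N) = (fun m => a (n.+1 + m)%N) by apply/funext => m; rewrite addnS.
Qed.

Lemma iter_shift f n z : iter n (@Defs.shift R) f z = z ^+ n * f z.
Proof. by elim: n => [|n IH]; rewrite ?expr0 ?mul1r // iterS /Defs.shift IH exprS mulrA. Qed.

Lemma psr_mulzX a f n : psr a f ->
  psr (fun m => if (m < n)%N then 0 else a (m - n)%N) (fun z => z ^+ n * f z).
Proof.
move=> af; elim: n => [|n IH].
  apply: (psr_ext (f := f)); first by move=> z _; rewrite expr0 mul1r.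
  by have -> : (fun m => if (m < 0)%N then 0 else a (m - 0)%N) = a by apply/funext => m; rewrite subn0.
have := psr_mulz IH.
have -> : mulz_coef (fun m => if (m < n)%N then 0 else a (m - n)%N) =
    (fun m => if (m < n.+1)%N then 0 else a (m - n.+1)%N).
  by apply/funext => -[|m].
by apply: psr_ext => z _; rewrite exprS mulrA.
Qed.

(* Each of the n factors z is removed by one backward shift, at the cost of the
   denominator m + 1 of integration becoming n + m + 1. *)
Lemma psr_shifted_integral c h F n : psr c h -> (forall z, cmod z < 1 -> F z = z ^+ n * h z) ->
  psr (fun m => c m * ((n + m).+1%:R^-1 : R)%:C) (iter n.+1 (@backward_shift R) (segment_integral F)).
Proof.
move=> ch hF; have pF : psr (fun m => if (m < n)%N then 0 else c (m - n)%N) F.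
  by apply: (psr_ext _ (psr_mulzX n ch)) => z z1; rewrite hF.
have := psr_iter_backward n.+1 (psr_segment_integral pF).
suff -> : (fun m => acoef (fun m => if (m < n)%N then 0 else c (m - n)%N) (n.+1 + m)) =
  (fun m => c m * ((n + m).+1%:R^-1 : R)%:C) by [].
by apply/funext => m; rewrite addSn /= ltnNge leq_addr /= addKn.
Qed.

(** Dominated convergence in the space of square summable sequences: the weights are at most 1,
    which handles the tail from [M] on, and at most [M / (n + 1)] on the first [M] coefficients. *)
Lemma weighted_vanish c (C : R) (F : nat -> R[i] -> R[i]) :
  (forall N, \sum_(m < N) cmod (c m) ^+ 2 <= C) ->
  (forall n, psr (fun m => (m%:R / (n + m).+1%:R : R)%:C * c m) (F n.+1)) ->
  H2norm (F n) @[n --> \oo] --> (0 : \bar R)%E.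
Proof.
move=> hC hF; have C0 : 0 <= C by have := hC 0%N; rewrite big_ord0.
have key e : 0 < e -> exists N, forall n, (N <= n)%N -> (0 <= H2norm (F n) <= e%:E)%E.
  move=> e0; have e2 : 0 < e ^+ 2 / 2 by rewrite divr_gt0 // exprn_gt0.
  have [M hM] := l2_tail (fun n => sqr_ge0 (cmod (c n))) hC e2.
  pose D := C * M%:R / (e ^+ 2 / 2).
  have D0 : 0 <= D by rewrite divr_ge0 ?(ltW e2) // mulr_ge0.
  (* The successor excludes the index 0, about which [hF] says nothing. *)
  exists (Num.bound D).+1 => -[//|n]; rewrite ltnS => Nn.
  have hn : D < n.+1%:R.
    apply: lt_le_trans (archi_boundP D0) _; rewrite ler_nat; exact: leqW.
  have hF' := hol_cont (psr_hol (hF n)).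
  rewrite H2norm_ge0 //=; apply: H2norm_le => //; first exact: ltW.
  move=> r r0 r1; apply: (parseval_ge (hF n)); first by rewrite r0 r1.
  move=> N; set w : nat -> R := fun m => m%:R / (n + m).+1%:R.
  have w0 m : 0 <= w m by rewrite divr_ge0.
  have w1 m : w m <= 1 by rewrite ler_pdivrMr ?ltr0n // mul1r ler_nat leqW // leq_addl.
  have wM m : (m < M)%N -> w m <= M%:R / n.+1%:R.
    move=> mM; apply: ler_pM => //; rewrite ?invr_ge0 //; first by rewrite ler_nat ltnW.
    by rewrite lef_pV2 ?posrE ?ltr0n // ler_nat ltnS leq_addr.
  have tm m : cmod ((w m)%:C * c m) ^+ 2 * (r ^+ m) ^+ 2 <=
      cmod (c m) ^+ 2 * (M%:R / n.+1%:R) + (if (m < M)%N then 0 else cmod (c m) ^+ 2).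
    have cm := sqr_ge0 (cmod (c m)).
    have rm : (r ^+ m) ^+ 2 <= 1 by rewrite -exprM exprn_ile1 // ltW.
    have mn : 0 <= (M%:R / n.+1%:R : R) by rewrite divr_ge0.
    have wc : 0 <= cmod ((w m)%:C * c m) ^+ 2 by exact: sqr_ge0.
    apply: le_trans (ler_piMr wc rm) _.
    rewrite cmodM exprMn cmodR (ger0_norm (w0 m)) mulrC.
    have ww : w m ^+ 2 <= w m by rewrite expr2; apply: ler_piMr.
    case: ifP => mM.
      by rewrite addr0; apply: ler_wpM2l => //; apply: le_trans ww (wM m mM).
    rewrite -[leLHS]add0r; apply: lerD; first exact: mulr_ge0.
    by apply: ler_piMr => //; apply: le_trans ww (w1 m).
  apply: (@le_trans _ _ (\sum_(m < N) (cmod (c m) ^+ 2 * (M%:R / n.+1%:R) +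
      (if (m < M)%N then 0 else cmod (c m) ^+ 2)))); first by apply: ler_sum => m _; exact: tm.
  rewrite big_split /= -mulr_suml [e ^+ 2]splitr; apply: lerD; last exact: hM.
  apply: (@le_trans _ _ (C * (M%:R / n.+1%:R))).
    by apply: ler_wpM2r; [rewrite divr_ge0|exact: hC].
  by rewrite mulrA ler_pdivrMr ?ltr0n // -ler_pdivrMl // mulrC; exact: ltW.
apply/fine_cvgP; split.
  have [N hN] := key 1 ltr01; exists N => // n /= /hN /andP[h1 h2].
  by rewrite ge0_fin_numE // (le_lt_trans h2) // ltry.
apply/cvgrPdist_le => e e0; have [N hN] := key e e0; exists N => // n /= /hN /andP[h1 h2].
rewrite sub0r normrN ger0_norm ?fine_ge0 //.
have fn : H2norm (F n) \is a fin_num by rewrite ge0_fin_numE // (le_lt_trans h2) // ltry.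
by rewrite -lee_fin fineK.
Qed.

Lemma bounded_operator_m2 (S : (R[i] -> R[i]) -> R[i] -> R[i]) (C : R) : 0 <= C ->
  (forall f, holomorphic_disk f -> holomorphic_disk (S f)) ->
  (forall (k : R[i]) f h, holomorphic_disk f -> holomorphic_disk h -> forall z, cmod z < 1 ->
    S (fun w => k * f w + h w) z = k * S f z + S h z) ->
  (forall f r, holomorphic_disk f -> 0 <= r -> r < 1 -> m2 (S f) r <= C * m2 f r) ->
  bounded_operator S.
Proof.
move=> C0 Sh Sl Sm.
have key f : H2 f -> H2 (S f) /\ (H2norm (S f) <= (Num.sqrt C)%:E * H2norm f)%E.
  move=> Hf; have hf := proj1 Hf; apply: (H2norm_bounded (sqrtr_ge0 C) Hf (Sh f hf)) => r r0 r1 D hD.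
  rewrite sqr_sqrtr //; apply: le_trans (Sm f r hf r0 r1) _.
  by apply: ler_wpM2l => //; exact: hD.
split; first by move=> f /key [].
  by move=> k f h Hf Hh z; rewrite diskE => z1; exact: (Sl k f h (proj1 Hf) (proj1 Hh) z z1).
by exists (Num.sqrt C) => f /key [].
Qed.

Lemma hol_segment_integral f : holomorphic_disk f -> holomorphic_disk (segment_integral f).
Proof. by move=> hf; exact: psr_hol (psr_segment_integral (hol_psr hf)). Qed.

Lemma segment_integral_linear (k : R[i]) F G H z : holomorphic_disk F -> holomorphic_disk G -> cmod z < 1 ->
  (forall w, cmod w < 1 -> H w = k * F w + G w) ->
  segment_integral H z = k * segment_integral F z + segment_integral G z.
Proof.
move=> hF hG z1 hH.
have iz (P : R[i] -> R[i]) : holomorphic_disk P -> cintble 0 1 (fun t => P (t%:C * z) * z).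
  move=> hP; apply: eq_cintble (cintbleZ z (ccont_cintble (ccont_ray (hol_cont hP) z1))).
  by move=> t _; rewrite mulrC.
rewrite /segment_integral -!/(cint _ _ _) -(cintZ k (iz F hF)) -cintD; last 2 first.
- by apply: cintbleZ; exact: iz.
- exact: iz.
apply: eq_cint => t /andP[t0 t1]; rewrite hH; first by ring.
rewrite cmodM cmodR ger0_norm //; apply: le_lt_trans z1.
by apply: ler_piMl => //; exact: cmod_ge0.
Qed.

Lemma Vop_bounded g : BMOA g -> bounded_operator (Vop g).
Proof.
move=> [Hg Bg]; have hg := proj1 Hg; have [K K0 hK] := garsia Hg Bg.
have hI f : holomorphic_disk f -> holomorphic_disk (fun u => f u * cderiv g u).
  by move=> hf; exact: holM hf (hol_deriv hg).
apply: (@bounded_operator_m2 _ (4 * expR (K / T))).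
- by rewrite mulr_ge0 // expR_ge0.
- by move=> f hf; exact: hol_segment_integral (hI f hf).
- move=> k f h hf hh z z1; apply: segment_integral_linear (hI f hf) (hI h hh) z1 _.
  by move=> w _; ring.
- by move=> f r hf r0 r1; exact: volterra_m2 Hg K0 hK hf r0 r1.
Qed.

Lemma mul_bounded g : Hinfty g -> bounded_operator (fun f z => g z * f z).
Proof.
move=> [hg [M hM]]; apply: (@bounded_operator_m2 _ (M ^+ 2)).
- exact: sqr_ge0.
- by move=> f hf; exact: holM hg hf.
- by move=> k f h hf hh z z1; ring.
move=> f r hf r0 r1; rewrite /m2 mulrCA; apply: ler_wpM2l; first by rewrite invr_ge0 T_ge0.
have i1 := intble_circle2 0 T (hol_cont hf) r0 r1.
rewrite -(rintZ _ i1); apply: le_rint.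
- exact: intble_circle2 (hol_cont (holM hg hf)) r0 r1.
- exact: intbleZ.
move=> t _; rewrite cmodM exprMn; apply: ler_wpM2r; first exact: sqr_ge0.
have := hM (r%:C * cis t); rewrite diskE cmod_circle // => /(_ r1) h.
by apply: lerXn2r; rewrite ?nnegrE ?cmod_ge0 // (le_trans _ h) // cmod_ge0.
Qed.

Lemma zero_bounded : bounded_operator (fun _ _ => 0 : R[i]).
Proof.
apply: (@bounded_operator_m2 _ 0).
- exact: lexx.
- by move=> f hf; apply: cdiff_hol => z z1; exists 0; exact: cdiff_cst.
- by move=> k f h _ _ z _; rewrite mulr0 addr0.
move=> f r hf r0 r1; rewrite mul0r /m2 (eq_rint (v := fun=> 0)).
  by rewrite rint_cst ?T_ge0 // mul0r mulr0.
by move=> t _; rewrite cmod0 expr0n.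
Qed.

Lemma cderiv_lin (k : R[i]) f h z : holomorphic_disk f -> holomorphic_disk h -> cmod z < 1 ->
  cderiv (fun w => k * f w + h w) z = k * cderiv f z + cderiv h z.
Proof.
move=> hf hh z1.
have := cdiffD (cdiffM (cdiff_cst k z) (hol_cdiff hf z1)) (hol_cdiff hh z1).
by rewrite mul0r add0r => /cdiff_cderiv [].
Qed.

Lemma Sop_bounded g : Hinfty g -> bounded_operator (Sop g).
Proof.
(* The added 1 keeps the constant invertible when the bound [M] is 0. *)
move=> [hg [M hM]]; have M2 : 0 < M ^+ 2 + 1 by rewrite ltr_wpDl // sqr_ge0.
have hI f : holomorphic_disk f -> holomorphic_disk (fun u => cderiv f u * g u).
  by move=> hf; exact: holM (hol_deriv hf) hg.
apply: (@bounded_operator_m2 _ (2 * (M ^+ 2 + 1))).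
- by rewrite mulr_ge0 // ltW.
- by move=> f hf; exact: hol_segment_integral (hI f hf).
- move=> k f h hf hh z z1; apply: segment_integral_linear (hI f hf) (hI h hh) z1 _.
  by move=> w w1; rewrite (cderiv_lin k hf hh w1) mulrDl mulrA.
move=> f r hf r0 r1; pose k u := cderiv f u * g u.
have c0 : 0 < (M ^+ 2 + 1)^-1 by rewrite invr_gt0.
have lp : (M ^+ 2 + 1)^-1 * m2 (segment_integral k) r <= 2 * (\sum_(j < 1) m2 f r) + 4 * 0.
  apply: (littlewood_paley (h := fun=> f) (hI f hf) (fun=> hf) r0 r1 (ltW c0) (lexx 0)) => s /andP[s0 sr]; have s1 := le_lt_trans sr r1.
  rewrite big_ord1 addr0 ler_pdivrMl // /m2 mulrCA; apply: ler_wpM2l; first by rewrite invr_ge0 T_ge0.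
  have i1 := intble_circle2 0 T (hol_cont (hol_deriv hf)) s0 s1.
  rewrite -(rintZ _ i1); apply: le_rint.
  - exact: intble_circle2 (hol_cont (hI f hf)) s0 s1.
  - exact: intbleZ.
  move=> t _; rewrite /k cmodM exprMn mulrC; apply: ler_wpM2r; first exact: sqr_ge0.
  have := hM (s%:C * cis t); rewrite diskE cmod_circle // => /(_ s1) h.
  apply: (@le_trans _ _ (M ^+ 2)); last by rewrite lerDl.
  by apply: lerXn2r; rewrite ?nnegrE ?cmod_ge0 // (le_trans _ h) // cmod_ge0.
move: lp; rewrite big_ord1 mulr0 addr0 ler_pdivrMl // => h; apply: le_trans h _.
by rewrite mulrCA mulrA.
Qed.

Lemma Vop_vanish g : BMOA g -> strong_cvg (shift_conj (Vop g)) (fun _ _ => 0).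
Proof.
move=> BG; have [Hg Bg] := BG; have hg := proj1 Hg; move=> f Hf; have hf := proj1 Hf.
have hk := holM hf (hol_deriv hg); have pk := hol_psr hk; set d := tcoef _ in pk.
have pV := psr_segment_integral pk.
have HV : H2 (Vop g f) by have [h _ _] := Vop_bounded BG; exact: h.
have [C hC] := psr_H2_sum pV HV.
apply: (weighted_vanish hC) => n.
have pz := psr_mulz pk.
(* Integration raises degrees by one, so the [n + 1] backward shifts correspond to [n] factors [z]
   of the integrand; the last factor stays with [f * g']. *)
have E z : cmod z < 1 -> iter n.+1 (@Defs.shift R) f z * cderiv g z = z ^+ n * (z * (f z * cderiv g z)).
  by move=> _; rewrite iter_shift exprSr; ring.
have := psr_shifted_integral pz E.
have -> : (fun m => mulz_coef d m * ((n + m).+1%:R^-1 : R)%:C) =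
    (fun m => (m%:R / (n + m).+1%:R : R)%:C * acoef d m).
  apply/funext => -[|m]; first by rewrite /= mul0r mulr0.
  rewrite /= [RHS]mulrCA -rmorphM /=; congr (_ * _%:C); rewrite mulrAC divff ?mul1r //.
by apply: psr_ext => z _; rewrite subr0.
Qed.

Lemma Sop_vanish g : Hinfty g -> strong_cvg (shift_conj (Sop g)) (fun f z => g z * f z).
Proof.
move=> Gg; have hg := proj1 Gg; move=> f Hf; have hf := proj1 Hf.
have hp := holM hg hf; have pp := hol_psr hp; set p := tcoef _ in pp.
have hq := holM (hol_deriv hf) hg; have pq := hol_psr hq; set q := tcoef _ in pq.
have pS := psr_segment_integral pq.
have HS : H2 (Sop g f) by have [h _ _] := Sop_bounded Gg; exact: h.
have HM : H2 (fun z => g z * f z) by have [h _ _] := mul_bounded Gg; exact: h.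
have [C hC] := psr_H2_sum pS HS; have [D hD] := psr_H2_sum pp HM.
pose c m := acoef q m - p m.
have hc N : \sum_(m < N) cmod (c m) ^+ 2 <= 2 * C + 2 * D.
  apply: (@le_trans _ _ (\sum_(m < N) (2 * cmod (acoef q m) ^+ 2 + 2 * cmod (p m) ^+ 2))).
    by apply: ler_sum => m _; apply: le_trans (sqr_cmodD_le _ _) _; rewrite cmodN.
  rewrite big_split /= -!mulr_sumr; apply: lerD; apply: ler_wpM2l => //; [exact: hC|exact: hD].
apply: (weighted_vanish hc) => n.
(* The product rule for [z ^+ n.+1 * f z] after removal of [z ^+ n]: the derivative of the power
   supplies the multiple of [g * f] that survives in the limit. *)
pose h z := n.+1%:R * (g z * f z) + z * (cderiv f z * g z).
have ph : psr (fun m => n.+1%:R * p m + mulz_coef q m) h.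
  by apply: psrD; [exact: psrZ|exact: psr_mulz].
have E z : cmod z < 1 -> cderiv (iter n.+1 (@Defs.shift R) f) z * g z = z ^+ n * h z.
  move=> z1; have := cdiffM (cdiffX n.+1 (cdiff_id z)) (hol_cdiff hf z1).
  have -> : (fun w => w ^+ n.+1 * f w) = iter n.+1 (@Defs.shift R) f.
    by apply/funext => w; rewrite iter_shift.
  by move=> /cdiff_cderiv [_ ->]; rewrite /h exprSr mulr1 [_.+1.-1]/=; ring.
have := psrD (psr_shifted_integral ph E) (psrZ (-1) pp).
(* The coefficient is the average of [p m] and [acoef q m] with weights [n + 1] and [m]; subtracting
   [p m] leaves the fraction [m / (n + m + 1)] of their difference. *)
have -> : (fun m => (n.+1%:R * p m + mulz_coef q m) * ((n + m).+1%:R^-1 : R)%:C + -1 * p m) =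
    (fun m => (m%:R / (n + m).+1%:R : R)%:C * c m).
  apply/funext => m; rewrite /c rmorphM /= !fmorphV !rmorph_nat.
  have nz : (n + m).+1%:R != 0 :> R[i] by rewrite pnatr_eq0.
  have -> : mulz_coef q m = m%:R * acoef q m.
    case: m {nz} => [|m]; first by rewrite /= mul0r.
    rewrite /= fmorphV rmorph_nat mulrCA divff ?mulr1 //.
  have En : (n + m).+1%:R = n.+1%:R + m%:R :> R[i] by rewrite -addSn natrD.
  rewrite En in nz *; move: (n.+1%:R : R[i]) (m%:R : R[i]) nz (acoef q m) (p m) => x y nz u v.
  by field.
by apply: psr_ext => z _; rewrite mulN1r.
Qed.

End operators.

(** * Toeplitz symbols *)

Section toeplitz.
Context {R : realType}.
Implicit Types (f g h k : R[i] -> R[i]) (z : R[i]) (t e : R).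
Local Notation T := (2 * pi : R).
Local Notation mu := (@lebesgue_measure R).

Lemma Hinfty_H2 g : Hinfty g -> H2 g.
Proof.
move=> [hg [M hM]]; have M0 : 0 <= M.
  by apply: le_trans (cmod_ge0 (g 0)) (hM 0 _); rewrite diskE cmod0 ltr01.
apply: (m2_H2 hg M0) => r r0 r1; have T0 := @twopi_gt0 R.
rewrite /m2 ler_pdivrMl //.
have -> : T * M ^+ 2 = rint 0 T (fun=> M ^+ 2) by rewrite rint_cst ?T_ge0 // subr0 (mulrC T).
apply: le_rint; [exact: intble_circle2 (hol_cont hg) r0 r1|exact: intble_cst|].
move=> t _; have := hM (r%:C * cis t); rewrite diskE cmod_circle // => /(_ r1) h.
by apply: lerXn2r; rewrite ?nnegrE ?cmod_ge0.
Qed.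

Lemma rlimM f g z (l m : R[i]) : rlim f z l -> rlim g z m -> rlim (fun w => f w * g w) z (l * m).
Proof.
move=> fl gm e e0.
pose A := 1 + cmod l + cmod m; have A0 : 0 < A.
  by rewrite /A -addrA ltr_pwDl // addr_ge0 ?cmod_ge0.
pose d := Num.min 1 (e / A / 2); have d0 : 0 < d by rewrite lt_min ltr01 !divr_gt0.
have [s s1 hs] := fl _ d0; have [s' s'1 hs'] := gm _ d0.
exists (Num.max s s') => [|r]; first by rewrite gt_max s1.
rewrite gt_max => /andP[sr s'r] r1; have h1 := hs r sr r1; have h2 := hs' r s'r r1.
have dA : d <= e / A / 2 by rewrite ge_min lexx orbT.
have d1 : d <= 1 by rewrite ge_min lexx.
set x := f _ in h1 *; set y := g _ in h2 *.
have -> : x * y - l * m = (x - l) * (y - m) + ((x - l) * m + l * (y - m)) by ring.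
apply: le_trans (cmodD _ _) _; rewrite cmodM.
have k1 : cmod (x - l) * cmod (y - m) <= d * 1.
  by apply: ler_pM; rewrite ?cmod_ge0 // (le_trans h2).
have k2 : cmod ((x - l) * m + l * (y - m)) <= d * cmod m + cmod l * d.
  apply: le_trans (cmodD _ _) _; rewrite !cmodM; apply: lerD.
    by apply: ler_wpM2r => //; exact: cmod_ge0.
  by apply: ler_wpM2l => //; exact: cmod_ge0.
apply: le_trans (lerD k1 k2) _.
have -> : d * 1 + (d * cmod m + cmod l * d) = d * A by rewrite /A; ring.
apply: le_trans (ler_wpM2r (ltW A0) dA) _.
have -> : e / A / 2 * A = e / 2 by field; rewrite gt_eqF.
lra.
Qed.

Lemma bval0 z : bval (fun=> 0 : R[i]) z = 0.
Proof.
apply: rlim_bval => e e0; exists 0 => [|r _ _]; first exact: ltr01.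
by rewrite subrr cmod0 ltW.
Qed.

Lemma cmeasT_measurableT (u : R[i] -> R[i]) : cmeas [set: R] (fun t => u (cis t)) -> Defs.measurableT u.
Proof. by case. Qed.

Lemma rint_null (v : R -> R) (Z : set R) : measurable_fun [set: R] v -> measurable Z -> mu Z = 0%E ->
  (forall t, 0 <= t <= T -> ~ Z t -> v t = 0) -> rint 0 T v = 0.
Proof.
move=> mv mZ Z0 hv; rewrite /rint /Rintegral (_ : (\int[mu]_(t in _) _)%E = 0%E) //.
rewrite (_ : 0%E = (\int[mu]_(t in `[0%R, T]) (cst 0%E) t)%E); last by rewrite integral0.
apply: ae_eq_integral => //.
- by apply/measurable_EFinP; exact: measurable_funTS.
- exists Z; split => // t /= h; apply: contrapT => nZ; apply: h.
  by rewrite in_itv /= => ht; rewrite hv.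
Qed.

Lemma zero_toeplitz : is_Toeplitz (fun=> 0 : R[i]) (fun _ _ => 0).
Proof.
have m0 : Defs.measurableT (fun=> 0 : R[i]) by apply: cmeasT_measurableT; exact: cmeas_cst.
have H0 : H2 (fun=> 0 : R[i]).
  apply: Hinfty_H2; split; first by apply: cdiff_hol => z _; exists 0; exact: cdiff_cst.
  by exists 0 => z _; rewrite cmod0.
split; first by split => //; exists 0; apply: aeW => t; rewrite cmod0.
move=> f Hf; have -> : (fun w => 0 * bval f w) = (fun=> 0 : R[i]) by apply/funext => w; rewrite mul0r.
split => //.
  split => //; rewrite (eq_integral (fun=> 0%E)); first by rewrite integral0 ltry.
  by move=> t _; rewrite cmod0 expr0n.
move=> k Hk; rewrite /L2dot (_ : Cintegral _ _ = 0) ?mulr0 //.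
rewrite -/(cint 0 T _) (eq_cint (v := fun=> 0)) => [|t _]; last by rewrite bval0 subrr mul0r.
by rewrite cint_cst ?T_ge0 // mul0r.
Qed.

(** No projection has to be computed: [g * f] lies in H^2 already and its boundary values are almost
    everywhere the product, so the function integrated against [bval k] vanishes almost
    everywhere. *)
Lemma mul_toeplitz g : Hinfty g -> is_Toeplitz (bval g) (fun f z => g z * f z).
Proof.
move=> Gg; have Hg := Hinfty_H2 Gg; have hg := proj1 Hg.
have mg := cmeas_bval (hol_cont hg).
have [M hM] : exists M, forall t, cmod (bval g (cis t)) <= M.
  by case: Gg => _ [M0 hM0]; exact: bval_bounded hM0.
split.
  by split; [exact: cmeasT_measurableT|exists M; apply: aeW].
move=> f Hf; have hf := proj1 Hf; have mf := cmeas_bval (hol_cont hf).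
have Hgf : H2 (fun z => g z * f z) by have [h _ _] := mul_bounded Gg; exact: h.
have mgf := cmeas_bval (hol_cont (proj1 Hgf)).
have mp := cmeasM mg mf.
split => //.
  split; first exact: cmeasT_measurableT.
  have i2 : intble 0 T (fun t => cmod (bval g (cis t) * bval f (cis t)) ^+ 2).
    apply: (@intble_dom _ _ _ _ (fun t => M ^+ 2 * cmod (bval f (cis t)) ^+ 2)).
    - by apply: measurable_funTS; exact: measurable_sqcmod mp.
    - by apply: intbleZ; exact: bval_intble2.
    - move=> t _; rewrite ger0_norm ?sqr_ge0 // cmodM exprMn; apply: ler_wpM2r; first exact: sqr_ge0.
      by apply: lerXn2r; rewrite ?nnegrE ?cmod_ge0 // (le_trans _ (hM t)) // cmod_ge0.
  by rewrite (rint_EFin i2) ltry.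
move=> k Hk; have mk := cmeas_bval (hol_cont (proj1 Hk)).
have [Z1 [mZ1 Z10 hZ1]] := radial_limit_ae Hg; have [Z2 [mZ2 Z20 hZ2]] := radial_limit_ae Hf.
pose Z := Z1 `|` Z2; have mZ : measurable Z by exact: measurableU.
have Z0 : mu Z = 0%E by exact: null_set_setU.
pose v t := (bval g (cis t) * bval f (cis t) - bval (fun z => g z * f z) (cis t)) * (bval k (cis t))^*.
have v0 t : 0 <= t <= T -> ~ Z t -> v t = 0.
  move=> ht nZ; have [l1 h1] := hZ1 t ht (fun q => nZ (or_introl q)).
  have [l2 h2] := hZ2 t ht (fun q => nZ (or_intror q)).
  by rewrite /v (rlim_bval h1) (rlim_bval h2) (rlim_bval (rlimM h1 h2)) subrr mul0r.
have mv : cmeas [set: R] v.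
  by apply: cmeasM; [exact: cmeasB mp mgf|exact: cmeasJ].
rewrite /L2dot; apply/eqP; rewrite mulf_eq0; apply/orP; right; apply/eqP.
rewrite -[LHS]/(cint 0 T v) cintE.
by case: mv => m1 m2; rewrite (rint_null m1 mZ Z0) ?(rint_null m2 mZ Z0) // => t ht nZ; rewrite v0.
Qed.

End toeplitz.

Theorem theorem3p5 (R : realType) :
  (forall g : R[i] -> R[i], BMOA g ->
     strongly_asymptotically_Toeplitz (Vop g) /\
     strong_asymptotic_symbol (Vop g) (fun=> 0)) /\
  (forall g : R[i] -> R[i], Hinfty g ->
     strongly_asymptotically_Toeplitz (Sop g) /\
     strong_asymptotic_symbol (Sop g) (bval g)).
Proof.
split=> g Gg; (split; first split).
- exact: Vop_bounded.
- by exists (fun _ _ => 0); split; [exact: zero_bounded|exact: Vop_vanish].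
- by exists (fun _ _ => 0); split; [exact: zero_bounded|exact: Vop_vanish|exact: zero_toeplitz].
- exact: Sop_bounded.
- by exists (fun f z => g z * f z); split; [exact: mul_bounded|exact: Sop_vanish].
- by exists (fun f z => g z * f z); split; [exact: mul_bounded|exact: Sop_vanish|exact: mul_toeplitz].
Qed.
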